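(* Let $\mathfrak g$ be a symmetrizable Kac--Moody superalgebra (as in the context) and let $M$ be a highest weight $\mathfrak g$-supermodule with highest weight $\Lambda$. Suppose that $M\otimes M(\mathfrak g_{\bar1})$ contains a highest weight $\mathfrak g_{\bar0}$-submodule $V(\mu)$ of highest weight $\mu$. Then $\mathrm D^2_{\mathfrak g,\mathfrak g_{\bar0}}$ acts on $V(\mu)$ by the scalar $$B(\Lambda+\rho,\Lambda+\rho)-B(\mu+\rho_{\bar0},\mu+\rho_{\bar0}).$$ In particular, $V(\mu)\subset\ker\mathrm D^2_{\mathfrak g,\mathfrak g_{\bar0}}$ if and only if $B(\Lambda+\rho,\Lambda+\rho)=B(\mu+\rho_{\bar0},\mu+\rho_{\bar0})$.
   Context: Kac--Moody superalgebras: for $I=\{1,\dots,n\}$, an $n\times n$ matrix $A=(a_{ij})$ with $a_{ii}\in\{0,2\}$, a parity function $p:I\to\mathbb Z_2$, and $\mathfrak h$ even of dimension $2n-\operatorname{rk}A$ with linearly independent $\alpha_i\in\mathfrak h^*$, $h_i\in\mathfrak h$, $\alpha_j(h_i)=a_{ij}$, let $\mathfrak g(A)$ be the Lie superalgebra generated by $\mathfrak h$ and $X_i,Y_i$ (parity $p(i)$) with $[h,X_i]=\alpha_i(h)X_i$, $[h,Y_i]=-\alpha_i(h)Y_i$, $[X_i,Y_j]=\delta_{ij}h_i$, $[\mathfrak h,\mathfrak h]=0$, modulo the maximal ideal meeting $\mathfrak h$ trivially. It is a Kac--Moody superalgebra if it is quasisimple (every ideal is contained in $\mathfrak h$ or together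 with $\mathfrak h$ spans), regular ($a_{ij}=0\Rightarrow a_{ji}=0$) and admissible ($a_{ii}=0,p(i)=\bar0\Rightarrow a_{ij}=0\ \forall j$; $a_{ii}=2,p(i)=\bar0\Rightarrow a_{ij}\in\mathbb Z_{\le0}$ for $j\ne i$; $a_{ii}=2,p(i)=\bar1\Rightarrow a_{ij}\in2\mathbb Z_{\le0}$ for $j\neq i$); symmetrizable if $DA$ is symmetric for an invertible diagonal $D=\operatorname{diag}(d_i)$, in which case it has the nondegenerate even supersymmetric invariant standard form $B$ with $B(h,h_j)=d_j\alpha_j(h)$; $B$ also denotes the induced form on $\mathfrak h^*$. Standing assumption: $B(\alpha,\beta)\in\mathbb R$ for all simple roots. Principal grading: $\deg X_i=1$, $\deg Y_i=-1$, $\deg\mathfrak h=0$. Triangular decomposition $\mathfrak g=\mathfrak n^-\oplus\mathfrak h\oplus\mathfrak n^+$, $\mathfrak b=\mathfrak h\oplus\mathfrak n^+$. Weyl vector $\rho\in\mathfrak h^*$: $\rho(h_i)=\tfrac12\alpha_i(h_i)$. Standing assumption for the relative Dirac operator: the Kac--Peterson class of $\mathfrak g_{\bar0}$ is trivial, i.e. there is $\rho_{\bar0}\in\mathfrak h^*$ (extended by zero to root spaces) with $\rho_{\bar0}([x,y])=\tfrac12\operatorname{tr}(\mathrm{ad}_x\pi_-\mathrm{ad}_y\pi_+)-\tfrac12\operatorname{tr}(\mathrm{ad}_y\pi_-\mathrm{ad}_x\pi_+)$ on $\mathfrak g_{\bar0}$, $\pi_\pm$ the projections of $\mathfrak g_{\bar0}$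 onto its parts of positive, resp. nonpositive, principal degree. Put $\rho_{\bar1}=\rho_{\bar0}-\rho$. Highest weight supermodule of highest weight $\Lambda$: an $\mathfrak h$-weight supermodule with finite-dimensional weight spaces generated by a vector $v_\Lambda\ne0$ of weight $\Lambda$ with $\mathfrak n^+v_\Lambda=0$; highest weight $\mathfrak g_{\bar0}$-modules are analogous, relative to $\mathfrak b\cap\mathfrak g_{\bar0}$. Oscillator module: put $(\mathfrak g_{\bar1})_\pm=\mathfrak g_{\bar1}\cap\mathfrak n^\pm$ with bases of root vectors $(x_a)$ of $(\mathfrak g_{\bar1})_-$ and $(\partial_a)$ of $(\mathfrak g_{\bar1})_+$, $B(\partial_a,x_b)=\tfrac12\delta_{ab}$. $\mathrm{Cl}(\mathfrak g_{\bar1})$ (relations $xy-yx=2B(x,y)$) acts on $M(\mathfrak g_{\bar1})=S((\mathfrak g_{\bar1})_-)=\mathbb C[x_1,x_2,\dots]$, $x_a$ by multiplication, $\partial_a$ by $\partial/\partial x_a$. $x\in\mathfrak g_{\bar0}$ acts on $M(\mathfrak g_{\bar1})$ by $\pi(x)=\tfrac12\sum_a{:}[x,x_a]\partial_a{:}-\tfrac12\sum_a{:}[x,\partial_a]x_a{:}-\rho_{\bar1}(x)$, ${:}\ {:}$ placing elements of $(\mathfrak g_{\bar1})_-$ to the left of those of $(\mathfrak g_{\bar1})_+$; $\mathfrak g_{\bar0}$ acts diagonally on $M\otimes M(\mathfrak g_{\bar1})$. The relative Dirac operator on $M\otimes M(\mathfrak g_{\bar1})$ is $\mathrm D_{\mathfrak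 g,\mathfrak g_{\bar0}}=2\sum_a(x_a\otimes\partial_a-\partial_a\otimes x_a)$ with $(y\otimes z)(v\otimes P)=(-1)^{p(v)}yv\otimes zP$ for $y,z\in\mathfrak g_{\bar1}$ (finitely many nonzero terms on each vector).
   Formalization: The context's normalization B(h,h_j)=d_jα_j(h) conflicts with DA symmetric (no symmetric B for A=(2,-2;-1,2), D=diag(1,2)); the formal statement keeps DA symmetric and uses B(h,h_j)=d_j^{-1}α_j(h), the same family of forms after replacing D by its inverse. *)

(* Defs.v *)
From HB Require Import structures.
From mathcomp Require Import all_boot all_order all_algebra.
From mathcomp Require Import finmap boolp classical_sets functions fsbigop.
From mathcomp Require Import reals complex.
From mathcomp Require Import monalg.

Set Implicit Arguments.
Unset Strict Implicit.
Unset Printing Implicit Defensive.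

Import Order.TTheory GRing.Theory Num.Theory.

Local Open Scope classical_set_scope.
Local Open Scope ring_scope.

Section LinearAlgebra.
Variable K : fieldType.

Definition subspace (V : lmodType K) (W : set V) : Prop :=
  W 0 /\ forall (a : K) (u v : V), W u -> W v -> W (a *: u + v).

Definition lspan (V : lmodType K) (S : set V) : set V :=
  [set v | exists (k : nat) (c : 'I_k -> K) (e : 'I_k -> V),
     (forall i, S (e i)) /\ v = \sum_i c i *: e i].

Definition fin_dim (V : lmodType K) (W : set V) : Prop :=
  exists (k : nat) (e : 'I_k -> V), W `<=` lspan (range e).

Definition bilinear_map (U V W : lmodType K) (f : U -> V -> W) : Prop :=
  (forall u, linear (f u)) /\ (forall v, linear (f^~ v)).

(* {malg K[I]} is used as the type of finitely supported families (c_a). *)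
Definition lincomb (V : lmodType K) (I : choiceType) (e : I -> V)
    (c : {malg K[I]}) : V := \sum_(a <- msupp c) c@_a *: e a.

Definition is_basis (V : lmodType K) (W : set V) (I : choiceType)
    (e : I -> V) : Prop :=
  (forall a, W (e a)) /\
  (forall v, W v -> exists! c : {malg K[I]}, v = lincomb e c).

Definition coords (V : lmodType K) (I : choiceType) (e : I -> V) (v : V) :
    {malg K[I]} := xget 0 [set c | v = lincomb e c].

(* t is the trace of f on W when f|_W = sum_i v_i (x) phi_i has finite rank
   and t = sum_i phi_i(v_i); W may be infinite dimensional. *)
Definition is_trace_on (V : lmodType K) (W : set V) (f : V -> V) (t : K) :
    Prop :=
  exists (k : nat) (e : 'I_k -> V) (phi : 'I_k -> {linear V -> K^o}),
    [/\ forall i, W (e i),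
        forall z, W z -> f z = \sum_i (phi i z : K) *: e i
      & t = \sum_i (phi i (e i) : K)].

Definition trace_on (V : lmodType K) (W : set V) (f : V -> V) : K :=
  xget 0 [set t | is_trace_on W f t].

Record tensorProduct (V S : lmodType K) := TensorProduct {
  tp_space :> lmodType K;
  tens : V -> S -> tp_space;
  tens_bilinear : bilinear_map tens;
  tens_universal : forall (W : lmodType K) (f : V -> S -> W),
    bilinear_map f ->
    (exists F : {linear tp_space -> W}, forall v s, F (tens v s) = f v s) /\
    (forall F G : {linear tp_space -> W},
       (forall v s, F (tens v s) = G (tens v s)) -> forall t, F t = G t) }.

(* The operator f (x) g for linear f and g (no sign); well defined by
   universality. *)
Definition tmap (V S : lmodType K) (T : tensorProduct V S)
    (f : V -> V) (g : S -> S) (t : T) : T :=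
  xget 0 [set u | exists F : {linear T -> T},
            (forall v s, F (tens T v s) = tens T (f v) (g s)) /\ u = F t].

End LinearAlgebra.

Section Super.
Variable K : fieldType.

(* A Z/2-graded space is given by the two projections onto its homogeneous
   parts; parities are booleans, [true] being odd. *)
Record superSpace := SuperSpace {
  ss_space :> lmodType K;
  spr : bool -> {linear ss_space -> ss_space};
  spr_orth : forall (b c : bool) (v : ss_space),
    spr b (spr c v) = if b == c then spr c v else 0;
  spr_sum : forall v : ss_space, spr false v + spr true v = v }.

Definition homog (V : superSpace) (b : bool) : set V :=
  [set v | spr V b v = v].

(* v |-> (-1)^p(v) v *)
Definition parity_sign (V : superSpace) (v : V) : V :=
  spr V false v - spr V true v.

Record lieSuperalgebra := LieSuperalgebra {
  ls_space :> superSpace;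
  brk : ls_space -> ls_space -> ls_space;
  brk_bilinear : bilinear_map brk;
  brk_parity : forall (b c : bool) (x y : ls_space),
    homog b x -> homog c y -> homog (b (+) c) (brk x y);
  brk_anti : forall (b c : bool) (x y : ls_space),
    homog b x -> homog c y -> brk x y = - ((-1) ^+ (b && c) *: brk y x);
  brk_jacobi : forall (b c : bool) (x y z : ls_space),
    homog b x -> homog c y ->
    brk x (brk y z) = brk (brk x y) z + (-1) ^+ (b && c) *: brk y (brk x z) }.

Definition lie_hom (L L' : lieSuperalgebra) (f : {linear L -> L'}) : Prop :=
  (forall b x, homog b x -> homog b (f x)) /\
  (forall x y, f (brk x y) = brk (f x) (f y)).

Definition lie_ideal (L : lieSuperalgebra) (J : set L) : Prop :=
  [/\ subspace J,
      forall b x, J x -> J (spr L b x)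
    & forall x y, J y -> J (brk x y)].

Record superModule (L : lieSuperalgebra) := SuperModule {
  sm_space :> superSpace;
  sact : L -> sm_space -> sm_space;
  sact_bilinear : bilinear_map sact;
  sact_parity : forall (b c : bool) (x : L) (v : sm_space),
    homog b x -> homog c v -> homog (b (+) c) (sact x v);
  sact_brk : forall (b c : bool) (x y : L) (v : sm_space),
    homog b x -> homog c y ->
    sact (brk x y) v =
      sact x (sact y v) - (-1) ^+ (b && c) *: sact y (sact x v) }.

End Super.

Section KacMoody.
Variable K : numFieldType.

Record cartanDatum := CartanDatum {
  cd_n : nat;
  cd_A : 'M[K]_cd_n;
  cd_p : 'I_cd_n -> bool;
  cd_h : vectType K;
  cd_alpha : 'I_cd_n -> 'Hom(cd_h, K^o);
  cd_hh : 'I_cd_n -> cd_h;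
  cd_diag : forall i, cd_A i i = 0 \/ cd_A i i = 2;
  cd_dim : \dim {:cd_h} = (2 * cd_n - \rank cd_A)%N;
  cd_alpha_free : free [seq cd_alpha i | i <- enum 'I_cd_n];
  cd_hh_free : free [seq cd_hh i | i <- enum 'I_cd_n];
  cd_alphaE : forall i j, cd_alpha j (cd_hh i) = cd_A i j }.

Definition hdual (C : cartanDatum) := 'Hom(cd_h C, K^o).

Definition chevalley_relations (C : cartanDatum) (L : lieSuperalgebra K)
    (hL : cd_h C -> L) (X Y : 'I_(cd_n C) -> L) : Prop :=
  linear hL /\ (forall t, homog false (hL t)) /\
  (forall i, homog (cd_p i) (X i) /\ homog (cd_p i) (Y i)) /\
  (forall t i, brk (hL t) (X i) = (cd_alpha i t : K) *: X i) /\
  (forall t i, brk (hL t) (Y i) = - ((cd_alpha i t : K) *: Y i)) /\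
  (forall i j, brk (X i) (Y j) = if i == j then hL (cd_hh i) else 0) /\
  (forall s t, brk (hL s) (hL t) = 0).

(* L is the Lie superalgebra generated by h, X_i, Y_i with the defining
   relations above (no ideal divided out yet). *)
Definition presented_by_chevalley (C : cartanDatum) (L : lieSuperalgebra K)
    (hL : cd_h C -> L) (X Y : 'I_(cd_n C) -> L) : Prop :=
  [/\ chevalley_relations hL X Y,
      forall W : set L, subspace W ->
        (forall x y, W x -> W y -> W (brk x y)) ->
        (forall t, W (hL t)) -> (forall i, W (X i)) -> (forall i, W (Y i)) ->
        forall x, W x
    & forall (L' : lieSuperalgebra K) (hL' : cd_h C -> L')
             (X' Y' : 'I_(cd_n C) -> L'),
        chevalley_relations hL' X' Y' ->
        exists f : {linear L -> L'},
          lie_hom f /\ (forall t, f (hL t) = hL' t) /\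
          (forall i, f (X i) = X' i /\ f (Y i) = Y' i)].

Definition meets_h_trivially (C : cartanDatum) (L : lieSuperalgebra K)
    (hL : cd_h C -> L) (J : set L) : Prop := forall t, J (hL t) -> t = 0.

(* g is the quotient of the presented Lie superalgebra L by its maximal ideal
   meeting h trivially. *)
Definition is_contragredient (C : cartanDatum) (g : lieSuperalgebra K)
    (hg : cd_h C -> g) (X Y : 'I_(cd_n C) -> g) : Prop :=
  exists (L : lieSuperalgebra K) (hL : cd_h C -> L)
         (XL YL : 'I_(cd_n C) -> L) (f : {linear L -> g}),
    presented_by_chevalley hL XL YL /\
    lie_hom f /\ (forall y, exists x, f x = y) /\
    (forall t, f (hL t) = hg t) /\
    (forall i, f (XL i) = X i /\ f (YL i) = Y i) /\
    meets_h_trivially hL [set x | f x = 0] /\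
    (forall J : set L, lie_ideal J -> meets_h_trivially hL J ->
       forall x, J x -> f x = 0).

Record contragredient (C : cartanDatum) := Contragredient {
  ga :> lieSuperalgebra K;
  ga_h : cd_h C -> ga;
  ga_X : 'I_(cd_n C) -> ga;
  ga_Y : 'I_(cd_n C) -> ga;
  ga_axiom : is_contragredient ga_h ga_X ga_Y }.

Definition quasisimple (C : cartanDatum) (g : contragredient C) : Prop :=
  forall J : set g, lie_ideal J ->
    J `<=` range (@ga_h C g) \/ (forall x, exists t, J (x - ga_h g t)).

Definition regular (C : cartanDatum) : Prop :=
  forall i j, cd_A C i j = 0 -> cd_A C j i = 0.

Definition admissible (C : cartanDatum) : Prop :=
  forall i,
    [/\ cd_A C i i = 0 -> cd_p i = false -> forall j, cd_A C i j = 0,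
        cd_A C i i = 2 -> cd_p i = false ->
          forall j, j != i -> exists k : nat, cd_A C i j = - k%:R
      & cd_A C i i = 2 -> cd_p i = true ->
          forall j, j != i -> exists k : nat, cd_A C i j = - (2 * k)%:R].

Definition kac_moody (C : cartanDatum) (g : contragredient C) : Prop :=
  [/\ quasisimple g, regular C & admissible C].

Definition symmetrizer (C : cartanDatum) (d : 'rV[K]_(cd_n C)) : Prop :=
  (forall i, d 0 i != 0) /\
  (diag_mx d *m cd_A C)^T = diag_mx d *m cd_A C.

Section Structure.
Variables (C : cartanDatum) (g : contragredient C).

(* With the symmetrizer on the left (D A symmetric), the normalization
   compatible with the symmetry of B on the h_i is B(h, h_j) = d_j^-1 alpha_j(h);
   when D^-1 A (equivalently A D) is symmetric it reads d_j alpha_j(h). *)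
Definition standard_form (d : 'rV[K]_(cd_n C)) (B : g -> g -> K) : Prop :=
  @bilinear_map K g g K^o B /\
  (forall x y, homog false x -> homog true y -> B x y = 0) /\
  (forall b c x y, homog b x -> homog c y ->
     B x y = (-1) ^+ (b && c) * B y x) /\
  (forall x y z, B (brk x y) z = B x (brk y z)) /\
  (forall x, (forall y, B x y = 0) -> x = 0) /\
  (forall t j, B (ga_h g t) (ga_h g (cd_hh j)) = (d 0 j)^-1 * cd_alpha j t).

Definition dual_vec (B : g -> g -> K) (l : hdual C) : cd_h C :=
  xget 0 [set t | forall s, B (ga_h g t) (ga_h g s) = l s].

Definition dual_form (B : g -> g -> K) (l m : hdual C) : K :=
  B (ga_h g (dual_vec B l)) (ga_h g (dual_vec B m)).

(* The principal grading: the least family of subspaces compatible with the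
   bracket such that deg h = 0, deg X_i = 1 and deg Y_i = -1. *)
Inductive pdeg : int -> g -> Prop :=
| pdeg_zero k : pdeg k 0
| pdeg_lin k (a : K) x y : pdeg k x -> pdeg k y -> pdeg k (a *: x + y)
| pdeg_h t : pdeg 0 (ga_h g t)
| pdeg_X i : pdeg 1 (ga_X g i)
| pdeg_Y i : pdeg (-1) (ga_Y g i)
| pdeg_brk k l x y : pdeg k x -> pdeg l y -> pdeg (k + l) (brk x y).

Definition deg_part (Q : pred int) : set g :=
  lspan [set x | exists2 k, Q k & pdeg k x].

Definition deg_proj (Q : pred int) (x : g) : g :=
  xget 0 [set u | deg_part Q u /\ deg_part (predC Q) (x - u)].

Definition pos_deg : pred int := fun k => 0 < k.
Definition neg_deg : pred int := fun k => k < 0.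

Definition nplus : set g := deg_part pos_deg.
Definition nminus : set g := deg_part neg_deg.

(* extension of a functional on h by zero on all root spaces, i.e. on n^- + n^+ *)
Definition hext (l : hdual C) (x : g) : K :=
  l (xget 0 [set t | deg_part (fun k => k != 0) (x - ga_h g t)]).

Definition root_vector (x : g) : Prop :=
  x != 0 /\ exists2 r : hdual C, r != 0 &
    forall t, brk (ga_h g t) x = (r t : K) *: x.

Definition weyl_vector (rho : hdual C) : Prop :=
  forall i, rho (cd_hh i) = 2^-1 * cd_alpha i (cd_hh i).

(* ad_x pi_- ad_y pi_+ *)
Definition kp_operator (x y z : g) : g :=
  brk x (deg_proj (predC pos_deg) (brk y (deg_proj pos_deg z))).

Definition kac_peterson_primitive (rho0 : hdual C) : Prop :=
  forall x y : g, homog false x -> homog false y ->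
    hext rho0 (brk x y) =
      2^-1 * trace_on (homog false) (kp_operator x y)
      - 2^-1 * trace_on (homog false) (kp_operator y x).

Definition weight_vector (V : lmodType K) (act : g -> V -> V) (m : hdual C) :
    set V := [set v | forall t, act (ga_h g t) v = (m t : K) *: v].

Definition submodule (V : lmodType K) (act : g -> V -> V) (L : set g)
    (U : set V) : Prop :=
  subspace U /\ (forall x v, L x -> U v -> U (act x v)).

(* [L] is the subalgebra of g that acts (g or g_0), [U] the invariant subspace
   of [V] claimed to be a highest weight module of highest weight [l]. *)
Definition highest_weight (V : lmodType K) (act : g -> V -> V) (L : set g)
    (U : set V) (l : hdual C) : Prop :=
  [/\ submodule act L U,
      U `<=` lspan [set v | U v /\ exists m, weight_vector act m v],
      forall m, fin_dim (U `&` weight_vector act m)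
    & exists v, [/\ U v /\ v != 0,
                    weight_vector act l v,
                    forall x, L x -> nplus x -> act x v = 0
                  & forall W, submodule act L W -> W v -> U `<=` W]].

Definition highest_weight_supermodule (M : superModule g) (l : hdual C) :
    Prop := highest_weight (@sact K g M) setT setT l.

Definition odd_nplus : set g := homog true `&` nplus.
Definition odd_nminus : set g := homog true `&` nminus.

Definition dual_odd_bases (B : g -> g -> K) (I : choiceType)
    (xx dd : I -> g) : Prop :=
  [/\ is_basis odd_nminus xx, is_basis odd_nplus dd,
      forall a, root_vector (xx a) /\ root_vector (dd a)
    & forall a b, B (dd a) (xx b) = if a == b then 2^-1 else 0].

Section Oscillator.
Variables (I : choiceType) (xx dd : I -> g).

(* S((g_1)_-), as the polynomial ring in the basis (x_a) of (g_1)_- *)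
Definition oscillator := {malg K[{cmonom I}]}.

Definition ovar (a : I) : oscillator := << ucm a >>.

Definition oderiv (a : I) (P : oscillator) : oscillator :=
  \sum_(m <- msupp P) << P@_m *+ m a *g divcm m (ucm a) >>.

(* Action of y in g_1, seen in Cl(g_1): y = sum c_a x_a + sum d_a del_a acts
   by sum c_a x_a (multiplication) + sum d_a d/dx_a. *)
Definition cliff (y : g) (P : oscillator) : oscillator :=
  lincomb ovar (coords xx (deg_proj neg_deg y)) * P
  + lincomb (oderiv^~ P) (coords dd (deg_proj pos_deg y)).

(* :y z: obtained by bilinearity from the decompositions y = ym + yp and
   z = zm + zp along (g_1)_- + (g_1)_+. *)
Definition normal_order (y z : g) (P : oscillator) : oscillator :=
  let ym := deg_proj neg_deg y in let yp := deg_proj pos_deg y in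
  let zm := deg_proj neg_deg z in let zp := deg_proj pos_deg z in
  cliff ym (cliff zm P) + cliff ym (cliff zp P)
  + cliff zm (cliff yp P) + cliff yp (cliff zp P).

Definition osc_act (rho1 : hdual C) (x : g) (P : oscillator) : oscillator :=
  2^-1 *: (\sum_(a \in [set: I]) normal_order (brk x (xx a)) (dd a) P)
  - 2^-1 *: (\sum_(a \in [set: I]) normal_order (brk x (dd a)) (xx a) P)
  - hext rho1 x *: P.

Variables (M : superModule g) (T : tensorProduct M oscillator).

Definition diag_act (rho1 : hdual C) (x : g) (t : T) : T :=
  tmap (@sact K g M x) id t + tmap id (osc_act rho1 x) t.

(* y (x) z for y, z in g_1, with the sign (-1)^p(v) *)
Definition odd_tensor_act (y z : g) (t : T) : T :=
  tmap (fun v => sact y (parity_sign v)) (cliff z) t.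

(* Only finitely many summands are nonzero on a given t. *)
Definition dirac (t : T) : T :=
  2 *: \sum_(a \in [set: I])
    (odd_tensor_act (xx a) (dd a) t - odd_tensor_act (dd a) (xx a) t).

End Oscillator.
End Structure.
End KacMoody.

(* Main.v *)
From HB Require Import structures.
Require Import Defs.
From mathcomp Require Import all_boot all_order all_algebra.
From mathcomp Require Import finmap boolp classical_sets functions fsbigop.
From mathcomp Require Import reals complex monalg.
From mathcomp Require Import zify.

(* Let D be the relative Dirac operator and S the oscillator module. In bases of
   g_1 made of principal homogeneous vectors and dual for B, D is sum_p f_p e_p,
   with f_p acting on M and e_p on S, up to the parity sign. Squaring it and
   reordering with the Clifford relations expresses D^2 by generalised Casimir
   operators: that of g on M and those of g_0 on M (x) S and on S, all three
   formed with rho instead of rho_0.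
   - The one on M commutes with g, hence is the scalar (Lambda, Lambda + 2 rho).
   - The one on S vanishes. An operator on S that commutes with the Clifford
     algebra and sends the vacuum to a polynomial without constant term is 0, and
     this applies in turn to the double commutators of the Casimir operator with
     Clifford elements, to its commutators, and to the operator itself.
   - The one on M (x) S acts on the highest weight vector of V(mu) by
     (l, l + 2 rho), where l = mu + rho_0 - rho is the weight of that vector for
     the action of g_0 without the shift by rho_1.
   As l + rho = mu + rho_0, this gives the scalar on the highest weight vector;
   it holds on all of V(mu) because D commutes with g_0. *)

Set Implicit Arguments.
Unset Strict Implicit.
Unset Printing Implicit Defensive.

Import Order.TTheory GRing.Theory Num.Theory.
Local Open Scope classical_set_scope.
Local Open Scope ring_scope.

(** No Casimir operator used here is a finite sum in general. Each is cut by principal degree into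
    finite canonical tensors, one per parity and degree, with weights [cw] that make the sum over
    degrees finite on every vector. The common [rho] has a simple origin. The oscillator action is
    the unshifted one, [spin], minus [rho0 - rho]; substituting this into the Casimir operator of
    the even part replaces [2 rho0] by [2 (rho0 - (rho0 - rho)) = 2 rho], up to an additive
    constant. The unshifted vacuum has weight 0, so the value on the oscillator module is 0 and not
    merely a constant. That vanishing cannot be checked on Chevalley generators: the even part need
    not be generated by the even [X_i], [Y_i], and [rho] is not its Weyl vector. It is tested
    against Clifford elements instead, so only commutators of [spin] with these are computed. What
    remains is a scalar identity about the adjoint action on [n^-], where no highest weight vector
    is at hand; it comes from a truncated Casimir operator and an induction on brackets with the
    [Y_i]. *)

(** * Linear maps, bilinear maps and subspaces *)

Section LinearMaps.
Variables (K : fieldType) (U V : lmodType K) (f : U -> V).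
Hypothesis hf : linear f.

Definition lmap : {linear U -> V} := HB.pack f (GRing.isLinear.Build K U V _ f hf).

Lemma lmapD x y : f (x + y) = f x + f y. Proof. exact: (linearD lmap). Qed.
Lemma lmapB x y : f (x - y) = f x - f y. Proof. exact: (linearB lmap). Qed.
Lemma lmapN x : f (- x) = - f x. Proof. exact: (linearN lmap). Qed.
Lemma lmap0 : f 0 = 0. Proof. exact: (linear0 lmap). Qed.
Lemma lmapZ a x : f (a *: x) = a *: f x. Proof. exact: (linearZZ lmap). Qed.
Lemma lmap_sum (I : Type) (r : seq I) (P : pred I) (E : I -> U) :
  f (\sum_(i <- r | P i) E i) = \sum_(i <- r | P i) f (E i).
Proof. exact: (linear_sum lmap). Qed.
End LinearMaps.

Section LinearClosure.
Variables (K : fieldType) (U V : lmodType K).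

Lemma linear_comp (W : lmodType K) (f : V -> W) (g : U -> V) :
  linear f -> linear g -> linear (fun x => f (g x)).
Proof. by move=> hf hg a x y; rewrite hg hf. Qed.

Lemma linear_add (f g : U -> V) :
  linear f -> linear g -> linear (fun x => f x + g x).
Proof. by move=> hf hg a x y; rewrite hf hg scalerDr addrACA. Qed.

Lemma linear_scale (f : U -> V) b : linear f -> linear (fun x => b *: f x).
Proof. by move=> hf a x y; rewrite hf scalerDr !scalerA mulrC. Qed.

Lemma linear_sub (f g : U -> V) :
  linear f -> linear g -> linear (fun x => f x - g x).
Proof.
move=> hf hg a x y.
by rewrite hf hg scalerBr opprD addrACA.
Qed.

Lemma linear_bigsum (I : Type) (r : seq I) (f : I -> U -> V) :
  (forall i, linear (f i)) -> linear (fun x => \sum_(i <- r) f i x).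
Proof.
move=> hf a x y; rewrite scaler_sumr -big_split /=.
by apply: eq_bigr => i _; rewrite hf.
Qed.
End LinearClosure.

Section Bilinear.
Variables (K : fieldType) (U V W : lmodType K) (f : U -> V -> W).
Hypothesis hf : bilinear_map f.

Lemma bil_linl v : linear (f^~ v). Proof. exact: hf.2. Qed.
Lemma bil_linr u : linear (f u). Proof. exact: hf.1. Qed.
Lemma bilDl x y z : f (x + y) z = f x z + f y z.
Proof. exact: (lmapD (hf.2 z)). Qed.
Lemma bilBl x y z : f (x - y) z = f x z - f y z.
Proof. exact: (lmapB (hf.2 z)). Qed.
Lemma bilNl x z : f (- x) z = - f x z. Proof. exact: (lmapN (hf.2 z)). Qed.
Lemma bil0l z : f 0 z = 0. Proof. exact: (lmap0 (hf.2 z)). Qed.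
Lemma bilZl a x z : f (a *: x) z = a *: f x z.
Proof. exact: (lmapZ (hf.2 z)). Qed.
Lemma bil_suml (I : Type) (r : seq I) (P : pred I) (E : I -> U) z :
  f (\sum_(i <- r | P i) E i) z = \sum_(i <- r | P i) f (E i) z.
Proof. exact: (lmap_sum (hf.2 z)). Qed.
Lemma bilDr x y z : f z (x + y) = f z x + f z y.
Proof. exact: (lmapD (hf.1 z)). Qed.
Lemma bilBr x y z : f z (x - y) = f z x - f z y.
Proof. exact: (lmapB (hf.1 z)). Qed.
Lemma bilNr x z : f z (- x) = - f z x. Proof. exact: (lmapN (hf.1 z)). Qed.
Lemma bil0r z : f z 0 = 0. Proof. exact: (lmap0 (hf.1 z)). Qed.
Lemma bilZr a x z : f z (a *: x) = a *: f z x.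
Proof. exact: (lmapZ (hf.1 z)). Qed.
Lemma bil_sumr (I : Type) (r : seq I) (P : pred I) (E : I -> V) z :
  f z (\sum_(i <- r | P i) E i) = \sum_(i <- r | P i) f z (E i).
Proof. exact: (lmap_sum (hf.1 z)). Qed.
End Bilinear.

Section Subspaces.
Variables (K : fieldType) (V : lmodType K).
Implicit Types (P S : set V).

Lemma sub0 P : subspace P -> P 0. Proof. by case. Qed.
Lemma subZ P : subspace P -> forall a x, P x -> P (a *: x).
Proof. by move=> [P0 h] a x Px; rewrite -[_ *: _]addr0; apply: h. Qed.
Lemma subD P : subspace P -> forall x y, P x -> P y -> P (x + y).
Proof. by move=> [P0 h] x y Px Py; rewrite -[x]scale1r; apply: h. Qed.
Lemma subN P : subspace P -> forall x, P x -> P (- x).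
Proof. by move=> hP x Px; rewrite -scaleN1r; apply: subZ. Qed.
Lemma subB P : subspace P -> forall x y, P x -> P y -> P (x - y).
Proof. by move=> hP x y Px Py; apply: subD => //; apply: subN. Qed.
Lemma sub_sum P : subspace P -> forall (I : eqType) (r : seq I) (E : I -> V),
  (forall i, i \in r -> P (E i)) -> P (\sum_(i <- r) E i).
Proof.
move=> hP I r E hE; rewrite big_seq; elim/big_ind: _ => //; first exact: sub0.
exact: subD.
Qed.

Lemma lspan_sub S : subspace (lspan S).
Proof.
split; first by exists 0%N, (fun=> 0), (fun=> 0); split=> [[]|] //; rewrite big_ord0.
move=> a u v [k1 [c1 [e1 [h1 ->]]]] [k2 [c2 [e2 [h2 ->]]]].
exists (k1 + k2)%N,
  (fun i => match fintype.split i with inl i => a * c1 i | inr i => c2 i end),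
  (fun i => match fintype.split i with inl i => e1 i | inr i => e2 i end).
split; first by move=> i; case: (fintype.split i).
rewrite big_split_ord /= scaler_sumr; congr (_ + _); apply: eq_bigr => i _.
- by rewrite (unsplitK (inl i)) scalerA.
- by rewrite (unsplitK (inr i)).
Qed.

Lemma lspan_gen S x : S x -> lspan S x.
Proof.
move=> Sx; exists 1%N, (fun=> 1), (fun=> x); split=> //.
by rewrite big_ord1 scale1r.
Qed.

Lemma lspan_ind S P : subspace P -> (forall x, S x -> P x) ->
  forall x, lspan S x -> P x.
Proof.
move=> hP SP x [k [c [e [he ->]]]]; apply: sub_sum => // i _.
by apply: subZ => //; apply: SP.
Qed.

Lemma sub_pre (U : lmodType K) (f : U -> V) P :
  linear f -> subspace P -> subspace [set x | P (f x)].
Proof.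
move=> hf [P0 hP]; split=> /=; first by rewrite (lmap0 hf).
by move=> a u v /= Pu Pv; rewrite hf; apply: hP.
Qed.

Lemma sub_eq (U : lmodType K) (f g : V -> U) :
  linear f -> linear g -> subspace [set x | f x = g x].
Proof.
move=> hf hg; split=> /=; first by rewrite (lmap0 hf) (lmap0 hg).
by move=> a u v /= fu fv; rewrite hf hg fu fv.
Qed.

Lemma sub_and (P Q : set V) : subspace P -> subspace Q ->
  subspace [set x | P x /\ Q x].
Proof.
move=> hP hQ; split=> [|a u v [? ?] [? ?]]; first by split; apply: sub0.
by split; [apply: hP.2|apply: hQ.2].
Qed.

End Subspaces.

(** * Dual systems *)
Section DualSystems.
Variables (K : fieldType) (V : lmodType K) (B : V -> V -> K).
Hypothesis hB : @bilinear_map K V V K^o B.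

(* A finite family of pairs (e, f) whose tensor sum_p e (x) f is the canonical
   element of W (x) W' for the pairing B. *)
Definition dual_system (W W' : set V) (s : seq (V * V)) : Prop :=
  [/\ forall p, p \in s -> W p.1 /\ W' p.2,
      forall w, W w -> w = \sum_(p <- s) B w p.2 *: p.1
    & forall w, W' w -> w = \sum_(p <- s) B p.1 w *: p.2].

(** Unlike a dual system, such a family need not exhaust [W], so it can be built one pair at a
    time. *)
Definition dual_family (W W' : set V) (s : seq (V * V)) : Prop :=
  (forall i, (i < size s)%N -> W (nth 0 s i).1 /\ W' (nth 0 s i).2) /\
  (forall i j, (i < size s)%N -> (j < size s)%N ->
     B (nth 0 s i).1 (nth 0 s j).2 = (i == j)%:R).

(** The pairing matrix of the family is an identity matrix that factors through the [k] spanning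
    vectors. *)
Lemma dual_family_size (W W' : set V) k (e : 'I_k -> V) s :
  W `<=` lspan (range e) -> dual_family W W' s -> (size s <= k)%N.
Proof.
move=> hW [hs hd].
have hc (w : V) : W w -> exists c : 'I_k -> K, w = \sum_i c i *: e i.
  move=> Ww; have := hW _ Ww.
  apply: (@lspan_ind _ _ _
    [set w | exists c : 'I_k -> K, w = \sum_i c i *: e i]); first split.
  - by exists (fun=> 0); rewrite big1 // => i _; rewrite scale0r.
  - move=> a u v [c ->] [c' ->]; exists (fun i => a * c i + c' i).
    rewrite scaler_sumr -big_split /=; apply: eq_bigr => i _.
    by rewrite scalerDl scalerA.
  - move=> x [i _ <-]; exists (fun j => (j == i)%:R).
    by rewrite (bigD1 i) //= eqxx scale1r big1 ?addr0 // => j /negbTE->; rewrite scale0r.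
have [c hcE] : exists c : 'I_(size s) -> 'I_k -> K,
    forall i : 'I_(size s), (nth 0 s i).1 = \sum_l c i l *: e l.
  suff /choice[c h] : forall i : 'I_(size s), exists c : 'I_k -> K,
    (nth 0 s i).1 = \sum_l c l *: e l by exists c.
  by move=> i; apply: hc; have [] := hs i (ltn_ord i).
apply: (@mulmx1_min _ _ _ (\matrix_(i, l) c i l)
  (\matrix_(l, j) B (e l) (nth 0 s j).2)).
apply/matrixP => i j; rewrite !mxE.
rewrite -(val_eqE i j) -(hd i j (ltn_ord i) (ltn_ord j)) hcE.
rewrite (bil_suml hB); apply: eq_bigr => l _.
by rewrite !mxE (bilZl hB).
Qed.

(** A Gram-Schmidt step: a vector not reproduced by the family is made orthogonal to it;
    nondegeneracy supplies a partner, which is orthogonalised and normalised in turn. *)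
Lemma dual_family_extend (W W' : set V) s : subspace W -> subspace W' ->
  (forall w, W w -> (forall w', W' w' -> B w w' = 0) -> w = 0) ->
  dual_family W W' s ->
  (forall w, W w -> w = \sum_(p <- s) B w p.2 *: p.1) \/
  exists p, dual_family W W' (p :: s).
Proof.
move=> sW sW' nd [hs hd].
have hin p : p \in s -> W p.1 /\ W' p.2.
  by move=> ps; have := hs (index p s); rewrite index_mem ps nth_index //; apply.
case: (pselect (forall w, W w -> w = \sum_(p <- s) B w p.2 *: p.1)); first by left.
move=> /existsNP[w /not_implyP[Ww wne]]; right.
pose w1 := w - \sum_(p <- s) B w p.2 *: p.1.
have Ww1 : W w1.
  by apply: subB => //; apply: sub_sum => // p /hin[? _]; apply: subZ.
have w1s j : (j < size s)%N -> B w1 (nth 0 s j).2 = 0.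
  move=> js; rewrite /w1 (bilBl hB) (bil_suml hB) (big_nth 0) big_mkord.
  rewrite (bigD1 (Ordinal js)) //= (bilZl hB) hd // eqxx.
  rewrite big1 => [|i ij]; last first.
    by move: ij; rewrite -val_eqE /= => /negbTE ij; rewrite (bilZl hB) hd // ij scaler0.
  by rewrite addr0 [_ *: _]mulr1 subrr.
have w1n0 : w1 <> 0 by move=> /eqP; rewrite subr_eq0 => /eqP.
have [w2 W2 Bw2] : exists2 w', W' w' & B w1 w' != 0.
  apply: contrapT => h; apply: w1n0; apply: nd => // w' Ww'.
  by apply/eqP; apply: contrapT => h'; apply: h; exists w' => //; apply/negP.
pose w3 := (B w1 w2)^-1 *: (w2 - \sum_(p <- s) B p.1 w2 *: p.2).
have Bw1w3 : B w1 w3 = 1.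
  rewrite /w3 (bilZr hB) (bilBr hB) (bil_sumr hB).
  rewrite [X in _ - X]big1_seq ?subr0; first by rewrite [_ *: _]mulVf.
  move=> p /= ps; rewrite (bilZr hB).
  have := w1s (index p s); rewrite index_mem ps nth_index // => -> //.
  by rewrite scaler0.
have sBw3 i : (i < size s)%N -> B (nth 0 s i).1 w3 = 0.
  move=> is_; rewrite /w3 (bilZr hB) (bilBr hB) (bil_sumr hB) (big_nth 0) big_mkord.
  rewrite (bigD1 (Ordinal is_)) //= (bilZr hB) hd // eqxx.
  rewrite big1 => [|j ij]; last first.
    move: ij; rewrite -val_eqE /= eq_sym => /negbTE ij.
    by rewrite (bilZr hB) hd // ij scaler0.
  by rewrite addr0 [_ *: 1%:R]mulr1 subrr scaler0.
exists (w1, w3); split.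
- case=> [|i] /=; last exact: hs.
  move=> _; split=> //; apply: subZ => //; apply: subB => //.
  by apply: sub_sum => // p /hin[_ ?]; apply: subZ.
- case=> [|i] [|j] //=; rewrite ?ltnS.
  + by move=> _ js; rewrite w1s.
  + by move=> is_ _; rewrite sBw3.
  + by move=> is_ js; rewrite hd.
Qed.

(** The expansion in [W'] follows from the one in [W]: both of its sides pair equally with every
    element of [W], and [nd'] identifies them. *)
Lemma dual_system_exists (W W' : set V) : subspace W -> subspace W' ->
  fin_dim W ->
  (forall w, W w -> (forall w', W' w' -> B w w' = 0) -> w = 0) ->
  (forall w', W' w' -> (forall w, W w -> B w w' = 0) -> w' = 0) ->
  exists s, dual_system W W' s.
Proof.
move=> sW sW' [k [e he]] nd nd'.
have [s [ds exps]] : exists s, dual_family W W' s /\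
    forall w, W w -> w = \sum_(p <- s) B w p.2 *: p.1.
  have ext n : forall s, dual_family W W' s -> (k < size s + n)%N ->
      exists s, dual_family W W' s /\
      forall w, W w -> w = \sum_(p <- s) B w p.2 *: p.1.
    elim: n => [s ds|n IH s ds kn].
      by rewrite addn0 ltnNge (dual_family_size he ds).
    have [?|[p dps]] := dual_family_extend sW sW' nd ds; first by exists s.
    by apply: (IH _ dps); rewrite /= addSnnS.
  (* After [k.+1] extensions the family would exceed the bound [k], so a complete one is met
     before. *)
  by apply: (ext k.+1 [::]) => //; split.
have hin p : p \in s -> W p.1 /\ W' p.2.
  by move=> ps; have := ds.1 (index p s); rewrite index_mem ps nth_index //; apply.
exists s; split=> // w' Ww'.
apply/eqP; rewrite -subr_eq0; apply/eqP; apply: nd'.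
  by apply: subB => //; apply: sub_sum => // p /hin[_ ?]; apply: subZ.
move=> w Ww; rewrite (bilBr hB) (bil_sumr hB) {1}(exps _ Ww) (bil_suml hB).
apply/eqP; rewrite subr_eq0; apply/eqP; apply: eq_bigr => p _.
by rewrite (bilZl hB) (bilZr hB) [LHS]mulrC.
Qed.

(** The canonical tensor does not depend on the system: each one is expanded in the other. This
    later replaces arbitrary systems by the one built from [xx] and [dd]. *)
Lemma dual_system_unique (U : lmodType K) (Phi : V -> V -> U) W W' s s' :
  bilinear_map Phi -> dual_system W W' s -> dual_system W W' s' ->
  \sum_(p <- s) Phi p.2 p.1 = \sum_(p <- s') Phi p.2 p.1.
Proof.
move=> hP [s1 s2 s3] [t1 t2 t3].
transitivity (\sum_(p <- s) \sum_(q <- s') B p.1 q.2 *: Phi p.2 q.1).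
  apply: eq_big_seq => p /s1[/t2 {1}-> _]; rewrite (bil_sumr hP).
  by apply: eq_bigr => q _; rewrite (bilZr hP).
rewrite exchange_big /=; apply: eq_big_seq => q /t1[_ /s3 {2}->].
rewrite (bil_suml hP); apply: eq_bigr => p _.
by rewrite (bilZl hP).
Qed.

End DualSystems.

(** * Finitely supported sums over the integers *)
Section IntegerSums.
Variables (K : fieldType).
Implicit Types (V U : lmodType K).

Definition zfin V (f : int -> V) : Prop :=
  exists N : nat, forall k, (N < `|k|)%N -> f k = 0.

Definition zsum V (f : int -> V) : V := \sum_(k \in [set: int]) f k.

(** Zero, then the positive, then the negative integers: the contributions of [k] and [- k] can be
    separated or paired at once. *)
Definition zrange (N : nat) : seq int :=
  0 :: [seq k%:Z | k <- iota 1 N] ++ [seq - k%:Z | k <- iota 1 N].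

Lemma mem_zrange N k : (k \in zrange N) = (`|k| <= N)%N.
Proof.
rewrite in_cons mem_cat; apply/idP/idP.
- case/or3P => [/eqP->|/mapP[m]|/mapP[m]] //; rewrite mem_iota => h -> ; lia.
- move=> kN; case: (ltrgt0P k) => k0 //=.
  + apply/orP; left; apply/mapP; exists `|k|%N; last by lia.
    by rewrite mem_iota; lia.
  + apply/orP; right; apply/mapP; exists `|k|%N; last by lia.
    by rewrite mem_iota; lia.
Qed.

Lemma zrange_uniq N : uniq (zrange N).
Proof.
rewrite /= cat_uniq !map_inj_uniq ?iota_uniq ?andbT /=; last 2 first.
- by move=> a b /eqP; rewrite eqr_oppLR opprK => /eqP[].
- by move=> a b [].
rewrite mem_cat; apply/andP; split.
- by apply/negP => /orP[] /mapP[m]; rewrite mem_iota => h h'; lia.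
- apply/hasPn => x /mapP[m]; rewrite mem_iota => h ->; apply/negP => /mapP[n].
  by rewrite mem_iota => h2 h3; lia.
Qed.

Lemma zsumE V (f : int -> V) N : (forall k, (N < `|k|)%N -> f k = 0) ->
  zsum f = \sum_(k <- zrange N) f k.
Proof.
move=> hf; rewrite /zsum [RHS]fsbig_seq ?zrange_uniq //.
apply/esym/fsbig_widen => // k /= [_ /negP]; rewrite mem_zrange -ltnNge => h.
exact: hf.
Qed.

Lemma zfin_common V U (f : int -> V) (g : int -> U) : zfin f -> zfin g ->
  exists N : nat, forall k, (N < `|k|)%N -> f k = 0 /\ g k = 0.
Proof.
move=> [N hN] [M hM]; exists (maxn N M) => k; rewrite gtn_max => /andP[h1 h2].
by split; [apply: hN|apply: hM].
Qed.

Lemma zsum_ext V (f g : int -> V) : f =1 g -> zsum f = zsum g.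
Proof. by move=> /funext->. Qed.

Lemma zfinD V (f g : int -> V) : zfin f -> zfin g -> zfin (fun k => f k + g k).
Proof.
by move=> hf hg; have [N h] := zfin_common hf hg; exists N => k /h[-> ->]; rewrite addr0.
Qed.

Lemma zsumD V (f g : int -> V) : zfin f -> zfin g ->
  zsum (fun k => f k + g k) = zsum f + zsum g.
Proof.
move=> hf hg; have [N h] := zfin_common hf hg.
rewrite !(@zsumE _ _ N) ?big_split // => k /h[fk gk] //.
by rewrite fk gk addr0.
Qed.

Lemma zfinN V (f : int -> V) : zfin f -> zfin (fun k => - f k).
Proof. by move=> [N h]; exists N => k /h->; rewrite oppr0. Qed.

Lemma zsumN V (f : int -> V) : zfin f -> zsum (fun k => - f k) = - zsum f.
Proof.
move=> [N h]; rewrite !(@zsumE _ _ N) ?sumrN // => k /h fk //.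
by rewrite fk oppr0.
Qed.

Lemma zsumB V (f g : int -> V) : zfin f -> zfin g ->
  zsum (fun k => f k - g k) = zsum f - zsum g.
Proof. by move=> hf hg; rewrite zsumD ?zsumN //; apply: zfinN. Qed.

Lemma zfin_lin V U (A : V -> U) (f : int -> V) : linear A -> zfin f ->
  zfin (fun k => A (f k)).
Proof. by move=> hA [N h]; exists N => k /h->; rewrite (lmap0 hA). Qed.

Lemma zsum_lin V U (A : V -> U) (f : int -> V) : linear A -> zfin f ->
  A (zsum f) = zsum (fun k => A (f k)).
Proof.
move=> hA [N h]; rewrite !(@zsumE _ _ N) //; first by rewrite (lmap_sum hA).
by move=> k /h fk; rewrite fk (lmap0 hA).
Qed.

Lemma zfin_shift V (f : int -> V) j : zfin f -> zfin (fun k => f (k + j)).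
Proof. by move=> [N h]; exists (N + `|j|)%N => k hk; apply: h; lia. Qed.

Lemma zsum_shift V (f : int -> V) j : zsum (fun k => f (k + j)) = zsum f.
Proof.
rewrite /zsum [RHS](@reindex_fsbigT _ _ _ _ _ (fun k => k + j)) //.
by exists (fun k => k - j) => k; rewrite ?addrK ?subrK.
Qed.

Lemma zsum1 V (f : int -> V) k0 : (forall k, k != k0 -> f k = 0) -> zsum f = f k0.
Proof.
move=> h; rewrite (@zsumE _ _ `|k0|); last first.
  by move=> k hk; apply: h; apply/eqP => E; rewrite E ltnn in hk.
rewrite (bigD1_seq k0) ?zrange_uniq ?mem_zrange //= big1 ?addr0 //.
Qed.

Lemma zsum0 V (f : int -> V) : (forall k, f k = 0) -> zsum f = 0.
Proof. by move=> h; rewrite (@zsum1 _ _ 0). Qed.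

Lemma zsum_linear V U (f : int -> V -> U) :
  (forall k, linear (f k)) -> (forall t, zfin (f^~ t)) ->
  linear (fun t => zsum (f^~ t)).
Proof.
move=> hf hz a x y.
have -> : zsum (f^~ (a *: x + y)) = zsum (fun k => a *: f k x + f k y).
  by apply: zsum_ext => k; rewrite hf.
have hs : linear (fun v : U => a *: v).
  by move=> b u v; rewrite scalerDr !scalerA mulrC.
by rewrite zsumD //; [rewrite -(zsum_lin hs)|apply: (zfin_lin hs)].
Qed.
End IntegerSums.

(** * Lie superalgebras *)
Section SuperSpaces.
Variables (K : fieldType) (V : superSpace K).

Lemma homog_sprE b c (x : V) : homog b x -> spr V c x = if c == b then x else 0.
Proof. by move=> hx; rewrite -[in LHS]hx spr_orth; case: eqP => // ->. Qed.

Lemma spr_homog b (x : V) : homog b (spr V b x).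
Proof. by rewrite /homog /= spr_orth eqxx. Qed.

Lemma homog_sub b : subspace (@homog K V b).
Proof. by apply: (@sub_eq K V V); [exact: linearP|]. Qed.

Lemma homog_ind (P : set V) : subspace P ->
  (forall b x, homog b x -> P x) -> forall x, P x.
Proof.
move=> sP hP x; rewrite -(spr_sum x).
by apply: subD => //; apply: (hP _ _ (spr_homog _ _)).
Qed.

Lemma homog_both (x : V) : homog false x -> homog true x -> x = 0.
Proof. by move=> h1 h2; rewrite -h2 (homog_sprE _ h1). Qed.

Lemma parity_signE b (v : V) : homog b v -> parity_sign v = (-1) ^+ b *: v.
Proof.
move=> hv; rewrite /parity_sign !(homog_sprE _ hv).
by case: b {hv} => /=; rewrite ?sub0r ?subr0 ?scaleN1r ?scale1r.
Qed.

Lemma parity_sign_lin : linear (@parity_sign K V).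
Proof. exact: (linear_sub (linearP _) (linearP _)). Qed.
End SuperSpaces.

Section LieSuper.
Variables (K : fieldType) (L : lieSuperalgebra K).
Implicit Types x y z : L.

Definition brkB := @brk_bilinear K L.

Lemma brk_evenC w y : homog false w -> brk w y = - brk y w.
Proof.
move=> hw; move: y; apply: homog_ind.
  apply: sub_eq; first exact: bil_linr brkB _.
  by move=> a u v /=; rewrite (brkB.2 w) opprD -scalerN.
by move=> b y hy /=; rewrite (brk_anti hw hy) /= scale1r.
Qed.

Lemma brk_oddC y z : homog true y -> homog true z -> brk y z = brk z y.
Proof. by move=> hy hz; rewrite (brk_anti hy hz) /= expr1 scaleN1r opprK. Qed.

Lemma brk_jac b c x y z : homog b x -> homog c y ->
  brk x (brk y z) = brk (brk x y) z + (-1) ^+ (b && c) *: brk y (brk x z).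
Proof. exact: brk_jacobi. Qed.

Lemma brk_jac_even w y z : homog false w ->
  brk w (brk y z) = brk (brk w y) z + brk y (brk w z).
Proof.
move=> hw; move: y; apply: homog_ind.
  apply: sub_eq.
    exact: (linear_comp (bil_linr brkB w) (bil_linl brkB z)).
  apply: linear_add; last exact: (bil_linl brkB).
  exact: (linear_comp (bil_linl brkB z) (bil_linr brkB w)).
by move=> b y hy /=; rewrite (brk_jac z hw hy) /= scale1r.
Qed.

(** The symmetric form of the Jacobi identity for three odd elements; it makes the third commutator
    in [spin_comm2_gam] vanish. *)
Lemma brk_jac_odd x y z : homog true x -> homog true y -> homog true z ->
  brk (brk x y) z + brk (brk y z) x + brk (brk x z) y = 0.
Proof.
move=> hx hy hz.
have hxy := brk_parity hx hy; have hyz := brk_parity hy hz.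
have hxz := brk_parity hx hz.
have := brk_jac z hx hy; rewrite /= expr1 scaleN1r => /eqP; rewrite eq_sym subr_eq => /eqP ->.
rewrite (brk_evenC x hyz) (brk_evenC y hxz).
by rewrite [X in X - _ - _]addrC addrK subrr.
Qed.
End LieSuper.

Section Gelt.
Variables (K : numFieldType) (C : cartanDatum K).

(* The element of h on which every simple root is 1: its adjoint action is the
   principal grading. *)
Definition gelt : cd_h C := xget 0 [set t | forall i, cd_alpha i t = 1].

(** As the simple roots are independent, the matrix of their values on a basis of [h] has a right
    inverse; the sum of the columns of that inverse gives the coordinates of the element. *)
Lemma alpha_gelt i : cd_alpha i gelt = 1.
Proof.
suff [t ht] : exists t : cd_h C, forall i, cd_alpha i t = 1.
  by have := @xgetPex _ 0 [set t | forall i, cd_alpha i t = 1]; apply; exists t.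
pose b := vbasis {:cd_h C}.
pose A := \matrix_(i < cd_n C, j < \dim {:cd_h C}) (cd_alpha i b`_j : K).
have fA : row_free A.
  rewrite -kermx_eq0; apply/eqP/row_matrixP => r; rewrite row0.
  have /sub_kermxP : (row r (kermx A) <= kermx A)%MS by apply: row_sub.
  move: (row r (kermx A)) => u hu.
  have hn : size [seq cd_alpha i | i <- enum 'I_(cd_n C)] = cd_n C.
    by rewrite size_map size_enum_ord.
  have /freeP fr : free (Tuple (introT eqP hn)) by exact: cd_alpha_free.
  apply/rowP => i0; rewrite [RHS]mxE; apply: (fr (fun r => u 0 r)).
  apply/lfunP => t; rewrite lfunE /= sum_lfunE.
  rewrite (coord_vbasis (memvf t)).
  transitivity (\sum_(j < \dim {:cd_h C}) coord b j t * (u *m A) 0 j); last first.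
    by rewrite hu big1 // => j _; rewrite mxE mulr0.
  under eq_bigr => k _ do rewrite lfunE /= linear_sum /= scaler_sumr.
  rewrite exchange_big /=; apply: eq_bigr => j _.
  rewrite mxE mulr_sumr; apply: eq_bigr => k _.
  rewrite (nth_map k) ?size_enum_ord // nth_ord_enum linearZ /= !mxE.
  by rewrite [LHS]mulrCA.
have := mulmxVp fA; set P := pinvmx A => hP.
exists (\sum_j (\sum_k P j k) *: b`_j) => k.
rewrite linear_sum /=.
transitivity (\sum_l (A *m P) k l).
  rewrite (eq_bigr (fun l => \sum_j A k j * P j l)) => [|l _]; last by rewrite mxE.
  rewrite exchange_big /=; apply: eq_bigr => j _.
  by rewrite linearZ /= -mulr_sumr mxE mulrC.
rewrite hP (bigD1 k) //= mxE eqxx big1 ?addr0 // => l /negbTE h.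
by rewrite mxE eq_sym h.
Qed.
End Gelt.

(** * The principal grading and the triangular decomposition *)
Section Contragredient.
Variables (K : numFieldType) (C : cartanDatum K) (g : contragredient C).
Local Notation hh := (@ga_h K C g).
Local Notation X := (@ga_X K C g).
Local Notation Y := (@ga_Y K C g).
Local Notation brkB := (@brkB K g).
Implicit Types x y z : g.

Lemma ga_gen (W : set g) : subspace W ->
  (forall x y, W x -> W y -> W (brk x y)) ->
  (forall t, W (hh t)) -> (forall i, W (X i)) -> (forall i, W (Y i)) ->
  forall x, W x.
Proof.
move=> sW hb ht hX hY x.
have [L [hL [XL [YL [f [[_ gen _] [[_ fb] [fs [fh [fXY _]]]]]]]]]] := ga_axiom g.
have [u <-] := fs x; apply: (gen [set u | W (f u)]).
- by apply: sub_pre => //; exact: linearP.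
- by move=> a b /= Wa Wb; rewrite fb; apply: hb.
- by move=> t /=; rewrite fh.
- by move=> i /=; rewrite (fXY i).1.
- by move=> i /=; rewrite (fXY i).2.
Qed.

Lemma ga_rel : chevalley_relations hh X Y.
Proof.
have [L [hL [XL [YL [f [[rel _ _] [[fp fb] [fs [fh [fXY _]]]]]]]]]] := ga_axiom g.
have [r1 [r2 [r3 [r4 [r5 [r6 r7]]]]]] := rel.
split; first by move=> a s t; rewrite -!fh r1 linearP.
split; first by move=> t; rewrite -fh; apply: fp.
split; first by move=> i; rewrite -(fXY i).1 -(fXY i).2; split; apply: fp; have [] := r3 i.
split; first by move=> t i; rewrite -fh -(fXY i).1 -fb r4 linearZ.
split; first by move=> t i; rewrite -fh -(fXY i).2 -fb r5 linearN linearZ.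
split.
  move=> i j; rewrite -(fXY i).1 -(fXY j).2 -fb r6.
  by case: eqP => _; rewrite ?fh ?linear0.
by move=> s t; rewrite -!fh -fb r7 linear0.
Qed.

Lemma ga_h_inj t : hh t = 0 -> t = 0.
Proof.
have [L [hL [XL [YL [f [_ [_ [_ [fh [_ [fm _]]]]]]]]]]] := ga_axiom g.
by rewrite -fh => h; apply: fm.
Qed.

Lemma ga_h_lin : linear hh. Proof. by case: ga_rel. Qed.
Lemma homog_h t : homog false (hh t). Proof. by case: ga_rel => _ []. Qed.
Lemma homog_X i : homog (cd_p i) (X i).
Proof. by case: ga_rel => _ [_ [/(_ i)[]]]. Qed.
Lemma homog_Y i : homog (cd_p i) (Y i).
Proof. by case: ga_rel => _ [_ [/(_ i)[]]]. Qed.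
Lemma brk_hX t i : brk (hh t) (X i) = (cd_alpha i t : K) *: X i.
Proof. by case: ga_rel => _ [_ [_ []]]. Qed.
Lemma brk_hY t i : brk (hh t) (Y i) = - ((cd_alpha i t : K) *: Y i).
Proof. by case: ga_rel => _ [_ [_ [_ []]]]. Qed.
Lemma brk_XY i j : brk (X i) (Y j) = if i == j then hh (cd_hh i) else 0.
Proof. by case: ga_rel => _ [_ [_ [_ [_ []]]]]. Qed.
Lemma brk_hh s t : brk (hh s) (hh t) = 0.
Proof. by case: ga_rel => _ [_ [_ [_ [_ []]]]]. Qed.

(** The Jacobi identity is available for homogeneous elements only. The induction is run on the
    stronger property that both homogeneous components lie in [W]. *)
Lemma ga_gen_homog (W : set g) : subspace W ->
  (forall b c x y, homog b x -> homog c y -> W x -> W y -> W (brk x y)) ->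
  (forall t, W (hh t)) -> (forall i, W (X i)) -> (forall i, W (Y i)) ->
  forall x, W x.
Proof.
move=> sW hb hWh hWX hWY x.
have hW b y : homog b y -> W y -> forall c, W (spr g c y).
  by move=> hy Wy c; rewrite (homog_sprE _ hy); case: eqP => // _; apply: sub0.
suff h : forall x b, W (spr g b x).
  by rewrite -[x]spr_sum; apply: (subD sW).
apply: (@ga_gen [set x | forall b, W (spr g b x)]).
  - split=> [b|a u v hu hv b] /=; first by rewrite linear0; apply: sub0.
    by rewrite linearP; apply: sW.2; [apply: hu|apply: hv].
  - move=> u v hu hv b.
    have key c c' : W (spr g b (brk (spr g c u) (spr g c' v))).
      apply: (hW (c (+) c')); first by apply: brk_parity; apply: spr_homog.
      by apply: (hb _ _ _ _ (spr_homog c u) (spr_homog c' v)); [apply: hu|apply: hv].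
    rewrite -[u]spr_sum -[v]spr_sum !(bilDl brkB) !(bilDr brkB) !linearD /=.
    by do ! apply: (subD sW).
  - by move=> t; apply: hW (homog_h t) _.
  - by move=> i; apply: hW (homog_X i) _.
  - by move=> i; apply: hW (homog_Y i) _.
Qed.

(** Eigenspaces of [ad gelt] stand in for [pdeg], because membership becomes an equation; [pdeg_dg]
    and [dg_pdeg] show that the two gradings agree. *)
Definition dg (k : int) : set g := [set x | brk (hh (gelt C)) x = k%:~R *: x].

Definition gk (b : bool) (k : int) : set g := [set x | homog b x /\ dg k x].

Lemma dg_sub k : subspace (dg k).
Proof.
apply: sub_eq; first exact: (bil_linr brkB).
by move=> a x y; rewrite scalerDr !scalerA mulrC.
Qed.

Lemma gk_sub b k : subspace (gk b k).
Proof. by apply: sub_and; [apply: homog_sub|apply: dg_sub]. Qed.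

Lemma dg_brk k l x y : dg k x -> dg l y -> dg (k + l) (brk x y).
Proof.
rewrite /dg /= => hx hy; rewrite (brk_jac_even _ _ (homog_h _)) hx hy.
by rewrite (bilZl brkB) (bilZr brkB) -scalerDl intrD.
Qed.

Lemma gk_brk b c k l x y : gk b k x -> gk c l y -> gk (b (+) c) (k + l) (brk x y).
Proof.
by move=> [? ?] [? ?]; split; [apply: brk_parity|apply: dg_brk].
Qed.

Lemma gk_h t : gk false 0 (hh t).
Proof. by split; [apply: homog_h|rewrite /dg /= brk_hh scale0r]. Qed.

Lemma gk_X i : gk (cd_p i) 1 (X i).
Proof. by split; [apply: homog_X|rewrite /dg /= brk_hX alpha_gelt]. Qed.

Lemma gk_Y i : gk (cd_p i) (-1) (Y i).
Proof. by split; [apply: homog_Y|rewrite /dg /= brk_hY alpha_gelt scaleN1r scale1r]. Qed.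

Lemma dg_spr k b x : dg k x -> dg k (spr g b x).
Proof.
rewrite /dg /= -linearZ => <-.
have h c : homog c (brk (hh (gelt C)) (spr g c x)).
  by have := brk_parity (homog_h (gelt C)) (spr_homog c x).
rewrite -{2}[x]spr_sum (bilDr brkB) linearD /= !(homog_sprE _ (h _)).
by case: b => /=; rewrite ?add0r ?addr0.
Qed.

Lemma dg_ind k (P : set g) : subspace P ->
  (forall b x, gk b k x -> P x) -> forall x, dg k x -> P x.
Proof.
move=> sP hP x hx; rewrite -[x]spr_sum.
by apply: subD => //; apply: (hP _ _ (conj (spr_homog _ _) (dg_spr _ hx))).
Qed.

Lemma pdeg_dg k x : pdeg k x -> dg k x.
Proof.
elim=> {k x}.
- by move=> k; apply: sub0 (dg_sub k).
- by move=> k a x y _ hx _ hy; apply: (dg_sub k).2.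
- by move=> t; case: (gk_h t).
- by move=> i; case: (gk_X i).
- by move=> i; case: (gk_Y i).
- by move=> k l x y _ hx _ hy; apply: dg_brk.
Qed.

Lemma deg_part_ind (Q : pred int) (P : set g) : subspace P ->
  (forall k x, Q k -> pdeg k x -> P x) -> forall x, deg_part Q x -> P x.
Proof. by move=> sP hP; apply: lspan_ind => // x [k Qk px]; apply: (hP k). Qed.

Lemma deg_part_sub Q : subspace (@deg_part K C g Q).
Proof. exact: lspan_sub. Qed.

Lemma deg_part_gen (Q : pred int) k x : Q k -> pdeg k x -> deg_part Q x.
Proof. by move=> Qk px; apply: lspan_gen; exists k. Qed.

Lemma deg_part_all x : deg_part predT x.
Proof.
apply: ga_gen.
- exact: deg_part_sub.
- move=> a b hA; move: b; apply: deg_part_ind.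
    by apply: (sub_pre (bil_linr brkB a)); exact: deg_part_sub.
  move=> l b _ pb; move: a hA; apply: deg_part_ind.
    by apply: (sub_pre (bil_linl brkB b)); exact: deg_part_sub.
  by move=> k a _ pa; apply: (@deg_part_gen _ (k + l)) => //; apply: pdeg_brk.
- by move=> t; apply: (@deg_part_gen _ 0) => //; apply: pdeg_h.
- by move=> i; apply: (@deg_part_gen _ 1) => //; apply: pdeg_X.
- by move=> i; apply: (@deg_part_gen _ (-1)) => //; apply: pdeg_Y.
Qed.

Lemma gk_ind (P : set g) : subspace P ->
  (forall b k x, gk b k x -> P x) -> forall x, P x.
Proof.
move=> sP hP x; apply: deg_part_ind (deg_part_all x) => // k y _ /pdeg_dg.
by apply: dg_ind => // b z; apply: hP.
Qed.

(* One half of the triangular decomposition, stated for a family [E] so that it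
   applies both to the [X i] and to the [Y i]. *)
Section Half.
Variables (E : 'I_(cd_n C) -> g) (a : 'I_(cd_n C) -> cd_h C -> K).
Hypothesis hE : forall i, homog (cd_p i) (E i).
Hypothesis hhE : forall t i, brk (hh t) (E i) = a i t *: E i.

Definition iter_brk i (s : seq 'I_(cd_n C)) : g :=
  foldr (fun j u => brk (E j) u) (E i) s.

(** It contains [h], since bracketing with an opposite generator can end there. *)
Definition half : set g :=
  lspan [set x | (exists i s, x = iter_brk i s) \/ exists t, x = hh t].

Lemma half_ind (P : set g) : subspace P -> (forall i w, P (iter_brk i w)) ->
  (forall t, P (hh t)) -> forall x, half x -> P x.
Proof. by move=> sP h1 h2; apply: lspan_ind => // x [[i [w ->]]|[t ->]]. Qed.

Lemma half_h s x : half x -> half (brk (hh s) x).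
Proof.
move: x; apply: (@half_ind [set x | half (brk (hh s) x)]); last 1 first.
- by move=> t /=; rewrite brk_hh; apply: sub0; apply: lspan_sub.
- exact: (sub_pre (bil_linr brkB _) (lspan_sub _)).
move=> i w /=.
suff [c ->] : exists c, brk (hh s) (iter_brk i w) = c *: iter_brk i w.
  by apply: subZ; [exact: lspan_sub|apply: lspan_gen; left; exists i, w].
elim: w => [|j w [c IH]] /=; first by exists (a i s); rewrite hhE.
exists (a j s + c); rewrite (brk_jac_even _ _ (homog_h _)) hhE IH.
by rewrite (bilZl brkB) (bilZr brkB) -scalerDl.
Qed.

Lemma half_E j x : half x -> half (brk (E j) x).
Proof.
move: x; apply: (@half_ind [set x | half (brk (E j) x)]).
- exact: (sub_pre (bil_linr brkB _) (lspan_sub _)).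
- by move=> i w; apply: lspan_gen; left; exists i, (j :: w).
move=> t /=; rewrite -[brk _ _]opprK -brk_evenC ?hhE; last exact: homog_h.
rewrite -scaleNr; apply: subZ; first exact: lspan_sub.
by apply: lspan_gen; left; exists j, [::].
Qed.

(** [F] is moved inwards by the Jacobi identity; where it meets some [E j] it leaves an element of
    [h], which preserves [half]. *)
Lemma half_F b F i w : homog b F -> (forall i, exists t, brk F (E i) = hh t) ->
  half (brk F (iter_brk i w)).
Proof.
move=> hF FE; elim: w => [|j w IH] /=.
  by have [t ->] := FE i; apply: lspan_gen; right; exists t.
rewrite (brk_jac _ hF (hE j)); apply: subD; first exact: lspan_sub.
  have [t ->] := FE j; apply: half_h.
  by apply: lspan_gen; left; exists i, w.
by apply: subZ; [exact: lspan_sub|apply: half_E].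
Qed.

Lemma iter_brk_dg (e : int) i w : (forall i, dg e (E i)) ->
  dg (e * (size w).+1%:Z) (iter_brk i w).
Proof.
move=> hd; elim: w => [|j w IH] /=; first by rewrite mulr1.
have -> : e * (size w).+2%:Z = e + e * (size w).+1%:Z by lia.
exact: dg_brk.
Qed.
End Half.

Local Notation hX := (half X).
Local Notation hY := (half Y).

Definition tri : set g := [set x | exists2 u, hX u & hY (x - u)].

Lemma tri_sub : subspace tri.
Proof.
split; first by exists 0; rewrite ?subr0; apply: sub0; exact: lspan_sub.
move=> a x y [u hu hxu] [v hv hyv]; exists (a *: u + v).
  exact: (lspan_sub _).2.
have -> : a *: x + y - (a *: u + v) = a *: (x - u) + (y - v).
  by rewrite scalerBr opprD addrACA.
exact: (lspan_sub _).2.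
Qed.

Lemma hX_tri x : hX x -> tri x.
Proof. by move=> h; exists x => //; rewrite subrr; apply: sub0; exact: lspan_sub. Qed.
Lemma hY_tri x : hY x -> tri x.
Proof. by move=> h; exists 0; rewrite ?subr0 //; apply: sub0; exact: lspan_sub. Qed.

Lemma tri_ind (P : set g) : subspace P -> (forall x, hX x -> P x) ->
  (forall x, hY x -> P x) -> forall x, tri x -> P x.
Proof.
move=> sP h1 h2 x [u hu hxu]; rewrite -[x](subrK u) addrC.
by apply: subD => //; [apply: h1|apply: h2].
Qed.

Lemma brk_YX i j : exists t, brk (Y i) (X j) = hh t.
Proof.
rewrite (brk_anti (homog_Y i) (homog_X j)) brk_XY; case: eqP => [->|_].
  exists (- ((-1) ^+ (cd_p i && cd_p i) *: cd_hh i)).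
  by rewrite (lmapN ga_h_lin) (lmapZ ga_h_lin).
by exists 0; rewrite scaler0 oppr0 (lmap0 ga_h_lin).
Qed.

Lemma brk_XY_h i j : exists t, brk (X i) (Y j) = hh t.
Proof.
rewrite brk_XY; case: eqP => _; first by exists (cd_hh i).
by exists 0; rewrite (lmap0 ga_h_lin).
Qed.

Lemma brk_hY' t i : brk (hh t) (Y i) = (- cd_alpha i t : K) *: Y i.
Proof. by rewrite brk_hY scaleNr. Qed.

Lemma tri_adX i x : tri x -> tri (brk (X i) x).
Proof.
have sP := sub_pre (bil_linr brkB (X i)) tri_sub.
move: x; apply: (tri_ind sP).
  by move=> x h; apply: hX_tri; apply: (half_E (a := fun i t => cd_alpha i t)) => //; exact: brk_hX.
apply: (half_ind sP).
  move=> j w; apply: hY_tri; apply: (half_F homog_Y brk_hY' _ _ (homog_X i)).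
  exact: brk_XY_h.
move=> t; apply: hX_tri; apply: (half_E (a := fun i t => cd_alpha i t)); first exact: brk_hX.
by apply: lspan_gen; right; exists t.
Qed.

Lemma tri_adY i x : tri x -> tri (brk (Y i) x).
Proof.
have sP := sub_pre (bil_linr brkB (Y i)) tri_sub.
move: x; apply: (tri_ind sP).
  apply: (half_ind sP).
    move=> j w; apply: hX_tri; apply: (half_F homog_X (a := fun i t => cd_alpha i t) brk_hX _ _ (homog_Y i)).
    exact: brk_YX.
  move=> t; apply: hY_tri; apply: (half_E brk_hY').
  by apply: lspan_gen; right; exists t.
by move=> x h; apply: hY_tri; apply: (half_E brk_hY').
Qed.

Lemma tri_adh t x : tri x -> tri (brk (hh t) x).
Proof.
move: x; apply: (tri_ind (sub_pre (bil_linr brkB (hh t)) tri_sub)).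
  by move=> x h; apply: hX_tri; apply: (half_h (a := fun i t => cd_alpha i t)) => //; exact: brk_hX.
by move=> x h; apply: hY_tri; apply: (half_h brk_hY').
Qed.

(** The elements whose adjoint action preserves [tri] form a subalgebra containing all
    generators. *)
Lemma tri_ad x y : tri y -> tri (brk x y).
Proof.
move: x y; apply: (@ga_gen_homog [set x | forall y, tri y -> tri (brk x y)]).
- have sP z := sub_pre (bil_linl brkB z) tri_sub.
  split=> [z _|a u v hu hv z hz]; first exact: (sP z).1.
  by apply: (sP z).2; [apply: hu|apply: hv].
- move=> b c u v bu cv hu hv z hz.
  have := brk_jac z bu cv; move=> /eqP; rewrite -subr_eq => /eqP <-.
  by apply: (subB tri_sub); [|apply: (subZ tri_sub)];
    repeat first [apply: hu|apply: hv].
- by move=> t z; exact: tri_adh.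
- by move=> i z; exact: tri_adX.
- by move=> i z; exact: tri_adY.
Qed.

Lemma tri_all x : tri x.
Proof.
apply: (ga_gen tri_sub) => [|t|i|i]; first by move=> a b _; apply: tri_ad.
- by apply: hX_tri; apply: lspan_gen; right; exists t.
- by apply: hX_tri; apply: lspan_gen; left; exists i, [::].
- by apply: hY_tri; apply: lspan_gen; left; exists i, [::].
Qed.

(** Up to span this is finite: brackets of exactly [|k|] generators of one kind if [k != 0], and [h]
    if [k = 0]. *)
Definition piece (k : int) : set g :=
  [set x | (exists t, k = 0 /\ x = hh t) \/
           (exists i w, x = iter_brk X i w /\ k = (size w).+1%:Z) \/
           (exists i w, x = iter_brk Y i w /\ k = - (size w).+1%:Z)].

Lemma pieces_all x : lspan [set y | exists k, piece k y] x.
Proof.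
have sP := lspan_sub [set y | exists k, piece k y].
have ht t : lspan [set y | exists k, piece k y] (hh t).
  by apply: lspan_gen; exists 0; left; exists t.
have := tri_all x; apply: (tri_ind sP); apply: (half_ind sP) => // i w;
  apply: lspan_gen.
  by exists (size w).+1%:Z; right; left; exists i, w.
by exists (- (size w).+1%:Z); right; right; exists i, w.
Qed.

Lemma piece_dg k x : piece k x -> dg k x.
Proof.
move=> [[t [-> ->]]|[[i [w [-> ->]]]|[i [w [-> ->]]]]].
- by case: (gk_h t).
- have := @iter_brk_dg X 1 i w; rewrite mul1r; apply => j.
  by case: (gk_X j).
- have := @iter_brk_dg Y (-1) i w; rewrite mulN1r; apply => j.
  by case: (gk_Y j).
Qed.

Lemma piece_fin k : fin_dim (piece k).
Proof.
case: (ltrgt0P k) => [k0|k0|->].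
- pose T := ('I_(cd_n C) * (`|k|.-1).-tuple 'I_(cd_n C))%type.
  exists #|{: T}|, (fun r : 'I_#|{: T}| => iter_brk X (enum_val r).1 (enum_val r).2).
  move=> x [[t [? _]]|[[i [w [-> kE]]]|[i [w [_ kE]]]]]; [lia| |lia].
  apply: lspan_gen.
  have hw : size w == (`|k|.-1)%N by apply/eqP; lia.
  by exists (enum_rank (i, Tuple hw)) => //; rewrite enum_rankK.
- pose T := ('I_(cd_n C) * (`|k|.-1).-tuple 'I_(cd_n C))%type.
  exists #|{: T}|, (fun r : 'I_#|{: T}| => iter_brk Y (enum_val r).1 (enum_val r).2).
  move=> x [[t [? _]]|[[i [w [_ kE]]]|[i [w [-> kE]]]]]; [lia|lia|].
  apply: lspan_gen.
  have hw : size w == (`|k|.-1)%N by apply/eqP; lia.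
  by exists (enum_rank (i, Tuple hw)) => //; rewrite enum_rankK.
- exists (\dim {:cd_h C}), (fun r => hh (vbasis {:cd_h C})`_r).
  move=> x [[t [_ ->]]|[[i [w [_ kE]]]|[i [w [_ kE]]]]]; [|lia|lia].
  rewrite (coord_vbasis (memvf t)) (lmap_sum ga_h_lin).
  apply: (sub_sum (lspan_sub _)) => i _; rewrite (lmapZ ga_h_lin).
  by apply: (subZ (lspan_sub _)); apply: lspan_gen; exists i.
Qed.
End Contragredient.

(** * Consequences of the invariant form *)
Section Form.
Variables (K : numFieldType) (C : cartanDatum K) (g : contragredient C).
Variables (d : 'rV[K]_(cd_n C)) (B : g -> g -> K).
Hypothesis hB : standard_form d B.
Local Notation hh := (@ga_h K C g).
Implicit Types x y z : g.

Lemma form_bilinear : @bilinear_map K g g K^o B. Proof. by case: hB. Qed.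

Lemma form_inv x y z : B (brk x y) z = B x (brk y z).
Proof. by case: hB => _ [_ [_ []]]. Qed.

Lemma form_sym b c x y : homog b x -> homog c y -> B x y = (-1) ^+ (b && c) * B y x.
Proof. by case: hB => _ [_ [h _]]; apply: h. Qed.

Lemma form_even b x y : homog false x -> homog b y -> B x y = B y x.
Proof. by move=> hx hy; rewrite (form_sym hx hy) mul1r. Qed.

Lemma form_odd x y : homog true x -> homog true y -> B x y = - B y x.
Proof. by move=> hx hy; rewrite (form_sym hx hy) /= expr1 mulN1r. Qed.

Lemma form_par b c x y : homog b x -> homog c y -> b != c -> B x y = 0.
Proof.
case: hB => _ [h [h' _]]; case: b; case: c => // hx hy _; last exact: h.
by rewrite (h' _ _ _ _ hx hy) h ?mulr0.
Qed.

Lemma form_nd x : (forall y, B x y = 0) -> x = 0.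
Proof. by case: hB => _ [_ [_ [_ [h _]]]]; apply: h. Qed.

Lemma form_hh t j : B (hh t) (hh (cd_hh j)) = (d 0 j)^-1 * cd_alpha j t.
Proof. by case: hB => _ [_ [_ [_ [_ h]]]]; apply: h. Qed.

(** By invariance [ad gelt] is skew for [B], so eigenvectors pair to 0 unless their eigenvalues are
    opposite. *)
Lemma form_dg k l x y : dg k x -> dg l y -> k + l != 0 -> B x y = 0.
Proof.
move=> hx hy kl; have : k%:~R * B x y + l%:~R * B x y = 0.
  have <- : B (k%:~R *: x) y = k%:~R * B x y by rewrite (bilZl form_bilinear).
  have <- : B x (l%:~R *: y) = l%:~R * B x y by rewrite (bilZr form_bilinear).
  rewrite -hx -hy (brk_evenC x (homog_h g _)).
  by rewrite (bilNl form_bilinear) form_inv addNr.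
by rewrite -mulrDl -intrD => /eqP; rewrite mulf_eq0 intr_eq0 (negbTE kl) => /eqP.
Qed.

Lemma form_gk b c k l x y : gk b k x -> gk c l y -> (b != c) || (k + l != 0) ->
  B x y = 0.
Proof.
by move=> [bx kx] [cy ly] /orP[]; [apply: form_par bx cy|apply: form_dg kx ly].
Qed.

Lemma form_kerl y : subspace [set x | B x y = 0].
Proof.
split=> [|a u v /= hu hv]; first exact: (bil0l form_bilinear).
by rewrite (bilDl form_bilinear) (bilZl form_bilinear) hu hv scaler0 addr0.
Qed.

Lemma form_kerr x : subspace [set y | B x y = 0].
Proof.
split=> [|a u v /= hu hv]; first exact: (bil0r form_bilinear).
by rewrite (bilDr form_bilinear) (bilZr form_bilinear) hu hv scaler0 addr0.
Qed.

Lemma form_nd_gk b k x : gk b k x -> (forall y, gk b (- k) y -> B x y = 0) -> x = 0.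
Proof.
move=> hx h; apply: form_nd; apply: (gk_ind (form_kerr x)).
move=> c l y hy /=; case: (boolP ((b != c) || (k + l != 0))) => [hbc|].
  exact: form_gk hx hy hbc.
rewrite negb_or !negbK => /andP[/eqP bc /eqP kl]; apply: h.
by rewrite bc (_ : - k = l) //; lia.
Qed.

Lemma form_nd_gkr b k y : gk b (- k) y -> (forall x, gk b k x -> B x y = 0) -> y = 0.
Proof.
move=> hy h; apply: (form_nd_gk hy) => x; rewrite opprK => hx.
by rewrite (form_sym hy.1 hx.1) h ?mulr0.
Qed.

Lemma form_nd_dg k x : dg k x -> (forall y, dg (- k) y -> B x y = 0) -> x = 0.
Proof.
move=> hx h; have key b : spr g b x = 0.
  apply: (@form_nd_gk b k); first by split; [apply: spr_homog|apply: dg_spr].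
  move=> y hy.
  have := h y hy.2; rewrite -[x in B x y]spr_sum (bilDl form_bilinear).
  case: b hy => hy; rewrite ?(@form_par false true _ _ (spr_homog _ _) hy.1) //.
    by rewrite add0r.
  by rewrite (@form_par true false _ _ (spr_homog _ _) hy.1) // addr0.
by rewrite -[x]spr_sum !key addr0.
Qed.

Lemma deg_part_orth Q k x y : deg_part Q x -> dg k y -> ~~ Q (- k) -> B x y = 0.
Proof.
move=> hx hy hQ; move: x hx; apply: (@deg_part_ind _ _ _ _ [set x | B x y = 0]).
  exact: form_kerl.
move=> l x Ql /pdeg_dg hx; apply: (form_dg hx hy).
by apply: contraNneq hQ => /eqP; rewrite addr_eq0 => /eqP <-.
Qed.

(** By orthogonality an element of both parts pairs to 0 with every homogeneous element, so
    nondegeneracy applies. *)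
Lemma deg_part_disj Q x : deg_part Q x -> deg_part (predC Q) x -> x = 0.
Proof.
move=> h1 h2; apply: form_nd; apply: (gk_ind (form_kerr x)).
move=> c l y hy /=; case: (boolP (Q (- l))) => hQ.
  by apply: deg_part_orth h2 hy.2 _; rewrite /= hQ.
exact: deg_part_orth h1 hy.2 hQ.
Qed.

Lemma deg_part_split Q x : exists u, deg_part Q u /\ deg_part (predC Q) (x - u).
Proof.
pose P := [set x : g | exists u, deg_part Q u /\ deg_part (predC Q) (x - u)].
apply: (@deg_part_ind _ _ _ predT P) (deg_part_all x).
  split.
    by exists 0; rewrite subr0; split; apply: sub0; apply: deg_part_sub.
  move=> a u v [u1 [h1 h2]] [v1 [h3 h4]]; exists (a *: u1 + v1); split.
    exact: (deg_part_sub g _).2.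
  have -> : a *: u + v - (a *: u1 + v1) = a *: (u - u1) + (v - v1).
    by rewrite scalerBr opprD addrACA.
  exact: (deg_part_sub g _).2.
move=> k y _ py; case: (boolP (Q k)) => hQ.
  exists y; rewrite subrr; split; first exact: deg_part_gen hQ py.
  exact: sub0 (deg_part_sub g _).
exists 0; rewrite subr0; split; first exact: sub0 (deg_part_sub g _).
exact: deg_part_gen hQ py.
Qed.

(** The part of [x] generated in degrees other than [k] again has eigenvalue [k], yet is orthogonal
    to degree [- k]; hence it is 0. The projections of the definitions can now be read off from
    eigenvalues. *)
Lemma dg_pdeg k x : dg k x -> pdeg k x.
Proof.
move=> hx; have [u [hu hxu]] := deg_part_split (pred1 k) x.
have pu : pdeg k u.
  move: u hu {hxu}; apply: (@deg_part_ind _ _ _ (pred1 k) (@pdeg _ _ g k)).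
    by split=> [|a u v]; [apply: pdeg_zero|apply: pdeg_lin].
  by move=> l u /= /eqP ->.
suff : x - u = 0 by move=> /eqP; rewrite subr_eq0 => /eqP ->.
apply: (@form_nd_dg k) => [|y hy].
  by apply: (subB (dg_sub g k)) => //; apply: pdeg_dg.
by apply: (deg_part_orth hxu hy); rewrite /= opprK negbK.
Qed.

Lemma dg_deg_part (Q : pred int) k x : Q k -> dg k x -> deg_part Q x.
Proof. by move=> Qk /dg_pdeg; apply: deg_part_gen. Qed.

Lemma deg_projP Q x : deg_part Q (deg_proj Q x) /\ deg_part (predC Q) (x - deg_proj Q x).
Proof.
exact: (@xgetPex _ 0 [set u | deg_part Q u /\ deg_part (predC Q) (x - u)]
  (deg_part_split Q x)).
Qed.

Lemma deg_proj_eq Q x u : deg_part Q u -> deg_part (predC Q) (x - u) -> deg_proj Q x = u.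
Proof.
move=> h1 h2; have [h3 h4] := deg_projP Q x.
apply/eqP; rewrite -subr_eq0; apply/eqP; apply: (@deg_part_disj Q).
  exact: (subB (deg_part_sub g _)).
have -> : deg_proj Q x - u = (x - u) - (x - deg_proj Q x).
  by rewrite opprB [RHS]addrC addrA subrK.
exact: (subB (deg_part_sub g _)).
Qed.

Lemma deg_proj_lin Q : linear (@deg_proj K C g Q).
Proof.
move=> a x y; have [h1 h2] := deg_projP Q x; have [h3 h4] := deg_projP Q y.
apply: deg_proj_eq; first exact: (deg_part_sub g _).2.
have -> : a *: x + y - (a *: deg_proj Q x + deg_proj Q y)
    = a *: (x - deg_proj Q x) + (y - deg_proj Q y).
  by rewrite scalerBr opprD addrACA.
exact: (deg_part_sub g _).2.
Qed.

Lemma deg_proj_dg (Q : pred int) k x : dg k x -> deg_proj Q x = if Q k then x else 0.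
Proof.
move=> hx; case: ifPn => hQ; apply: deg_proj_eq; rewrite ?subrr ?subr0.
- exact: dg_deg_part hQ hx.
- exact: sub0 (deg_part_sub g _).
- exact: sub0 (deg_part_sub g _).
- exact: dg_deg_part hx.
Qed.

Lemma deg_proj_homog Q b x : homog b x -> homog b (deg_proj Q x).
Proof.
move=> hx; have hlin := deg_proj_lin Q.
have hc u : spr g b (deg_proj Q u) = deg_proj Q (spr g b u).
  move: u; apply: gk_ind.
    by apply: sub_eq; apply: linear_comp => //; exact: linearP.
  move=> c k y hy /=; rewrite (deg_proj_dg _ hy.2) (deg_proj_dg _ (dg_spr _ hy.2)).
  by case: ifP => // _; rewrite linear0.
by rewrite /homog /= hc hx.
Qed.

(** An expansion of [x] in pieces is sorted by degree, and nondegeneracy kills the remainder. Finite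
    dimensionality of the degree parts and [dg0_h] follow. *)
Lemma dg_piece k x : dg k x -> lspan (piece k) x.
Proof.
move=> hx.
pose P := [set x : g | exists2 u, lspan (piece k) u & deg_part (predC (pred1 k)) (x - u)].
have [u hu hxu] : P x.
  apply: (lspan_ind _ _ (pieces_all x)).
    split; first by exists 0; rewrite ?subr0; apply: sub0; [apply: lspan_sub|apply: deg_part_sub].
    move=> a y z [u1 h1 h2] [v1 h3 h4]; exists (a *: u1 + v1).
      exact: (lspan_sub _).2.
    have -> : a *: y + z - (a *: u1 + v1) = a *: (y - u1) + (z - v1).
      by rewrite scalerBr opprD addrACA.
    exact: (deg_part_sub g _).2.
  move=> y [l py]; case: (eqVneq l k) py => [->|lk] py.
    exists y; first exact: lspan_gen.
    by rewrite subrr; apply: sub0 (deg_part_sub g _).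
  exists 0; first exact: sub0 (lspan_sub _).
  by rewrite subr0; apply: (@dg_deg_part _ l) => //; apply: piece_dg.
suff : x - u = 0 by move=> /eqP; rewrite subr_eq0 => /eqP ->.
apply: (@form_nd_dg k) => [|y hy].
  apply: (subB (dg_sub g k)) => //.
  by apply: (lspan_ind (dg_sub g k) _ hu) => y; apply: piece_dg.
by apply: (deg_part_orth hxu hy); rewrite /= opprK negbK.
Qed.

Lemma dg0_h x : dg 0 x -> exists t, x = hh t.
Proof.
move=> /dg_piece; apply: (@lspan_ind _ _ _ [set x | exists t, x = hh t]).
  split; first by exists 0; rewrite (lmap0 (ga_h_lin g)).
  by move=> a u v [s ->] [t ->]; exists (a *: s + t); rewrite ga_h_lin.
by move=> y [[t [_ ->]]|[[i [w [_ /eqP]]]|[i [w [_ /eqP]]]]] //; exists t.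
Qed.

(** Degree 0 is [h], which is even. Thus odd elements split into a positive and a negative part,
    with nothing in between. *)
Lemma gk_odd0 x : gk true 0 x -> x = 0.
Proof.
move=> [hx h0]; have [t xt] := dg0_h h0.
by apply: homog_both => //; rewrite xt; apply: homog_h.
Qed.

Lemma gk_fin b k : fin_dim (@gk K C g b k).
Proof.
have [n [e he]] := piece_fin g k; exists n, e => x [_ /dg_piece].
by apply: lspan_ind; [exact: lspan_sub|exact: he].
Qed.

Lemma form_dual_systems : exists cs : bool -> int -> seq (g * g),
  forall b k, dual_system B (gk b k) (gk b (- k)) (cs b k).
Proof.
suff /choice[cs h] : forall bk : bool * int, exists s,
    dual_system B (gk bk.1 bk.2) (gk bk.1 (- bk.2)) s.
  by exists (fun b k => cs (b, k)) => b k; apply: (h (b, k)).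
move=> [b k] /=; apply: (dual_system_exists form_bilinear) (gk_fin b k) _ _; try exact: gk_sub.
- by move=> w; apply: form_nd_gk.
- by move=> w; apply: form_nd_gkr.
Qed.

End Form.

(** * Casimir tensors *)
Section Casimir.
Variables (K : numFieldType) (C : cartanDatum K) (g : contragredient C).
Variables (d : 'rV[K]_(cd_n C)) (B : g -> g -> K).
Hypothesis hB : standard_form d B.
Hypothesis hd : symmetrizer d.
Variable cs : bool -> int -> seq (g * g).
Hypothesis hcs : forall b k, dual_system B (gk b k) (gk b (- k)) (cs b k).
Variable rho : hdual C.
Hypothesis hrho : weyl_vector rho.
Local Notation hh := (@ga_h K C g).
Local Notation brkB := (@brkB K g).
Local Notation formB := (form_bilinear hB).
Implicit Types x y z w : g.

Lemma cs1 b k p : p \in cs b k -> gk b k p.1.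
Proof. by have [h _ _] := hcs b k; move=> /h[]. Qed.
Lemma cs2 b k p : p \in cs b k -> gk b (- k) p.2.
Proof. by have [h _ _] := hcs b k; move=> /h[]. Qed.
Lemma cs_exp1 b k w : gk b k w -> w = \sum_(p <- cs b k) B w p.2 *: p.1.
Proof. by have [_ h _] := hcs b k; apply: h. Qed.
Lemma cs_exp2 b k w : gk b (- k) w -> w = \sum_(p <- cs b k) B p.1 w *: p.2.
Proof. by have [_ _ h] := hcs b k; apply: h. Qed.

Section Shift.
Variables (U : lmodType K) (Phi : g -> g -> U).
Hypothesis hPhi : bilinear_map Phi.

(** Invariance of the canonical tensor: the bracket with [z] passes from one leg to the other, while
    degree and parity of the layer change by those of [z]. *)
Lemma cs_shift b c k j z : gk c j z ->
  \sum_(p <- cs b k) Phi p.2 (brk p.1 z) =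
  \sum_(q <- cs (b (+) c) (k + j)) Phi (brk z q.2) q.1.
Proof.
move=> hz.
transitivity (\sum_(p <- cs b k) \sum_(q <- cs (b (+) c) (k + j))
    B p.1 (brk z q.2) *: Phi p.2 q.1).
  apply: eq_big_seq => p /cs1 hp; rewrite {1}(cs_exp1 (gk_brk hp hz)) (bil_sumr hPhi).
  by apply: eq_bigr => q _; rewrite (bilZr hPhi) (form_inv hB).
rewrite exchange_big /=; apply: eq_big_seq => q /cs2 hq.
have hzq : gk b (- k) (brk z q.2).
  have := gk_brk hz hq; rewrite addbC -addbA addbb addbF.
  by rewrite (_ : j - (k + j) = - k) //; lia.
rewrite {2}(cs_exp2 hzq) (bil_suml hPhi); apply: eq_bigr => p _.
by rewrite (bilZl hPhi).
Qed.

(** On even elements [B] is symmetric, so exchanging the entries of each pair turns a system for [k]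
    into one for [- k]. In odd parity a sign would appear, see [dual_system_skew]. *)
Lemma cs_flip k :
  \sum_(p <- cs false (- k)) Phi p.2 p.1 = \sum_(p <- cs false k) Phi p.1 p.2.
Proof.
pose s := [seq (p.2, p.1) | p <- cs false k].
have hs : dual_system B (gk false (- k)) (gk false (- (- k))) s.
  rewrite opprK; split.
  - by move=> _ /mapP[p ps ->] /=; split; [apply: cs2 ps|apply: cs1 ps].
  - move=> w hw; rewrite big_map {1}(cs_exp2 hw); apply: eq_big_seq => p /cs1 hp /=.
    by rewrite (form_even hB hp.1 hw.1).
  - move=> w hw; rewrite big_map {1}(cs_exp1 hw); apply: eq_big_seq => p /cs2 hp /=.
    by rewrite (form_even hB hw.1 hp.1).
by rewrite (dual_system_unique hPhi (hcs _ _) hs) big_map.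
Qed.


Lemma cs_odd0 : \sum_(p <- cs true 0) Phi p.2 p.1 = 0.
Proof. by rewrite big1_seq // => p /cs1 /(gk_odd0 hB) ->; rewrite (bil0r hPhi). Qed.
End Shift.

Definition csa k := cs false k ++ cs true k.

Lemma csa_shift (U : lmodType K) (Phi : g -> g -> U) c k j z :
  bilinear_map Phi -> gk c j z ->
  \sum_(p <- csa k) Phi p.2 (brk p.1 z) =
  \sum_(q <- csa (k + j)) Phi (brk z q.2) q.1.
Proof.
move=> hPhi hz; rewrite !big_cat /= !(cs_shift hPhi _ _ hz).
by case: c hz => _ //; rewrite addrC.
Qed.

Lemma cs_commutator (V : lmodType K) (m : g -> V -> V) b c k j z v :
  bilinear_map m ->
  (forall b c x y v, homog b x -> homog c y ->
     m x (m y v) = m (brk x y) v + (-1) ^+ (b && c) *: m y (m x v)) ->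
  gk c j z ->
  \sum_(p <- cs b k) m p.2 (m p.1 (m z v)) - m z (\sum_(p <- cs b k) m p.2 (m p.1 v))
  = \sum_(p <- cs b k) m p.2 (m (brk p.1 z) v)
    - \sum_(p <- cs b k) m (brk z p.2) (m p.1 v).
Proof.
move=> hm hrep hz; rewrite (bil_sumr hm) -!sumrB; apply: eq_big_seq => p ps.
rewrite (hrep _ _ _ _ _ (cs1 ps).1 hz.1) (hrep _ _ _ _ _ hz.1 (cs2 ps).1).
rewrite (bilDr hm) (bilZr hm) [c && b]andbC opprD addrA.
by rewrite addrAC addrK.
Qed.

(** The commutator of a layer with [z] is one and the same expression taken at [k + j] minus at [k];
    sums over [k] therefore telescope. *)
Lemma csa_commutator (V : lmodType K) (m : g -> V -> V) c k j z v :
  bilinear_map m ->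
  (forall b c x y v, homog b x -> homog c y ->
     m x (m y v) = m (brk x y) v + (-1) ^+ (b && c) *: m y (m x v)) ->
  gk c j z ->
  \sum_(p <- csa k) m p.2 (m p.1 (m z v)) - m z (\sum_(p <- csa k) m p.2 (m p.1 v))
  = \sum_(p <- csa (k + j)) m (brk z p.2) (m p.1 v)
    - \sum_(p <- csa k) m (brk z p.2) (m p.1 v).
Proof.
move=> hm hrep hz.
have hPhi : bilinear_map (fun x y => m x (m y v)).
  by split=> u; [exact: (linear_comp (bil_linr hm u) (bil_linl hm v))|exact: (bil_linl hm)].
rewrite -(csa_shift k hPhi hz) !big_cat /= (bilDr hm) opprD addrACA.
by rewrite !(cs_commutator _ _ _ hm hrep hz) opprD addrACA.
Qed.

Definition sharp (l : hdual C) : g := hh (dual_vec B l).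

(** [dual_vec] is chosen by [xget], so a representing vector must be exhibited: the canonical tensor
    of degree 0 turns the functional into an element of [h]. *)
Lemma sharpE l t : B (sharp l) (hh t) = l t.
Proof.
suff [s hs] : exists s, forall t, B (hh s) (hh t) = l t.
  have := @xgetPex _ 0 [set t | forall s, B (hh t) (hh s) = l s].
  by rewrite /sharp /dual_vec; apply; exists s.
suff [s hs] : exists s, hh s = \sum_(p <- cs false 0)
    (l (xget 0 [set t | hh t = p.2]) : K) *: p.1.
  exists s => {}t; rewrite hs (bil_suml formB).
  transitivity (\sum_(p <- cs false 0) (B p.1 (hh t) : K) * (l (xget 0 [set t | hh t = p.2]))).
    by apply: eq_bigr => p _; rewrite (bilZl formB) [LHS]mulrC.
  have ht : gk false (- 0) (hh t) by rewrite oppr0; apply: gk_h.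
  have -> : l t = l (\sum_(p <- cs false 0) B p.1 (hh t) *: (xget 0 [set t | hh t = p.2])).
    congr (l _); apply/eqP; rewrite -subr_eq0; apply/eqP/(@ga_h_inj _ _ g).
    rewrite (lmapB (ga_h_lin g)) (lmap_sum (ga_h_lin g)) {1}(cs_exp2 ht).
    rewrite -sumrB big1_seq // => p /= /cs2[_]; rewrite oppr0 => /(dg0_h hB)[u pu].
    rewrite (lmapZ (ga_h_lin g)) (_ : hh (xget _ _) = p.2) ?subrr //.
    by apply: (@xgetPex _ 0 [set t | hh t = p.2]); exists u.
  by rewrite linear_sum /=; apply: eq_bigr => p _; rewrite linearZ.
have : gk false 0 (\sum_(p <- cs false 0) (l (xget 0 [set t | hh t = p.2]) : K) *: p.1).
  by apply: (sub_sum (gk_sub g _ _)) => p /cs1 hp; apply: (subZ (gk_sub g _ _)).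
by move=> [_ /(dg0_h hB)[s ->]]; exists s.
Qed.

Lemma gk_sharp l : gk false 0 (sharp l). Proof. exact: gk_h. Qed.

Lemma sharp_lin a l l' : sharp (a *: l + l') = a *: sharp l + sharp l'.
Proof.
apply/eqP; rewrite -subr_eq0; apply/eqP; apply: (@form_nd_gk _ _ _ _ _ hB false 0).
  by apply: (subB (gk_sub g _ _)); [|apply: (gk_sub g _ _).2]; apply: gk_sharp.
move=> y [_]; rewrite oppr0 => /(dg0_h hB)[t ->].
rewrite (bilBl formB) (bilDl formB) (bilZl formB) !sharpE lfunE /= lfunE /=.
by rewrite subrr.
Qed.

Definition asharp i := sharp (cd_alpha i).

Lemma brk_0X u i b : gk b 0 u -> brk u (ga_X g i) = B u (asharp i) *: ga_X g i.
Proof.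
case: b => [/(gk_odd0 hB)->|]; first by rewrite (bil0l brkB) (bil0l formB) scale0r.
move=> [_ /(dg0_h hB)[t ->]]; rewrite brk_hX; congr (_ *: _).
by rewrite (form_even hB (homog_h g t) (gk_sharp _).1) sharpE.
Qed.

Lemma brk_0Y u i b : gk b 0 u -> brk u (ga_Y g i) = - (B u (asharp i) *: ga_Y g i).
Proof.
case: b => [/(gk_odd0 hB)->|]; first by rewrite (bil0l brkB) (bil0l formB) scale0r oppr0.
move=> [_ /(dg0_h hB)[t ->]]; rewrite brk_hY; congr (- (_ *: _)).
by rewrite (form_even hB (homog_h g t) (gk_sharp _).1) sharpE.
Qed.

(** Multiplied by [d_i^-1], the two sides are [alpha_i(h_i)] and [2 rho(h_i)]. This is how the Weyl
    vector enters the Casimir computations. *)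
Lemma form_alpha_rho i : B (asharp i) (asharp i) = 2 * B (sharp rho) (asharp i).
Proof.
have hi l : B (sharp l) (hh (cd_hh i)) = (d 0 i)^-1 * B (sharp l) (asharp i).
  rewrite (form_hh hB) -sharpE; congr (_ * _).
  exact: (form_even hB (gk_sharp _).1 (gk_sharp _).1).
have d0 : (d 0 i)^-1 != 0 by rewrite invr_eq0; case: hd.
apply: (mulfI d0); rewrite -hi mulrCA -hi !sharpE hrho mulrA divff ?mul1r //.
by rewrite pnatr_eq0.
Qed.

Lemma cs0_pair (U : lmodType K) (f : g -> U) b w : linear f -> gk b 0 w ->
  \sum_(p <- cs b 0) B p.1 w *: f p.2 = f w.
Proof.
move=> hf hw; have hw' : gk b (- 0) w by rewrite oppr0.
rewrite [in RHS](cs_exp2 hw') (lmap_sum hf).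
by apply: eq_bigr => p _; rewrite (lmapZ hf).
Qed.

Lemma cs0_pair' (U : lmodType K) (f : g -> U) w : linear f -> gk false 0 w ->
  \sum_(p <- cs false 0) B p.2 w *: f p.1 = f w.
Proof.
move=> hf hw; rewrite [in RHS](cs_exp1 hw) (lmap_sum hf).
apply: eq_big_seq => p /cs2 hp; rewrite (lmapZ hf) (form_even hB hp.1 hw.1) //.
Qed.

Definition casimir_part b k y := \sum_(p <- cs b k) brk p.2 (brk p.1 y).

Lemma casimir_part_lin b k : linear (casimir_part b k).
Proof.
apply: linear_bigsum => p; exact: (linear_comp (bil_linr brkB _) (bil_linr brkB _)).
Qed.

(** A truncated Casimir operator of the adjoint module, meant for [y] of degree [- l]: only layers
    below [l] are kept, with weight 1 instead of 2. On a root vector of root [- a], its vanishing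
    says that the double brackets over [0 < k < l] add up to [(2 (rho, a) - (a, a)) y]. *)
Definition lowering l y :=
  casimir_part false 0 y + 2 *: brk (sharp rho) y +
  \sum_(1 <= k < l) (casimir_part false k%:Z y + casimir_part true k%:Z y).

Lemma lowering_lin l : linear (lowering l).
Proof.
apply: linear_add; first apply: linear_add.
- exact: casimir_part_lin.
- exact: (linear_scale _ (bil_linr brkB _)).
- by apply: linear_bigsum => k; apply: linear_add; apply: casimir_part_lin.
Qed.

Lemma brkrep b c x y v : homog b x -> homog c y ->
  brk x (brk y v) = brk (brk x y) v + (-1) ^+ (b && c) *: brk y (brk x v).
Proof. exact: (brk_jac (L := g)). Qed.

Lemma lowering_Y i : lowering 1 (ga_Y g i) = 0.
Proof.
rewrite /lowering big_geq // addr0 /casimir_part.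
rewrite (brk_0Y i (gk_sharp rho)) scalerN scalerA -form_alpha_rho.
have hf : linear (fun w => brk w (ga_Y g i)) := bil_linl brkB _.
rewrite (eq_big_seq (fun p => - (B p.1 (asharp i) *: brk p.2 (ga_Y g i)))); last first.
  by move=> p /cs1 hp; rewrite (brk_0Y i hp) (bilNr brkB) (bilZr brkB).
rewrite sumrN (cs0_pair (f := fun w => brk w (ga_Y g i))) //; last exact: gk_sharp.
by rewrite (brk_0Y i (gk_sharp _)) opprK subrr.
Qed.

(** Commuting layer [k] past [Y_i] leaves [T (k - 1) - T k], in total [T 0 - T l]. The new top layer
    supplies [T l]; the rest cancels against layer 0 and the [rho] term by [form_alpha_rho]. *)
Lemma lowering_step i e l y : gk e (- l.+1%:Z) y ->
  lowering l.+2 (brk (ga_Y g i) y) = brk (ga_Y g i) (lowering l.+1 y).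
Proof.
set z := ga_Y g i => hy; set c := cd_p i.
have hz : gk c (-1) z by apply: gk_Y.
set a := asharp i.
have ha : gk false 0 a by apply: gk_sharp.
pose T k := \sum_(p <- csa k) brk (brk z p.2) (brk p.1 y).
pose ck k y := casimir_part false k y + casimir_part true k y.
have ckE k u : ck k u = \sum_(p <- csa k) brk p.2 (brk p.1 u) by rewrite big_cat.
have ck_step k : ck k (brk z y) = brk z (ck k y) + (T (k - 1) - T k).
  have := csa_commutator k y brkB brkrep hz; rewrite -!ckE => /eqP.
  by rewrite subr_eq addrC => /eqP.
pose w' := brk a y.
have hw' : gk e (- l.+1%:Z) w' by have := gk_brk ha hy; rewrite add0r.
have hza u b : gk b 0 u -> brk z u = B u a *: z.
  case: b => [/(gk_odd0 hB)->|hu]; first by rewrite (bil0r brkB) (bil0l formB) scale0r.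
  by rewrite -[LHS]opprK -(brk_evenC _ hu.1) (brk_0Y i hu) opprK.
have T0 : T 0 = brk z w'.
  rewrite /T big_cat /= [X in _ + X]big1_seq ?addr0; last first.
    move=> p /= /cs2; rewrite oppr0 => /(gk_odd0 hB) ->.
    by rewrite (bil0r brkB) (bil0l brkB).
  rewrite (eq_big_seq (fun p => B p.2 a *: brk z (brk p.1 y))); last first.
    move=> p /cs2; rewrite oppr0 => hp.
    by rewrite (hza _ _ hp) (bilZl brkB).
  by rewrite (cs0_pair' (f := fun u => brk z (brk u y))) // => s u v;
    rewrite (bil_linl brkB) (bil_linr brkB).
(* In the top layer [[p.1, y]] has degree 0, so its bracket with [Y_i] is a multiple of [Y_i];
   summing the multiples over the dual vectors rebuilds [w']. *)
have cL : ck l.+1%:Z (brk z y) = T l%:Z + brk z w'.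
  have hs b p : p \in cs b l.+1%:Z ->
      brk p.2 (brk p.1 (brk z y)) = brk p.2 (brk (brk p.1 z) y) +
        (-1) ^+ (b && c) *: (- (B p.1 w' *: brk p.2 z)).
    move=> ps; rewrite (brk_jac y (cs1 ps).1 hz.1) (bilDr brkB) (bilZr brkB).
    congr (_ + _ *: _).
    have hu : gk (b (+) e) 0 (brk p.1 y).
      by have := gk_brk (cs1 ps) hy; rewrite subrr.
    rewrite (hza _ _ hu) (bilZr brkB) (form_inv hB).
    have -> : brk y a = - w' by rewrite /w' (brk_evenC y ha.1) opprK.
    by rewrite (bilNr formB) scaleNr.
  have hG b : \sum_(p <- cs b l.+1%:Z) (-1) ^+ (b && c) *: (- (B p.1 w' *: brk p.2 z))
      = if b == e then brk z w' else 0.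
    rewrite -scaler_sumr sumrN; case: eqP => [be|/eqP be].
      rewrite be in hs *.
      have -> : \sum_(p <- cs e l.+1%:Z) B p.1 w' *: brk p.2 z = brk w' z.
        rewrite [in RHS](cs_exp2 hw') (bil_suml brkB).
        by apply: eq_bigr => p _; rewrite (bilZl brkB).
      by rewrite (brk_anti hw'.1 hz.1) opprK scalerA -signr_addb addbb scale1r.
    rewrite big1_seq ?oppr0 ?scaler0 // => p /= /cs1 hp.
    by rewrite (form_gk hB hp hw') ?be // scale0r.
  rewrite ckE.
  have -> : T l%:Z = \sum_(p <- csa l.+1%:Z) brk p.2 (brk (brk p.1 z) y).
    have hPhi : bilinear_map (fun x1 y1 => brk x1 (brk y1 y)).
      by split=> u; [exact: (linear_comp (bil_linr brkB u) (bil_linl brkB y))|exact: (bil_linl brkB)].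
    rewrite (csa_shift _ hPhi hz) /T.
    by rewrite (_ : l.+1%:Z - 1 = l%:Z) //; lia.
  rewrite !big_cat /= !(eq_big_seq _ (@hs _)) !big_split /= !hG addrACA.
  by case: (e); rewrite /= ?add0r ?addr0.
have tel n : (n <= l)%N -> \sum_(1 <= k < n.+1) ck k%:Z (brk z y) =
    brk z (\sum_(1 <= k < n.+1) ck k%:Z y) + (T 0 - T n%:Z).
  elim: n => [|n IH] nl; first by rewrite !big_geq // (bil0r brkB) subrr addr0.
  rewrite big_nat_recr //= [in RHS]big_nat_recr //= (bilDr brkB) IH ?(ltnW nl) // ck_step.
  rewrite (_ : n.+1%:Z - 1 = n%:Z); last by lia.
  by rewrite addrACA; congr (_ + _); rewrite addrA subrK.
have F0 : casimir_part false 0 (brk z y) =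
    brk z (casimir_part false 0 y) + (B a a *: brk z y - 2 *: brk z w').
  have := cs_commutator false 0 y brkB brkrep hz.
  move=> /eqP; rewrite subr_eq addrC => /eqP; rewrite /casimir_part => ->.
  congr (_ + _).
  have -> : \sum_(p <- cs false 0) brk (brk z p.2) (brk p.1 y) = brk z w'.
    move: T0; rewrite /T big_cat /= [X in _ + X]big1_seq ?addr0 //.
    move=> p /= /cs2; rewrite oppr0 => /(gk_odd0 hB) ->.
    by rewrite (bil0r brkB) (bil0l brkB).
  rewrite (eq_big_seq (fun p => B p.1 a *: - brk p.2 (brk z y))); last first.
    move=> p /cs1 hp; rewrite (brk_0Y i hp) -/z -/a (bilNl brkB) (bilNr brkB).
    by rewrite (bilZl brkB) (bilZr brkB) scalerN.
  rewrite (cs0_pair (f := fun u => - brk u (brk z y))) //; last first.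
    by move=> s u v; rewrite (bil_linl brkB) opprD scalerN.
  rewrite (brk_jac_even _ _ ha.1) (brk_0Y i ha) -/a -/z -/w' (bilNl brkB) (bilZl brkB).
  by rewrite opprD opprK scaler_nat mulr2n opprD addrA.
have R0 : brk (sharp rho) (brk z y) =
    brk z (brk (sharp rho) y) - B (sharp rho) a *: brk z y.
  rewrite (brk_jac_even _ _ (gk_sharp rho).1) (brk_0Y i (gk_sharp rho)) -/a -/z.
  by rewrite (bilNl brkB) (bilZl brkB) addrC.
rewrite /lowering big_nat_recr //= -/(ck _ _) cL.
have -> : \sum_(1 <= k < l.+1) (casimir_part false k%:Z (brk z y)
   + casimir_part true k%:Z (brk z y)) = \sum_(1 <= k < l.+1) ck k%:Z (brk z y) by [].
rewrite tel // F0 R0 T0 scalerBr scalerA -form_alpha_rho -/a !(bilDr brkB) (bilZr brkB).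
rewrite -[\sum_(_ <= _ < _) (_ + _)]/(\sum_(1 <= k < l.+1) ck k%:Z y).
move: (casimir_part _ _ _) => A1; move: (\sum_(_ <= _ < _) _) => A2.
move: (brk z A1) (brk z A2) => {A1 A2} A1 A2.
move: (2 *: brk z (brk _ _)) (B a a *: _) (T _) => A3 A4 A5.
rewrite scaler_nat mulr2n; move: (brk z w') => A6.
have -> : A2 + (A6 - A5) + (A5 + A6) = A2 + (A6 + A6).
  by rewrite -addrA; congr (_ + _); rewrite addrA subrK.
have -> : A1 + (A4 - (A6 + A6)) + (A3 - A4) = A1 + A3 - (A6 + A6).
  by rewrite addrACA; congr (_ + _); rewrite addrAC subrr add0r.
by rewrite addrACA addNr addr0.
Qed.

(** Degree [- l.+1] is spanned by brackets of [l.+1] generators [Y_i], so the induction starts in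
    degree -1 and proceeds by [lowering_step]. *)
Lemma lowering_eq0 l y : dg (- l.+1%:Z) y -> lowering l.+1 y = 0.
Proof.
move=> /(dg_piece hB).
apply: (@lspan_ind _ _ _ [set y | lowering l.+1 y = 0]).
  split=> [|a u v /= hu hv]; first exact: (lmap0 (lowering_lin _)).
  by rewrite lowering_lin hu hv scaler0 addr0.
move=> {}y [[t [/eqP]]|[[i [w [_ /eqP]]]|[i [w [-> kE]]]]] //.
have {kE} -> : l = size w by lia.
have hdg u : dg (- (size u).+1%:Z) (iter_brk (@ga_Y K C g) i u).
  have := @iter_brk_dg _ _ g (@ga_Y K C g) (-1) i u; rewrite mulN1r; apply => j.
  by case: (gk_Y g j).
elim: w => [|j w IH] /=; first exact: lowering_Y.
suff [e he] : exists e, homog e (iter_brk (@ga_Y K C g) i w).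
  by rewrite (lowering_step j (conj he (hdg w))) IH (bil0r brkB).
elim: w {IH} => [|k w [e he]] /=; first by exists (cd_p i); exact: homog_Y.
by exists (cd_p k (+) e); apply: brk_parity => //; exact: homog_Y.
Qed.

(** Moving the odd [y] through the tensor makes an odd layer even; the degree becomes [k - L], and
    [cs_flip] turns it into [L - k]. *)
Lemma casimir_part_swap y L k : gk true (- L) y ->
  casimir_part true k y = casimir_part false (L - k) y.
Proof.
move=> hy.
rewrite /casimir_part (cs_shift brkB true k hy) /=.
have hPhi : bilinear_map (fun u v => brk (brk y u) v).
  by split=> u; [exact: (bil_linr brkB)|exact: (linear_comp (bil_linl brkB u) (bil_linr brkB y))].
have -> : k - L = - (L - k) by rewrite opprB.
rewrite (cs_flip hPhi); apply: eq_big_seq => p ps.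
have h1 := cs1 ps; have h2 := cs2 ps.
by rewrite -[LHS]opprK -(brk_evenC _ h2.1) (brk_evenC y h1.1) (bilNr brkB).
Qed.

(* On odd vectors the odd part of the Casimir tensor contributes as much as the
   even one, whence a formula in the even part alone. *)
Lemma lowering_odd l y : gk true (- l.+1%:Z) y ->
  casimir_part false 0 y + 2 *: brk (sharp rho) y +
  \sum_(1 <= k < l.+1) 2 *: casimir_part false k%:Z y = 0.
Proof.
move=> hy; rewrite -[RHS](lowering_eq0 hy.2) /lowering; congr (_ + _).
rewrite -scaler_sumr scaler_nat mulr2n big_split /=; congr (_ + _).
rewrite big_nat_rev /= big_nat [RHS]big_nat; apply: eq_bigr => k /andP[k1 k2].
rewrite (casimir_part_swap _ hy); congr casimir_part.
lia.
Qed.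

End Casimir.

(* The weights of the degree k part in a Casimir operator, whose summands of
   negative degree are reordered into positive degree. *)
Section CasimirWeights.
Variable K : numFieldType.

Definition cw (k : int) : K := if 0 < k then 2 else if k == 0 then 1 else 0.

Lemma cw_neg k : k < 0 -> cw k = 0.
Proof. by move=> k0; rewrite /cw; case: ifP => [|_]; [lia|case: eqP => //; lia]. Qed.

Lemma zfin_cw (V : lmodType K) (f : int -> V) (N : nat) :
  (forall k : int, N%:Z < k -> f k = 0) -> zfin (fun k => cw k *: f k).
Proof.
move=> h; exists N => k hk; case: (ltrP k 0) => k0.
  by rewrite cw_neg // scale0r.
by rewrite h ?scaler0 //; lia.
Qed.

(** The weight rises by 1 from degree -1 to 0 and from 0 to 1 and is constant elsewhere, so a shift
    by one step changes it at two places, each time by [- j]. *)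
Lemma zsum_cw_diff (V : lmodType K) (f : int -> V) j : (j == 1) || (j == -1) ->
  zsum (fun k => (cw (k - j) - cw k) *: f k) = (- j)%:~R *: (f 0 + f j).
Proof.
move=> hj.
rewrite (@zsumE _ _ _ 1); last first.
  move=> k hk; rewrite (_ : cw _ - cw _ = 0) ?scale0r // /cw.
  by case/orP: hj => /eqP->; do ! case: ifP; rewrite ?subrr //; lia.
rewrite /zrange /= !big_cons big_nil addr0.
have cw0 : cw 0 = 1 by [].
have cw1 : cw 1 = 2 by [].
have two : (2 : K) = 1 + 1 by [].
case/orP: hj => /eqP->.
  rewrite sub0r subrr cw0 cw1 !cw_neg // subrr scale0r addr0 two opprD addrA.
  by rewrite subrr sub0r scalerDr.
rewrite !opprK add0r addNr cw0 cw1 (_ : 1 + 1 = 2) // (@cw_neg (-1)) //.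
rewrite (_ : cw 2 = 2) // subrr scale0r add0r two addrK subr0 !scale1r.
by [].
Qed.

Lemma zsum_cwE (V : lmodType K) (f : int -> V) L :
  (forall k : int, L.+1%:Z <= k -> f k = 0) ->
  zsum (fun k => cw k *: f k) = f 0 + \sum_(1 <= k < L.+1) 2 *: f k%:Z.
Proof.
move=> h; rewrite (@zsumE _ _ _ L); last first.
  move=> k hk; case: (ltrP k 0) => k0; first by rewrite cw_neg ?scale0r.
  by rewrite h ?scaler0 //; lia.
rewrite /zrange big_cons big_cat !big_map /= scale1r; congr (_ + _).
rewrite [X in _ + X]big1_seq ?addr0.
  by rewrite /index_iota subSS subn0; apply: eq_big_seq => k;
    rewrite mem_iota /cw => /andP[k1 _]; case: ifP => //; lia.
by move=> k /=; rewrite mem_iota => hk; rewrite cw_neg ?scale0r //; lia.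
Qed.

Lemma zsum_opp (V : lmodType K) (f : int -> V) : zsum (fun k => f (- k)) = zsum f.
Proof.
by rewrite /zsum [RHS](@reindex_fsbigT _ _ _ _ _ -%R).
Qed.

(** Gives an unweighted sum the weights of a Casimir operator, so that the cross terms can be merged
    layer by layer in [dirac0_sq_highest]. *)
Lemma zsum_sym (V : lmodType K) (f : int -> V) : zfin f ->
  2 *: zsum f = zsum (fun k => cw k *: (f k + f (- k))).
Proof.
move=> hf.
have hf' : zfin (fun k => f (- k)).
  by case: hf => N h; exists N => k hk; apply: h; rewrite abszN.
rewrite scaler_nat mulr2n -[X in _ + X]zsum_opp.
case: (zfin_common hf hf') => N h.
rewrite !(@zsumE _ _ _ N);
  try by move=> k /h[fk fNk]; rewrite ?fk ?fNk ?addr0 ?scaler0.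
rewrite -big_split /zrange !big_cons !big_cat !big_map /= oppr0.
rewrite {1}/cw /= scale1r; congr (_ + _).
rewrite [X in _ = _ + X]big1_seq ?addr0; last first.
  by move=> k /=; rewrite mem_iota => hk; rewrite cw_neg ?scale0r //; lia.
rewrite -big_split; apply: eq_big_seq => k /=; rewrite mem_iota => /andP[k1 _].
have -> : cw k = 2 by rewrite /cw; case: ifP => //; lia.
by rewrite opprK [f (- _) + _]addrC scaler_nat mulr2n.
Qed.
End CasimirWeights.

(** * The generalised Casimir operator of a restricted representation *)

Section Representation.
Variables (K : numFieldType) (C : cartanDatum K) (g : contragredient C).
Variables (d : 'rV[K]_(cd_n C)) (B : g -> g -> K).
Hypothesis hB : standard_form d B.
Hypothesis hd : symmetrizer d.
Variable cs : bool -> int -> seq (g * g).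
Hypothesis hcs : forall b k, dual_system B (gk b k) (gk b (- k)) (cs b k).
Variable rho : hdual C.
Hypothesis hrho : weyl_vector rho.
Local Notation hh := (@ga_h K C g).
Local Notation brkB := (@brkB K g).
Local Notation csa := (csa cs).
Local Notation sharp := (sharp B).
Local Notation asharp := (asharp B).

Variables (T : lmodType K) (m : g -> T -> T).
Hypothesis hm : bilinear_map m.
Hypothesis m_rep : forall b c x y t, homog b x -> homog c y ->
  m x (m y t) = m (brk x y) t + (-1) ^+ (b && c) *: m y (m x t).

(** Makes the weighted Casimir sums finite on each vector, as [cw] discards the negative degrees. *)
Definition restricted (A : g -> T -> T) : Prop := forall t, exists N : nat,
  forall k : int, N%:Z < k -> forall x, dg k x -> A x t = 0.

Hypothesis m_nil : restricted m.

(** Kac's operator: the [2 rho] term, the quadratic term of [h], and twice the positive layers with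
    the raising factor acting first. *)
Definition casimir t := 2 *: m (sharp rho) t +
  zsum (fun k => cw K k *: \sum_(p <- csa k) m p.2 (m p.1 t)).

Lemma csa1 k p : p \in csa k -> dg k p.1.
Proof. by rewrite mem_cat => /orP[] /(cs1 hcs)[]. Qed.

Lemma casimir_fin t : zfin (fun k => cw K k *: \sum_(p <- csa k) m p.2 (m p.1 t)).
Proof.
have [N hN] := m_nil t; apply: (@zfin_cw _ _ _ N) => k kN.
by rewrite big1_seq // => p /= /csa1 hp; rewrite (hN _ kN) // (bil0r hm).
Qed.

Lemma casimir_lin : linear casimir.
Proof.
apply: linear_add; first exact: (linear_scale _ (bil_linr hm _)).
apply: zsum_linear casimir_fin => k.
apply: linear_scale; apply: linear_bigsum => p.
exact: (linear_comp (bil_linr hm _) (bil_linr hm _)).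
Qed.

(** Summation by parts: shifting the index by [j] moves the difference from the layers to the
    weights. *)
Lemma casimir_commutator c j z t : gk c j z ->
  casimir (m z t) - m z (casimir t) = 2 *: m (brk (sharp rho) z) t +
  zsum (fun k => (cw K (k - j) - cw K k) *: \sum_(p <- csa k) m (brk z p.2) (m p.1 t)).
Proof.
move=> hz; rewrite /casimir (bilDr hm) (bilZr hm).
rewrite (zsum_lin (bil_linr hm z) (casimir_fin t)) opprD addrACA -scalerBr.
congr (_ *: _ + _).
  by rewrite (m_rep _ (gk_sharp B _).1 hz.1) scale1r addrK.
pose F k := \sum_(p <- csa k) m (brk z p.2) (m p.1 t).
have Ffin : exists N : nat, forall k : int, N%:Z < k -> F k = 0.
  have [N hN] := m_nil t; exists N => k kN.
  by rewrite /F big1_seq // => p /= /csa1 hp; rewrite (hN _ kN) // (bil0r hm).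
have [N hN] := Ffin.
have F1 : zfin (fun k => cw K k *: F k) by apply: (zfin_cw hN).
have F2 : zfin (fun k => cw K (k - j) *: F k).
  have h : zfin (fun k => cw K k *: F (k + j)).
    by apply: (@zfin_cw _ _ _ (N + `|j|)%N) => k hk; apply: hN; lia.
  have := zfin_shift (- j) h; case=> N' hN'; exists N' => k /hN'.
  by rewrite subrK.
transitivity (zsum (fun k => cw K k *: F (k + j) - cw K k *: F k)).
  rewrite -zsumB; [|exact: casimir_fin|exact: (zfin_lin (bil_linr hm z) (casimir_fin t))].
  apply: zsum_ext => k; rewrite (bilZr hm) -!scalerBr; congr (_ *: _).
  exact: (csa_commutator hB hcs k t hm m_rep hz).
rewrite zsumB //; last first.
  by apply: (@zfin_cw _ _ _ (N + `|j|)%N) => k hk; apply: hN; lia.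
rewrite -(zsum_shift (fun k => cw K k *: F (k + j)) (- j)).
rewrite -zsumB //; last by case: F2 => N' h; exists N' => k /h; rewrite subrK.
by apply: zsum_ext => k; rewrite subrK scalerBl.
Qed.

(** Only the layers [0] and [j] survive. Both reduce to the degree 0 tensor paired with the simple
    root, and their sum cancels the [rho] term by [form_alpha_rho]. *)
Lemma casimir_commutator_simple c (j : int) i z t : gk c j z -> (j == 1) || (j == -1) ->
  (forall u, gk false 0 u -> brk u z = j%:~R *: (B u (asharp i) *: z)) ->
  casimir (m z t) = m z (casimir t).
Proof.
move=> hz hj hu; apply/eqP; rewrite -subr_eq0 (casimir_commutator t hz) zsum_cw_diff //.
set a := asharp i; have ha : gk false 0 a by apply: gk_sharp.
have jj : (j%:~R : K) * j%:~R = 1.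
  by case/orP: hj => /eqP->; rewrite ?mulrNN mulr1.
have hPhi : bilinear_map (fun x y => m x (m y t)).
  by split=> u; [exact: (linear_comp (bil_linr hm u) (bil_linl hm t))|exact: (bil_linl hm)].
have odd0 (f : g * g -> T) : (forall u, f (0, u) = 0) -> (forall u, f (u, 0) = 0) ->
    \sum_(p <- cs true 0) f p = 0.
  move=> f1 f2; rewrite big1_seq // => p /= /(cs1 hcs) /(gk_odd0 hB) p1.
  by rewrite [p]surjective_pairing p1.
have -> : \sum_(p <- csa 0) m (brk z p.2) (m p.1 t) = - j%:~R *: m z (m a t).
  rewrite big_cat /= [X in _ + X](@odd0 (fun p => m (brk z p.2) (m p.1 t))); last 2 first.
  - by move=> u; rewrite /= (bil0l hm) (bil0r hm).
  - by move=> u; rewrite /= (bil0r brkB) (bil0l hm).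
  rewrite addr0.
  rewrite (eq_big_seq (fun p => B p.2 a *: (- j%:~R *: m z (m p.1 t)))); last first.
    move=> p /(cs2 hcs); rewrite oppr0 => hp.
    rewrite -[brk z _]opprK -(brk_evenC _ hp.1) (hu _ hp) (bilNl hm) !(bilZl hm).
    by rewrite scalerA mulrC -scalerA scaleNr scalerN.
  rewrite (cs0_pair' hB hcs (f := fun u => - j%:~R *: m z (m u t))) //.
  exact: (linear_scale _ (linear_comp (bil_linr hm _) (bil_linl hm _))).
have -> : \sum_(p <- csa j) m (brk z p.2) (m p.1 t) = j%:~R *: m a (m z t).
  have := csa_shift hB hcs 0 hPhi hz; rewrite add0r => <-.
  rewrite big_cat /= [X in _ + X](@odd0 (fun p => m p.2 (m (brk p.1 z) t))); last 2 first.
  - by move=> u; rewrite /= (bil0l brkB) (bil0l hm) (bil0r hm).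
  - by move=> u; rewrite /= (bil0l hm).
  rewrite addr0.
  rewrite (eq_big_seq (fun p => B p.1 a *: (j%:~R *: m p.2 (m z t)))); last first.
    move=> p /(cs1 hcs) hp.
    rewrite (hu _ hp) !(bilZl hm) !(bilZr hm).
    by rewrite scalerA mulrC -scalerA.
  rewrite (cs0_pair hcs (f := fun u => j%:~R *: m u (m z t))) //.
  exact: (linear_scale _ (bil_linl hm _)).
rewrite (m_rep _ ha.1 hz.1) scale1r [j%:~R *: (_ + _)]scalerDr addrCA.
rewrite [- _ *: m z _]scaleNr addNr addr0 rmorphN /= scalerA mulNr jj scaleN1r.
rewrite (hu _ ha) (hu _ (gk_sharp _ _)) !(bilZl hm).
rewrite [2 *: (_ *: _)]scalerA [2 * _]mulrC -[(_ * 2) *: _]scalerA -scalerBr.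
by rewrite scalerA (form_alpha_rho hB hd hcs hrho) subrr scaler0.
Qed.

Lemma casimir_comm x t : casimir (m x t) = m x (casimir t).
Proof.
move: x t; apply: (@ga_gen_homog _ _ _ [set x | forall t, casimir (m x t) = m x (casimir t)]).
- have sP t := sub_eq (linear_comp casimir_lin (bil_linl hm t)) (bil_linl hm (casimir t)).
  split=> [t|a u v hu hv t]; first exact: (sP t).1.
  by apply: (sP t).2; [apply: hu|apply: hv].
- move=> b c x y hx hy cx cy t.
  have key u : m (brk x y) u = m x (m y u) - (-1) ^+ (b && c) *: m y (m x u).
    by rewrite (m_rep _ hx hy) addrK.
  by rewrite !key (lmapB casimir_lin) (lmapZ casimir_lin) cx cy cy cx.
- move=> s t; apply/eqP; rewrite -subr_eq0 (casimir_commutator t (gk_h g s)).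
  rewrite brk_hh (bil0l hm) scaler0 add0r zsum0 // => k.
  by rewrite subr0 subrr scale0r.
- move=> i t; apply: (casimir_commutator_simple (i := i) _ (gk_X g i)) => // u hu.
  by rewrite (brk_0X hB hcs i hu) scale1r.
- move=> i t; apply: (casimir_commutator_simple (i := i) _ (gk_Y g i)) => // u hu.
  by rewrite (brk_0Y hB hcs i hu) scaleN1r.
Qed.

(** Stated for any bilinear [A], because it also serves for the diagonal action, about which no
    bracket relation is assumed. *)
Lemma cs0_weight (t : T) (A : g -> T -> T) (l : hdual C) : bilinear_map A ->
  (forall s, A (hh s) t = (l s : K) *: t) ->
  \sum_(p <- cs false 0) A p.2 (A p.1 t) = B (sharp l) (sharp l) *: t.
Proof.
move=> hA hl.
have hl' u : gk false 0 u -> A u t = B u (sharp l) *: t.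
  move=> [_ /(dg0_h hB)[s ->]]; rewrite hl -(sharpE hB hcs).
  by rewrite (form_even hB (homog_h g s) (gk_sharp B l).1).
rewrite (eq_big_seq (fun p => B p.1 (sharp l) *: A p.2 t)); last first.
  by move=> p /(cs1 hcs) hp; rewrite (hl' _ hp) (bilZr hA).
rewrite (cs0_pair hcs (f := fun u => A u t) _ (gk_sharp B l)); last exact: (bil_linl hA).
by rewrite (hl' _ (gk_sharp B l)).
Qed.

Lemma casimir_highest (l : hdual C) t :
  (forall s, m (hh s) t = (l s : K) *: t) ->
  (forall k x, 0 < k -> dg k x -> m x t = 0) ->
  casimir t = (B (sharp l) (sharp l) + 2 * B (sharp rho) (sharp l)) *: t.
Proof.
move=> hl hn; rewrite /casimir (zsum1 (k0 := 0)); last first.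
  move=> k k0; rewrite /cw (negbTE k0); case: ifP => [kp|]; last by rewrite scale0r.
  by rewrite big1_seq ?scaler0 // => p /= /csa1 hp; rewrite (hn _ _ kp hp) (bil0r hm).
rewrite /cw ltxx eqxx scale1r big_cat /= (cs0_weight hm hl).
rewrite (cs_odd0 hB hcs (Phi := fun x y => m x (m y t))); last first.
  by split=> u; [exact: (linear_comp (bil_linr hm u) (bil_linl hm t))|exact: (bil_linl hm)].
rewrite addr0 [RHS]scalerDl [LHS]addrC -[in RHS]scalerA; congr (_ + _ *: _).
rewrite hl -(sharpE hB hcs).
by rewrite (form_even hB (homog_h g _) (homog_h g _)).
Qed.
End Representation.

(** * The square of the Dirac operator *)
Section FockModule.
Variables (K : numFieldType) (C : cartanDatum K) (g : contragredient C).
Variables (d : 'rV[K]_(cd_n C)) (B : g -> g -> K).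
Hypothesis hB : standard_form d B.
Hypothesis hd : symmetrizer d.
Variable cs : bool -> int -> seq (g * g).
Hypothesis hcs : forall b k, dual_system B (gk b k) (gk b (- k)) (cs b k).
Variable rho : hdual C.
Hypothesis hrho : weyl_vector rho.
Local Notation hh := (@ga_h K C g).
Local Notation brkB := (@brkB K g).
Local Notation formB := (form_bilinear hB).
Local Notation csa := (csa cs).
Local Notation sharp := (sharp B).
Local Notation cw := (cw K).

(* [m], [gam], [Q] stand for the actions of g on M, of Cl(g_1) on the oscillator
   module S and of g_0 on S, all extended to T = M (x) S, [vac] for v |-> v (x) 1
   and [c0] for the evaluation of polynomials at 0. *)
Variables (M T : lmodType K) (act : g -> M -> M) (m gam Q : g -> T -> T).
Variables (vac : M -> T) (c0 : T -> M).
Hypotheses (hact : bilinear_map act) (hm : bilinear_map m).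
Hypotheses (hgam : bilinear_map gam) (hQ : bilinear_map Q) (hc0 : linear c0).
Hypothesis m_rep : forall b c x y t, homog b x -> homog c y ->
  m x (m y t) = m (brk x y) t + (-1) ^+ (b && c) *: m y (m x t).
Hypothesis gam_m : forall y x t, gam y (m x t) = m x (gam y t).
Hypothesis Q_m : forall w x t, Q w (m x t) = m x (Q w t).
Hypothesis gam_gam : forall y z t, homog true y -> homog true z ->
  gam y (gam z t) = gam z (gam y t) + (2 * B y z) *: t.
Hypothesis Q_gam : forall w y t, homog false w -> homog true y ->
  Q w (gam y t) = gam y (Q w t) + gam (brk w y) t.
Hypotheses (m_nil : restricted m) (gam_nil : restricted gam) (Q_nil : restricted Q).
Hypothesis gam_vac : forall k u v, gk true k u -> 0 <= k -> gam u (vac v) = 0.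
Hypothesis Q_vac : forall k w v, gk false k w -> 0 <= k -> Q w (vac v) = 0.
Hypothesis c0_gam : forall k u t, gk true k u -> k < 0 -> c0 (gam u t) = 0.
Hypothesis c0_vac : forall v, c0 (vac v) = v.
Hypothesis c0_Q : forall w v, homog false w -> c0 (Q w (vac v)) = 0.
Hypothesis c0_m : forall x t, c0 (m x t) = act x (c0 t).
Hypothesis fock : forall Delta : T -> T, linear Delta ->
  (forall k z t, gk true k z -> Delta (gam z t) = gam z (Delta t)) ->
  (forall v, c0 (Delta (vac v)) = 0) -> forall t, Delta t = 0.

(** The two ends are finite for different reasons: [gam] annihilates for large [k], and [m] for very
    negative [k], once commutation lets it act first. *)
Lemma odd_fin (A : g -> g) (e : int) t :
  (forall k x, gk true k x -> dg (e + k) (A x)) ->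
  zfin (fun k => \sum_(p <- cs true k) m (A p.2) (gam p.1 t)).
Proof.
move=> hA; have [N1 h1] := gam_nil t; have [N2 h2] := m_nil t.
exists (N1 + N2 + `|e|)%N => k hk; rewrite big1_seq // => p /= ps.
have hp := cs1 hcs ps; have hq := cs2 hcs ps.
case: (ltrP 0 k) => k0; first by rewrite (h1 k) ?(bil0r hm) //; [lia|exact: hp.2].
by rewrite -gam_m (h2 (e - k)) ?(bil0r hgam) //; [lia|exact: hA].
Qed.

(** The Dirac operator without the parity sign of [M], written with canonical tensors instead of
    bases. The operators on the two factors then commute strictly; the sign returns in
    [dirac_dirac0]. *)
Definition dirac0 t := zsum (fun k => \sum_(p <- cs true k) m p.2 (gam p.1 t)).

Lemma dirac0_fin t : zfin (fun k => \sum_(p <- cs true k) m p.2 (gam p.1 t)).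
Proof. by apply: (@odd_fin id 0) => k x [_]; rewrite add0r. Qed.

Lemma dirac0_lin : linear dirac0.
Proof.
apply: zsum_linear dirac0_fin => k; apply: linear_bigsum => p.
exact: (linear_comp (bil_linr hm _) (bil_linr hgam _)).
Qed.

(** All layers commute with [gam y] except the one of degree [- j], where pairing with [y] rebuilds
    [y] itself. *)
Lemma dirac0_gam j y t : gk true j y ->
  dirac0 (gam y t) = gam y (dirac0 t) + 2 *: m y t.
Proof.
move=> hy; rewrite /dirac0 (zsum_lin (bil_linr hgam y) (dirac0_fin t)).
apply/eqP; rewrite addrC -subr_eq; apply/eqP.
rewrite -zsumB; [|exact: dirac0_fin|exact: (zfin_lin (bil_linr hgam y) (dirac0_fin t))].
pose F k := \sum_(p <- cs true k) (2 * B p.1 y) *: m p.2 t.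
transitivity (zsum F).
  apply: zsum_ext => k; rewrite (bil_sumr hgam) -sumrB; apply: eq_big_seq => p ps.
  rewrite (gam_gam t (cs1 hcs ps).1 hy.1) (bilDr hm) (bilZr hm) gam_m.
  by rewrite addrC addKr.
rewrite (@zsum1 _ _ _ (- j)) /F; last first.
  move=> k kj; rewrite big1_seq // => p /= /(cs1 hcs) hp.
  by rewrite (form_gk hB hp hy) ?mulr0 ?scale0r // addr_eq0 kj orbT.
have hy' : gk true (- (- j)) y by rewrite opprK.
rewrite {2}(cs_exp2 hcs hy') (bil_suml hm) scaler_sumr; apply: eq_bigr => p _.
by rewrite (bilZl hm) scalerA.
Qed.

(** Each layer contributes a difference of two terms that are [j] apart, so the sum over all degrees
    is 0: the odd tensor is invariant under even elements. *)
Lemma dirac0_diag j w t : gk false j w ->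
  dirac0 (m w t + Q w t) = m w (dirac0 t) + Q w (dirac0 t).
Proof.
move=> hw.
pose G k := \sum_(p <- cs true k) m (brk w p.2) (gam p.1 t).
have Gfin : zfin G by apply: (@odd_fin (brk w) j) => k x [_]; apply: dg_brk hw.2.
have hA : linear (fun t => m w t + Q w t).
  exact: (linear_add (bil_linr hm w) (bil_linr hQ w)).
rewrite /dirac0 (zsum_lin hA (dirac0_fin t)).
apply/eqP; rewrite -subr_eq0; apply/eqP.
rewrite -zsumB; [|exact: dirac0_fin|exact: (zfin_lin hA (dirac0_fin t))].
transitivity (zsum (fun k => G (k + j) - G k)); last first.
  by rewrite zsumB // ?zsum_shift ?subrr //; exact: zfin_shift.
have hPhi : bilinear_map (fun x y => m x (gam y t)).
  by split=> u; [exact: (linear_comp (bil_linr hm u) (bil_linl hgam t))|exact: (bil_linl hm)].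
apply: zsum_ext => k; rewrite /G -(cs_shift hB hcs hPhi true k hw).
rewrite (bil_sumr hm) (bil_sumr hQ) -big_split /= -!sumrB.
apply: eq_big_seq => p ps; have hp := cs1 hcs ps; have hq := cs2 hcs ps.
rewrite (bilDr hgam) gam_m (bilDr hm) Q_m.
rewrite (Q_gam _ hw.1 hp.1) (bilDr hm) (m_rep _ hw.1 hq.1) scale1r.
rewrite (brk_evenC p.1 hw.1) (bilNl hgam) (bilNr hm) addrACA opprD opprB.
rewrite addrCA [in X in _ + X]addrC [in X in _ + X]addrA subrK.
by rewrite opprD addrACA addNr addr0 addrC.
Qed.

(** Twice this operator is the cross term of the even Casimir sum for the diagonal action. *)
Definition mixed t := zsum (fun k => \sum_(p <- cs false k) m p.2 (Q p.1 t)).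

Lemma mixed_fin t : zfin (fun k => \sum_(p <- cs false k) m p.2 (Q p.1 t)).
Proof.
have [N1 h1] := Q_nil t; have [N2 h2] := m_nil t.
exists (N1 + N2)%N => k hk; rewrite big1_seq // => p /= ps.
have hp := cs1 hcs ps; have hq := cs2 hcs ps.
case: (ltrP 0 k) => k0; first by rewrite (h1 k) ?(bil0r hm) //; [lia|exact: hp.2].
by rewrite -Q_m (h2 (- k)) ?(bil0r hQ) //; [lia|exact: hq.2].
Qed.

Lemma mixed_lin : linear mixed.
Proof.
apply: zsum_linear mixed_fin => k; apply: linear_bigsum => p.
exact: (linear_comp (bil_linr hm _) (bil_linr hQ _)).
Qed.

(** Twice this operator is the odd part of the weighted Casimir sum for [m]; degree 0 has no odd
    part. *)
Definition odd_positive t :=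
  zsum (fun k : int => if 0 < k then \sum_(p <- cs true k) m p.2 (m p.1 t) else 0).

Lemma odd_positive_fin t :
  zfin (fun k : int => if 0 < k then \sum_(p <- cs true k) m p.2 (m p.1 t) else 0).
Proof.
have [N h] := m_nil t; exists N => k hk; case: ifP => // k0.
rewrite big1_seq // => p /= /(cs1 hcs) hp.
by rewrite (h k) ?(bil0r hm) //; [lia|exact: hp.2].
Qed.

Lemma odd_positive_lin : linear odd_positive.
Proof.
apply: zsum_linear odd_positive_fin => k; case: (0 < k); last first.
  by move=> a u v; rewrite scaler0 addr0.
apply: linear_bigsum => p; exact: (linear_comp (bil_linr hm _) (bil_linr hm _)).
Qed.

Lemma odd_positive_gam y t : odd_positive (gam y t) = gam y (odd_positive t).
Proof.
rewrite /odd_positive (zsum_lin (bil_linr hgam y) (odd_positive_fin t)).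
apply: zsum_ext => k; case: ifP => _; last by rewrite (bil0r hgam).
by rewrite (bil_sumr hgam); apply: eq_bigr => p _; rewrite !gam_m.
Qed.

Section OddCross.
Variables (i : int) (z : g) (t : T).
Hypothesis hz : gk true i z.
Let G k := \sum_(p <- cs true k) m (brk z p.2) (gam p.1 t).

Lemma odd_cross_fin : zfin G.
Proof. by apply: (@odd_fin (brk z) i) => k x [_]; apply: dg_brk hz.2. Qed.

Lemma dirac0_anticomm : dirac0 (m z t) + m z (dirac0 t) = zsum G.
Proof.
rewrite /dirac0 (zsum_lin (bil_linr hm z) (dirac0_fin t)).
rewrite -zsumD; [|exact: dirac0_fin|exact: (zfin_lin (bil_linr hm z) (dirac0_fin t))].
apply: zsum_ext => k; rewrite (bil_sumr hm) -big_split; apply: eq_big_seq => p ps /=.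
rewrite gam_m (m_rep _ hz.1 (cs2 hcs ps).1) /= expr1 scaleN1r addrC.
by rewrite subrK.
Qed.

Lemma mixed_gam : mixed (gam z t) = gam z (mixed t) + zsum G.
Proof.
rewrite /mixed (zsum_lin (bil_linr hgam z) (mixed_fin t)) -(zsum_shift G i).
rewrite -zsumD; [|exact: (zfin_lin (bil_linr hgam z) (mixed_fin t))|
  exact: (zfin_shift _ odd_cross_fin)].
have hPhi : bilinear_map (fun x y => m x (gam y t)).
  by split=> u; [exact: (linear_comp (bil_linr hm u) (bil_linl hgam t))|exact: (bil_linl hm)].
apply: zsum_ext => k; rewrite /G -(cs_shift hB hcs hPhi false k hz).
rewrite (bil_sumr hgam) -big_split; apply: eq_big_seq => p ps /=.
by rewrite (Q_gam _ (cs1 hcs ps).1 hz.1) (bilDr hm) gam_m.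
Qed.
End OddCross.

(** Both sides have the same commutator with each Clifford element, so [fock] leaves a comparison of
    constant terms on the vacuum. The mixed term has none there, while positive layers of [dirac0]
    give [- 2 m p.2 m p.1]. *)
Lemma dirac0_sq t : dirac0 (dirac0 t) = 2 *: (mixed t - odd_positive t).
Proof.
pose Delta t := dirac0 (dirac0 t) - 2 *: (mixed t - odd_positive t).
suff : Delta t = 0 by move=> /eqP; rewrite subr_eq0 => /eqP.
have hlin : linear Delta.
  apply: linear_sub; first exact: (linear_comp dirac0_lin dirac0_lin).
  exact: (linear_scale _ (linear_sub mixed_lin odd_positive_lin)).
move: t; apply: fock => // [k z t hz|v].
- rewrite /Delta (dirac0_gam t hz) (lmapD dirac0_lin) (lmapZ dirac0_lin).
  rewrite (dirac0_gam _ hz) (mixed_gam t hz) odd_positive_gam.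
  rewrite -(addrA (gam z _)) -scalerDr [m z _ + _]addrC (dirac0_anticomm t hz).
  set G := zsum _; rewrite [gam z (mixed t) + G - _]addrAC [2 *: (_ + G)]scalerDr.
  rewrite opprD addrACA subrr addr0.
  by rewrite (bilBr hgam) (bilZr hgam) (bilBr hgam).
have hl := linear_comp hc0 dirac0_lin.
rewrite /Delta (lmapB hc0) (lmapZ hc0) (lmapB hc0).
rewrite {1}/dirac0 (zsum_lin hc0 (dirac0_fin _)).
rewrite (zsum_lin hc0 (mixed_fin _)) (zsum_lin hc0 (odd_positive_fin _)).
rewrite [X in 2 *: (X - _)]zsum0 => [|k]; last first.
  rewrite (lmap_sum hc0) big1_seq // => p /= /(cs1 hcs) hp.
  by rewrite c0_m c0_Q ?(bil0r hact) //; exact: hp.1.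
rewrite sub0r scalerN opprK.
set D := zsum _; set P := zsum _.
suff -> : D = - (2 *: P) by rewrite addNr.
have hs : linear (fun u : M => - (2 *: u)).
  by move=> a u w; rewrite scalerDr opprD scalerN !scalerA [a * _]mulrC.
have Pfin := zfin_lin hc0 (odd_positive_fin (vac v)).
rewrite (zsum_lin hs Pfin); apply: zsum_ext => k.
rewrite (lmap_sum hc0); case: ifPn => k0; last first.
  rewrite (lmap0 hc0) scaler0 oppr0 big1_seq // => p /= ps.
  have := cs1 hcs ps; case: (ltrgt0P k) k0 ps => // [kn _ ps hp|k0 _ ps].
    by rewrite c0_m (c0_gam _ hp) ?(bil0r hact).
  rewrite k0 => /(gk_odd0 hB) ->.
  by rewrite (bil0l hgam) (bil0r hm) (lmap0 hc0).
rewrite (lmap_sum hc0) scaler_sumr -sumrN; apply: eq_big_seq => p ps /=.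
have hp := cs1 hcs ps.
(* [p.1] has positive degree and kills the vacuum, so [dirac0_gam] evaluates [gam p.1] on
   [dirac0 (vac v)] as [- 2 m p.1] on the vacuum. *)
have : dirac0 (gam p.1 (vac v)) = 0.
  by rewrite (gam_vac _ hp (ltW k0)) (lmap0 dirac0_lin).
rewrite (dirac0_gam _ hp) => /eqP; rewrite addr_eq0 => /eqP h.
by rewrite !c0_m h (lmapN hc0) (lmapZ hc0) (bilNr hact) (bilZr hact) !c0_m.
Qed.

(** * Vanishing of the even Casimir operator on the oscillator module *)

Definition spin_casimir t := 2 *: Q (sharp rho) t +
  zsum (fun k => cw k *: \sum_(p <- cs false k) Q p.2 (Q p.1 t)).

Lemma spin_casimir_fin t :
  zfin (fun k => cw k *: \sum_(p <- cs false k) Q p.2 (Q p.1 t)).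
Proof.
have [N h] := Q_nil t; apply: (@zfin_cw _ _ _ N) => k kN.
by rewrite big1_seq // => p /= /(cs1 hcs)[_ hp]; rewrite (h _ kN) // (bil0r hQ).
Qed.

Lemma spin_casimir_lin : linear spin_casimir.
Proof.
apply: linear_add; first exact: (linear_scale _ (bil_linr hQ _)).
apply: zsum_linear spin_casimir_fin => k.
apply: linear_scale; apply: linear_bigsum => p.
exact: (linear_comp (bil_linr hQ _) (bil_linr hQ _)).
Qed.

Section SpinCommutator.
Variables (i : int) (y : g).
Hypothesis hy : gk true i y.

(** Counting [Q] as two Clifford factors, the Casimir operator has order four and every commutator
    lowers the order by one. The third commutator, of order one, is the one that vanishes by the
    Jacobi identity. *)
Definition spin_comm t := 2 *: gam (brk (sharp rho) y) t +
  zsum (fun k => cw k *: \sum_(p <- cs false k)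
    (Q p.2 (gam (brk p.1 y) t) + gam (brk p.2 y) (Q p.1 t))).

Lemma spin_comm_fin t : zfin (fun k => cw k *: \sum_(p <- cs false k)
    (Q p.2 (gam (brk p.1 y) t) + gam (brk p.2 y) (Q p.1 t))).
Proof.
have [N1 h1] := Q_nil t; have [N2 h2] := gam_nil t.
apply: (@zfin_cw _ _ _ (N1 + N2 + `|i|)%N) => k kN.
rewrite big1_seq // => p /= /(cs1 hcs) hp.
rewrite (h1 k) ?(bil0r hgam) ?addr0; [|lia|exact: hp.2].
by rewrite (h2 (k + i)) ?(bil0r hQ) //; [lia|exact: dg_brk hp.2 hy.2].
Qed.

Lemma spin_comm_lin : linear spin_comm.
Proof.
apply: linear_add; first exact: (linear_scale _ (bil_linr hgam _)).
apply: zsum_linear spin_comm_fin => k.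
apply: linear_scale; apply: linear_bigsum => p.
apply: linear_add; first exact: (linear_comp (bil_linr hQ _) (bil_linr hgam _)).
exact: (linear_comp (bil_linr hgam _) (bil_linr hQ _)).
Qed.

Lemma spin_casimir_gam t :
  spin_casimir (gam y t) = gam y (spin_casimir t) + spin_comm t.
Proof.
rewrite /spin_casimir /spin_comm (bilDr hgam) (bilZr hgam) addrACA.
rewrite -scalerDr (Q_gam _ (gk_sharp B rho).1 hy.1); congr (_ + _).
rewrite (zsum_lin (bil_linr hgam y) (spin_casimir_fin t)).
rewrite -zsumD; [|exact: (zfin_lin (bil_linr hgam y) (spin_casimir_fin t))
  |exact: spin_comm_fin].
apply: zsum_ext => k; rewrite (bilZr hgam) -scalerDr (bil_sumr hgam) -big_split.
congr (_ *: _); apply: eq_big_seq => p ps /=.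
rewrite (Q_gam _ (cs1 hcs ps).1 hy.1) (bilDr hQ) (Q_gam _ (cs2 hcs ps).1 hy.1).
by rewrite -addrA; congr (_ + _); rewrite addrC.
Qed.

Section SecondCommutator.
Variables (j : int) (z : g).
Hypothesis hz : gk true j z.

Definition spin_comm2 t := (2 * (2 * B (brk (sharp rho) y) z)) *: t +
  zsum (fun k => cw k *: \sum_(p <- cs false k)
    ((gam (brk p.2 z) (gam (brk p.1 y) t) + (2 * B (brk p.1 y) z) *: Q p.2 t) +
     (gam (brk p.2 y) (gam (brk p.1 z) t) + (2 * B (brk p.2 y) z) *: Q p.1 t))).

Lemma spin_comm2_fin t : zfin (fun k => cw k *: \sum_(p <- cs false k)
    ((gam (brk p.2 z) (gam (brk p.1 y) t) + (2 * B (brk p.1 y) z) *: Q p.2 t) +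
     (gam (brk p.2 y) (gam (brk p.1 z) t) + (2 * B (brk p.2 y) z) *: Q p.1 t))).
Proof.
have [N1 h1] := Q_nil t; have [N2 h2] := gam_nil t.
apply: (@zfin_cw _ _ _ (N1 + N2 + `|i| + `|j|)%N) => k kN.
rewrite big1_seq // => p /= /(cs1 hcs) hp.
rewrite [Q p.1 t](h1 k) ?scaler0 ?addr0; [|lia|exact: hp.2].
rewrite (h2 (k + i)) ?(bil0r hgam) ?add0r; [|lia|exact: dg_brk hp.2 hy.2].
rewrite (h2 (k + j)) ?(bil0r hgam) ?addr0; [|lia|exact: dg_brk hp.2 hz.2].
rewrite (form_dg hB (dg_brk hp.2 hy.2) hz.2) ?mulr0 ?scale0r //.
by apply/eqP; lia.
Qed.

Lemma spin_comm2_lin : linear spin_comm2.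
Proof.
have hs (c : K) : linear (fun t : T => c *: t).
  by move=> a u v; rewrite scalerDr !scalerA mulrC.
apply: linear_add; first exact: hs.
apply: zsum_linear spin_comm2_fin => k.
apply: linear_scale; apply: linear_bigsum => p.
by do 2 apply: linear_add;
  first [exact: (linear_comp (bil_linr hgam _) (bil_linr hgam _))
        |exact: (linear_comp (hs _) (bil_linr hQ _))].
Qed.

Lemma spin_comm_gam t : spin_comm (gam z t) = gam z (spin_comm t) + spin_comm2 t.
Proof.
have hry : homog true (brk (sharp rho) y).
  exact: (brk_parity (gk_sharp B rho).1 hy.1).
rewrite /spin_comm /spin_comm2 (bilDr hgam) (bilZr hgam) addrACA.
rewrite -scalerA -scalerDr (gam_gam _ hry hz.1); congr (_ + _).
rewrite (zsum_lin (bil_linr hgam z) (spin_comm_fin t)).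
rewrite -zsumD; [|exact: (zfin_lin (bil_linr hgam z) (spin_comm_fin t))
  |exact: spin_comm2_fin].
apply: zsum_ext => k; rewrite (bilZr hgam) -scalerDr (bil_sumr hgam) -big_split.
congr (_ *: _); apply: eq_big_seq => p ps /=.
have hp := (cs1 hcs ps).1; have hq := (cs2 hcs ps).1.
have hpy := brk_parity hp hy.1; have hqy := brk_parity hq hy.1.
rewrite (Q_gam _ hp hz.1) (bilDr hgam) (gam_gam _ hpy hz.1) (gam_gam _ hqy hz.1).
rewrite (bilDr hQ) (bilZr hQ) (Q_gam _ hq hz.1) (bilDr hgam) -!addrA.
congr (_ + _); rewrite [RHS]addrCA; congr (_ + _).
by rewrite [RHS]addrCA; do 2 congr (_ + _); rewrite addrC.
Qed.
End SecondCommutator.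
End SpinCommutator.

Section CasimirPairing.
Variables (e : int) (X : g).
Hypothesis hX : gk false e X.

(** The shape of the terms of the third commutator: [X] is a bracket of two odd elements, and
    pairing one leg of the tensor with it collapses the other leg to [X]. *)
Definition pairing y t k := \sum_(p <- cs false k)
  (B p.2 X *: gam (brk p.1 y) t + B p.1 X *: gam (brk p.2 y) t).

Lemma pairingE y t k : pairing y t k =
  (if k == e then gam (brk X y) t else 0) + (if k == - e then gam (brk X y) t else 0).
Proof.
pose f u := gam (brk u y) t.
have hf : linear f by exact: (linear_comp (bil_linl hgam t) (bil_linl brkB y)).
rewrite /pairing big_split /=; congr (_ + _).
- case: eqP => [->|/eqP ke].
    rewrite -[RHS]/(f X) [in RHS](cs_exp1 hcs hX) (lmap_sum hf).
    apply: eq_big_seq => p /(cs2 hcs) hp.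
    by rewrite (lmapZ hf) (form_even hB hp.1 hX.1).
  rewrite big1_seq // => p /= /(cs2 hcs) hp.
  by rewrite (form_gk hB hp hX) ?scale0r //= addrC subr_eq0 eq_sym.
- case: eqP => [->|/eqP ke].
    have hX' : gk false (- (- e)) X by rewrite opprK.
    rewrite -[RHS]/(f X) [in RHS](cs_exp2 hcs hX') (lmap_sum hf).
    by apply: eq_bigr => p _; rewrite (lmapZ hf).
  rewrite big1_seq // => p /= /(cs1 hcs) hp.
  by rewrite (form_gk hB hp hX) ?scale0r //= addr_eq0.
Qed.

Lemma pairing_fin y t : zfin (fun k => cw k *: pairing y t k).
Proof.
exists `|e|%N => k ke; rewrite pairingE.
have -> : (k == e) = false by apply/negbTE/eqP; lia.
have -> : (k == - e) = false by apply/negbTE/eqP; lia.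
by rewrite addr0 scaler0.
Qed.

(** The total weight is 2 whatever the sign of [e]: degree [|e|] has weight 2 if [e != 0], and
    degree 0 is met twice with weight 1 if [e = 0]. *)
Lemma pairing_sum y t : zsum (fun k => cw k *: pairing y t k) = 2 *: gam (brk X y) t.
Proof.
rewrite (zsum1 (k0 := `|e|%:Z)) => [|k ke]; rewrite pairingE; last first.
  case: (ltrP k 0) => k0; first by rewrite cw_neg // scale0r.
  have -> : (k == e) = false by apply/negbTE/eqP; lia.
  have -> : (k == - e) = false by apply/negbTE/eqP; lia.
  by rewrite addr0 scaler0.
have [e0|e0|->] := ltrgtP e 0.
- rewrite (_ : `|e|%:Z = - e) ?eqxx; last by lia.
  rewrite (_ : (- e == e) = false) ?add0r; last by apply/negbTE/eqP; lia.
  by rewrite /cw oppr_gt0 e0.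
- rewrite (_ : `|e|%:Z = e) ?eqxx; last by lia.
  rewrite (_ : (e == - e) = false) ?addr0; last by apply/negbTE/eqP; lia.
  by rewrite /cw e0.
- by rewrite absz0 oppr0 !eqxx /cw ltxx eqxx scale1r scaler_nat mulr2n.
Qed.
End CasimirPairing.

(** The third commutator consists of three pairings, with [[y, z]], [[z, u]] and [[y, u]], which add
    up to the Jacobi expression of three odd elements. *)
Lemma spin_comm2_gam i j l y z u t : gk true i y -> gk true j z -> gk true l u ->
  spin_comm2 y z (gam u t) = gam u (spin_comm2 y z t).
Proof.
move=> hy hz hu.
have hzu := gk_brk hz hu; have hyu := gk_brk hy hu; have hyz := gk_brk hy hz.
apply/eqP; rewrite -subr_eq0; apply/eqP.
rewrite /spin_comm2 (bilDr hgam) (bilZr hgam) opprD addrACA subrr add0r.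
rewrite (zsum_lin (bil_linr hgam u) (spin_comm2_fin hy hz t)).
rewrite -zsumB; [|exact: (spin_comm2_fin hy hz)
  |exact: (zfin_lin (bil_linr hgam u) (spin_comm2_fin hy hz t))].
have hs : linear (fun t : T => 2 *: t).
  by move=> a v w; rewrite scalerDr !scalerA mulrC.
have f1 := pairing_fin hzu y t; have f2 := pairing_fin hyu z t.
have f3 := pairing_fin hyz u t.
transitivity (zsum (fun k => 2 *: ((cw k *: pairing (brk y z) u t k +
    cw k *: pairing (brk z u) y t k) + cw k *: pairing (brk y u) z t k))).
  apply: zsum_ext => k; rewrite (bilZr hgam) -scalerBr -!scalerDr scalerA mulrC -scalerA.
  congr (_ *: _); rewrite (bil_sumr hgam) -sumrB /pairing -!big_split scaler_sumr.
  apply: eq_big_seq => p ps /=.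
  have hp := (cs1 hcs ps).1; have hq := (cs2 hcs ps).1.
  have hpy := brk_parity hp hy.1; have hqy := brk_parity hq hy.1.
  have hpz := brk_parity hp hz.1; have hqz := brk_parity hq hz.1.
  rewrite (gam_gam _ hpy hu.1) (gam_gam _ hpz hu.1) (Q_gam _ hp hu.1) (Q_gam _ hq hu.1).
  rewrite !(bilDr hgam) !(bilZr hgam) (gam_gam _ hqz hu.1) (gam_gam _ hqy hu.1).
  rewrite !scalerDr !scalerA !(form_inv hB).
  apply/eqP; rewrite subr_eq; apply/eqP.
  by rewrite (AC ((3*2)*(3*2)) (((10*5)*(2*8)*(7*3))*((1*4)*(6*9)))).
have f12 := zfinD f3 f1; have f123 := zfinD f12 f2.
rewrite -(zsum_lin hs f123) (zsumD f12 f2) (zsumD f3 f1).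
rewrite (pairing_sum hyz) (pairing_sum hzu) (pairing_sum hyu) -!scalerDr.
rewrite -!(bilDl hgam) brk_jac_odd ?(bil0l hgam) ?scaler0 //;
  [exact: hy.1|exact: hz.1|exact: hu.1].
Qed.

Lemma c0_gam_gam a b u u' v : gk true a u -> gk true b u' ->
  c0 (gam u (gam u' (vac v))) = (if b < 0 then 2 * B u u' else 0) *: v.
Proof.
move=> hu hu'; case: ltrP => b0; last first.
  by rewrite (gam_vac _ hu' b0) (bil0r hgam) (lmap0 hc0) scale0r.
by rewrite (gam_gam _ hu.1 hu'.1) (lmapD hc0) (c0_gam _ hu' b0) (lmapZ hc0) c0_vac add0r.
Qed.

(** For degree reasons only [i + j = 0] matters. If moreover [i < 0], invariance of [B] turns the
    scalar into a multiple of [z] paired with the left side of [lowering_odd]. *)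
Lemma c0_spin_comm2 i j y z v : gk true i y -> gk true j z ->
  c0 (spin_comm2 y z (vac v)) = 0.
Proof.
move=> hy hz.
have hsub u c : homog true u -> c0 ((c *: Q u (vac v))) = c *: c0 (Q u (vac v)).
  by rewrite (lmapZ hc0).
pose S i y z k := \sum_(p <- cs false k)
  (if k + i < 0 then 2 * B (brk p.2 z) (brk p.1 y) else 0).
have E : c0 (spin_comm2 y z (vac v)) = (2 * (2 * B (brk (sharp rho) y) z)) *: v +
    zsum (fun k => cw k *: (S i y z k *: v + S j z y k *: v)).
  rewrite /spin_comm2 (lmapD hc0) (lmapZ hc0) c0_vac; congr (_ + _).
  rewrite (zsum_lin hc0 (spin_comm2_fin hy hz _)); apply: zsum_ext => k.
  rewrite (lmapZ hc0) (lmap_sum hc0) -scalerDl /S -big_split scaler_suml.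
  congr (_ *: _); apply: eq_big_seq => p ps.
  have hp := cs1 hcs ps; have hq := cs2 hcs ps.
  rewrite !(lmapD hc0) !(lmapZ hc0) !c0_Q ?scaler0 ?addr0; [|exact: hp.1|exact: hq.1].
  rewrite (c0_gam_gam _ (gk_brk hq hz) (gk_brk hp hy)).
  by rewrite (c0_gam_gam _ (gk_brk hq hy) (gk_brk hp hz)) -scalerDl.
have Sne k a b x w : gk true a x -> gk true b w -> a + b != 0 -> S a x w k = 0.
  move=> hx hw ab; rewrite /S big1_seq // => p /= ps; case: ifP => // _.
  rewrite (form_dg hB (dg_brk (cs2 hcs ps).2 hw.2) (dg_brk (cs1 hcs ps).2 hx.2)) ?mulr0 //.
  by rewrite addrACA addNr add0r addrC.
case: (eqVneq (i + j) 0) => ij; last first.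
  rewrite E zsum0 => [|k].
    rewrite (form_dg hB (dg_brk (gk_sharp B rho).2 hy.2) hz.2) ?add0r //.
    by rewrite !mulr0 scale0r addr0.
  rewrite (Sne k _ _ _ _ hy hz ij) (Sne k _ _ _ _ hz hy) 1?addrC //.
  by rewrite scale0r addr0 scaler0.
(* Stated for a general pair of vectors: the case [i > 0] is obtained by exchanging [y] and [z]. *)
have main a b x w : gk true a x -> gk true b w -> a + b = 0 -> a < 0 ->
    (2 * (2 * B (brk (sharp rho) x) w)) *: v +
    zsum (fun k => cw k *: (S a x w k *: v + S b w x k *: v)) = 0.
  move=> hx hw ab a0.
  have [l al] : exists l, a = - l.+1%:Z by exists `|a|.-1; lia.
  (* Since [a = - l.+1], the condition [k + a < 0] stops the sum at [k = l], as in [lowering_odd];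
     the factors 1 and 2 there come from [cw]. *)
  pose f k := (if k + a < 0 then - (2 * B w (casimir_part cs false k x)) else 0) *: v.
  have -> : zsum (fun k => cw k *: (S a x w k *: v + S b w x k *: v)) =
      zsum (fun k => cw k *: f k).
    apply: zsum_ext => k; case: (ltrP k 0) => k0; first by rewrite cw_neg ?scale0r.
    have -> : S b w x k = 0.
      by rewrite /S big1_seq // => p _; case: ifP => //; lia.
    rewrite scale0r addr0 /f /S; case: ifP => _; last by rewrite big1_eq.
    congr (_ *: (_ *: _)); rewrite -mulr_sumr -mulrN; congr (_ * _).
    rewrite (bil_sumr formB) -sumrN; apply: eq_big_seq => p ps.
    have hq := (cs2 hcs ps).1.
    by rewrite (brk_evenC w hq) (bilNl formB) (form_inv hB).
  rewrite (@zsum_cwE _ _ _ l) => [|k kl]; last first.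
    by rewrite /f; case: ifP; rewrite ?scale0r //; lia.
  have -> : f 0 = - (2 * B w (casimir_part cs false 0 x)) *: v.
    by rewrite /f add0r a0.
  have -> : \sum_(1 <= k < l.+1) 2 *: f k%:Z =
      - (2 * B w (\sum_(1 <= k < l.+1) 2 *: casimir_part cs false k%:Z x)) *: v.
    rewrite (bil_sumr formB) mulr_sumr -sumrN scaler_suml.
    rewrite big_nat [RHS]big_nat; apply: eq_bigr => k /andP[k1 k2].
    rewrite /f; case: ifP => [_|]; last by lia.
    by rewrite scalerA (bilZr formB) mulrN.
  have hx' : gk true (- l.+1%:Z) x by rewrite -al.
  have := lowering_odd hB hd hcs hrho hx'.
  rewrite addrAC => /eqP; rewrite addr_eq0 => /eqP h.
  rewrite -scalerDl -opprD -mulrDr -(bilDr formB) h.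
  rewrite (bilNr formB) (bilZr formB) mulrN opprK -scalerDl.
  have -> : B (brk (sharp rho) x) w = - B w (brk (sharp rho) x).
    by rewrite (form_odd hB) //; [exact: brk_parity (gk_sharp B rho).1 hx.1|exact: hw.1].
  by rewrite !mulrN addNr scale0r.
rewrite E; case: (ltrgt0P i) => i0.
- rewrite -[RHS](main j i z y hz hy); [|lia|lia]; congr (_ *: _ + _).
    congr (2 * (2 * _)); rewrite !(form_inv hB) brk_oddC //.
    + exact: hy.1.
    + exact: hz.1.
  by apply: zsum_ext => k; rewrite [X in _ *: X]addrC.
- exact: main.
- have -> : y = 0 by apply: (gk_odd0 hB); rewrite -i0.
  rewrite (bil0r brkB) (bil0l formB) !mulr0 scale0r add0r zsum0 // => k.
  rewrite /S !big1 ?scale0r ?addr0 ?scaler0 // => p _; case: ifP => //.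
    by rewrite (bil0r brkB) (bil0l formB) mulr0.
  by rewrite (bil0r brkB) (bil0r formB) mulr0.
Qed.

Lemma spin_comm_eq0 i y t : gk true i y -> spin_comm y t = 0.
Proof.
move=> hy; move: t; apply: fock; first exact: (spin_comm_lin hy).
- move=> j z t hz; rewrite (spin_comm_gam hy hz).
  suff -> : spin_comm2 y z t = 0 by rewrite addr0.
  move: t; apply: fock; first exact: (spin_comm2_lin hy hz).
  + by move=> l u t hu; apply: (spin_comm2_gam t hy hz hu).
  + by move=> v; apply: c0_spin_comm2 hy hz.
(* On the vacuum everything reduces to constant terms of vectors [gam u (vac w)], which vanish in
   every degree. *)
- move=> v.
  have c0g l u w : gk true l u -> c0 (gam u (vac w)) = 0.
    move=> hu; case: (ltrP l 0) => l0; first exact: c0_gam hu l0.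
    by rewrite (gam_vac _ hu l0) (lmap0 hc0).
  rewrite /spin_comm (lmapD hc0) (lmapZ hc0) (zsum_lin hc0 (spin_comm_fin hy _)).
  rewrite (c0g _ _ _ (gk_brk (gk_sharp B rho) hy)) scaler0 add0r zsum0 // => k.
  case: (ltrP k 0) => k0; first by rewrite cw_neg // scale0r (lmap0 hc0).
  rewrite (lmapZ hc0) (lmap_sum hc0) big1_seq ?scaler0 // => p /= ps.
  have hp := cs1 hcs ps; have hq := cs2 hcs ps.
  rewrite (Q_vac _ hp k0) (bil0r hgam) addr0.
  have hpy := gk_brk hp hy.
  case: (ltrP (k + i) 0) => ki; last first.
    by rewrite (gam_vac _ hpy ki) (bil0r hQ) (lmap0 hc0).
  rewrite (Q_gam _ hq.1 hpy.1) (lmapD hc0) (c0_gam _ hpy ki) add0r.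
  exact: c0g (gk_brk hq hpy).
Qed.

(** For the action shifted by [rho0 - rho], with [rho0] in place of [rho], this reads: the even
    Casimir operator is the scalar [(rho, rho) - (rho0, rho0)]. *)
Lemma spin_casimir_eq0 t : spin_casimir t = 0.
Proof.
move: t; apply: fock; first exact: spin_casimir_lin.
- by move=> k z t hz; rewrite (spin_casimir_gam hz) (spin_comm_eq0 _ hz) addr0.
- move=> v; rewrite /spin_casimir (Q_vac _ (gk_sharp B rho)) // scaler0 add0r.
  rewrite zsum0 ?(lmap0 hc0) // => k.
  case: (ltrP k 0) => k0; first by rewrite cw_neg // scale0r.
  rewrite big1_seq ?scaler0 // => p /= /(cs1 hcs) hp.
  by rewrite (Q_vac _ hp k0) (bil0r hQ).
Qed.

(** The even Casimir sum of the diagonal action splits into those of [m] and [Q] and twice [mixed].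
    Adding the odd part of [m], twice [odd_positive], completes the Casimir operator of [m] and
    leaves the two terms of [dirac0_sq]. *)
Lemma dirac0_sq_highest (l : hdual C) (c : K) t :
  casimir B cs rho m t = c *: t ->
  (forall s, m (hh s) t + Q (hh s) t = (l s : K) *: t) ->
  (forall k w, 0 < k -> gk false k w -> m w t + Q w t = 0) ->
  dirac0 (dirac0 t) =
    (B (sharp l) (sharp l) + 2 * B (sharp rho) (sharp l) - c) *: t.
Proof.
move=> hc hl hn.
pose A w t := m w t + Q w t.
have hA : bilinear_map A.
  by split=> u; apply: linear_add; [exact: (bil_linr hm u)|exact: (bil_linr hQ u)
    |exact: (bil_linl hm u)|exact: (bil_linl hQ u)].
have hs : linear (fun t : T => 2 *: t).
  by move=> a v w; rewrite scalerDr !scalerA mulrC.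
pose x k := \sum_(p <- cs false k) m p.2 (Q p.1 t).
have xN k : x (- k) = \sum_(p <- cs false k) m p.1 (Q p.2 t).
  apply: (cs_flip hB hcs (Phi := fun u w => m u (Q w t))).
  by split=> u; [exact: (linear_comp (bil_linr hm u) (bil_linl hQ t))|exact: (bil_linl hm)].
pose o k := if 0 < k then \sum_(p <- cs true k) m p.2 (m p.1 t) else 0.
have main : zsum (fun k => cw k *: \sum_(p <- csa k) m p.2 (m p.1 t)) +
    zsum (fun k => cw k *: \sum_(p <- cs false k) Q p.2 (Q p.1 t)) + 2 *: mixed t =
    B (sharp l) (sharp l) *: t + 2 *: odd_positive t.
  have f1 := casimir_fin hcs hm m_nil t; have f2 := spin_casimir_fin t.
  have f3 : zfin (fun k => cw k *: (x k + x (- k))).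
    have [N h] := mixed_fin t; exists N => k hk.
    by rewrite /x !h ?abszN // addr0 scaler0.
  rewrite /mixed (zsum_sym (mixed_fin t)) -[odd_positive t]/(zsum o).
  rewrite (zsum_lin hs (odd_positive_fin t)) -(zsumD f1 f2) -(zsumD (zfinD f1 f2) f3).
  have f4 : zfin (fun k => if k == 0 then B (sharp l) (sharp l) *: t else 0).
    by exists 0%N => k; case: eqP => // ->.
  have <- : zsum (fun k => if k == 0 then B (sharp l) (sharp l) *: t else 0) =
      B (sharp l) (sharp l) *: t.
    by rewrite (@zsum1 _ _ _ 0) ?eqxx // => k /negbTE ->.
  rewrite -(zsumD f4 (zfin_lin hs (odd_positive_fin t))); apply: zsum_ext => k.
  transitivity (cw k *: (\sum_(p <- cs false k) A p.2 (A p.1 t)) +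
      cw k *: \sum_(p <- cs true k) m p.2 (m p.1 t)).
    rewrite -!scalerDr xN /x big_cat /=; congr (_ *: _).
    have -> : \sum_(p <- cs false k) A p.2 (A p.1 t) =
        \sum_(p <- cs false k) m p.2 (m p.1 t) + x k +
        (\sum_(p <- cs false k) m p.1 (Q p.2 t) + \sum_(p <- cs false k) Q p.2 (Q p.1 t)).
      rewrite /x -!big_split; apply: eq_bigr => p _ /=.
      by rewrite /A (bilDr hm) (bilDr hQ) Q_m.
    by rewrite /x (AC (3*2) (((1*4)*(5*3))*2)).
  congr (_ + _).
    have [k0|k0|->] := ltrgtP k 0; first by rewrite cw_neg // scale0r.
      rewrite big1_seq ?scaler0 // => p /= /(cs1 hcs) hp.
      by rewrite /A (hn _ _ k0 hp) (bil0r hm) (bil0r hQ) addr0.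
    by rewrite /cw ltxx eqxx scale1r (cs0_weight hB hcs hA hl).
  rewrite /o /cw; case: ifP => // _; case: eqP => [->|_]; rewrite ?scale0r ?scaler0 //.
  rewrite (cs_odd0 hB hcs (Phi := fun u w => m u (m w t))) ?scaler0 //.
  by split=> u; [exact: (linear_comp (bil_linr hm u) (bil_linl hm t))|exact: (bil_linl hm)].
have hK := spin_casimir_eq0 t.
rewrite dirac0_sq scalerBr; apply/eqP; rewrite subr_eq; apply/eqP.
have lr : m (sharp rho) t + Q (sharp rho) t = B (sharp rho) (sharp l) *: t.
  rewrite hl -(sharpE hB hcs); congr (_ *: _).
  exact: (form_even hB (gk_sharp B _).1 (gk_sharp B _).1).
move: main hc hK; rewrite /casimir /spin_casimir.
set S1 := zsum _; set S2 := zsum _; set X := 2 *: mixed t; set O := 2 *: odd_positive t.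
move=> e1 e2 e3.
rewrite scalerBl scalerDl -e2 -scalerA -lr scalerDr.
have -> : X = B (sharp l) (sharp l) *: t + O - S1 - S2.
  by rewrite -e1 -addrA -opprD addrAC subrr add0r.
have -> : S2 = - (2 *: Q (sharp rho) t).
  by apply/eqP; rewrite -addr_eq0 addrC e3.
by rewrite opprK opprD [RHS](AC ((1*2)*2*1) (((1*6)*5*3)*(2*4))) /= subrr addr0.
Qed.
End FockModule.

(** * Bases and polynomial calculus *)
Section Basis.
Variables (K : fieldType) (V : lmodType K) (I : choiceType).

Lemma lincombEw (e : I -> V) (D : {fset I}) (c : {malg K[I]}) :
  (msupp c `<=` D)%fset -> lincomb e c = \sum_(a <- D) c@_a *: e a.
Proof.
move=> cD; rewrite /lincomb (big_fset_incl _ cD) // => a _ /mcoeff_outdom ->.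
by rewrite scale0r.
Qed.

Lemma lincomb_lin (e : I -> V) : linear (lincomb e).
Proof.
move=> s x y; pose D := (msupp x `|` msupp y)%fset.
rewrite (@lincombEw e D); last first.
  apply: (fsubset_trans (msuppD_le _ _)); rewrite fsetUSS ?fsubset_refl //.
  exact: msuppZ_le.
rewrite (@lincombEw e D x) ?fsubsetUl // (@lincombEw e D y) ?fsubsetUr //.
rewrite scaler_sumr -big_split; apply: eq_bigr => a _ /=.
by rewrite mcoeffD mcoeffZ scalerDl scalerA.
Qed.

Lemma lincombU (e : I -> V) a : lincomb e << a >> = e a.
Proof. by rewrite /lincomb msuppU oner_eq0 big_seq_fset1 mcoeffUU scale1r. Qed.

End Basis.

Section Extension.
Variables (K : fieldType) (V : lmodType K) (I : choiceType).
Variables (W : set V) (e : I -> V).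
Hypotheses (sW : subspace W) (he : is_basis W e).

Lemma coordsK v : W v -> lincomb e (coords e v) = v.
Proof.
move=> Wv; have [c [hc _]] := he.2 v Wv.
by have := @xgetPex _ 0 [set c | v = lincomb e c]; move=> /(_ (ex_intro _ c hc)) /= <-.
Qed.

Lemma coords_unique v c : W v -> v = lincomb e c -> coords e v = c.
Proof.
move=> Wv hc; have [c' [_ hu]] := he.2 v Wv.
by rewrite -(hu _ (esym (coordsK Wv))) (hu _ hc).
Qed.

Variables (U : lmodType K) (f : I -> U).
Definition extend v := lincomb f (coords e v).

Lemma extendP a u v : W u -> W v -> extend (a *: u + v) = a *: extend u + extend v.
Proof.
move=> Wu Wv; rewrite /extend -lincomb_lin; congr lincomb.
apply: coords_unique; first exact: sW.2.
by rewrite lincomb_lin !coordsK.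
Qed.

Lemma extend0 : extend 0 = 0.
Proof.
have W0 := sub0 sW.
by have := extendP 1 W0 W0; rewrite !scale1r addr0 => /eqP; rewrite addrC -subr_eq subrr => /eqP.
Qed.

Lemma extend_basis a : extend (e a) = f a.
Proof.
rewrite /extend (coords_unique (c := << a >>)) ?lincombU //; exact: he.1.
Qed.
End Extension.

Section Polynomials.
Variables (K : numFieldType) (I : choiceType).
Local Notation osc := (oscillator K I).
Local Notation ovar := (ovar K).
Local Notation mon1 := (@mone {cmonom I}).
Implicit Types (P : osc) (a b : I) (m n : {cmonom I}).

Lemma mcoeff_lin (G : choiceType) k :
  linear (fun P : {malg K[G]} => (P@_k : K^o)).
Proof. by move=> s x y; rewrite mcoeffD mcoeffZ. Qed.

Lemma monom_eq m n : (forall i, m i = n i) -> m = n.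
Proof. by move=> h; apply/eqP/cmP. Qed.

Lemma monom_divK m a : (0 < m a)%N -> mulcm (ucm a) (divcm m (ucm a)) = m.
Proof.
move=> ma; apply: monom_eq => i; rewrite mulcmE divcmE ucmE.
by case: eqP => [<-|_]; rewrite ?subn0 // add1n subn1 prednK.
Qed.

Lemma monom_ind (Pm : {cmonom I} -> Prop) : Pm mon1 ->
  (forall a m, Pm m -> Pm (mulcm (ucm a) m)) -> forall m, Pm m.
Proof.
move=> h1 hM m; have [n] := ubnP (mdeg m); elim: n m => // n IH m; rewrite ltnS => mn.
case: (eqVneq m mon1) => [->//|m1].
have [a ma] : exists a, (0 < m a)%N.
  apply: contrapT => h; move/eqP: m1; apply; apply: monom_eq => i.
  rewrite cm1; apply/eqP; rewrite -leqn0 leqNgt; apply/negP => mi.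
  by apply: h; exists i.
rewrite -(monom_divK ma); apply: hM; apply: IH.
have : mdeg (mulcm (ucm a) (divcm m (ucm a))) =
    (mdeg (ucm a) + mdeg (divcm m (ucm a)))%N by exact: mdegM.
rewrite (monom_divK ma) mdegU => E.
by move: mn; rewrite E; lia.
Qed.

Lemma osc_ind (S : set osc) : subspace S ->
  (forall c m, S << c *g m >>) -> forall P, S P.
Proof. by move=> sS h P; rewrite [P]monalgE; apply: sub_sum. Qed.

Lemma osc_eq (U : lmodType K) (f h : osc -> U) : linear f -> linear h ->
  (forall c m, f << c *g m >> = h << c *g m >>) -> forall P, f P = h P.
Proof. by move=> hf hh fh; apply: osc_ind => //; apply: sub_eq. Qed.

Lemma scale_monom (s c : K) m : s *: << c *g m >> = << s * c *g m >> :> osc.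
Proof. by rewrite -mul_malgC malgM_def fgmulUU mul1m. Qed.

Lemma ovarU a c m : ovar a * << c *g m >> = << c *g mulcm (ucm a) m >> :> osc.
Proof. by rewrite malgM_def fgmulUU mul1r. Qed.

Lemma osc_ind_var (S : set osc) : subspace S -> S 1 ->
  (forall a P, S P -> S (ovar a * P)) -> forall P, S P.
Proof.
move=> sS h1 hv; apply: (osc_ind sS) => c; apply: (monom_ind (Pm := fun m => S << c *g m >>)).
  have -> : << c *g mon1 >> = c *: 1 :> osc.
    by rewrite -mul_malgC mulr1.
  exact: subZ.
by move=> a m hm; rewrite -ovarU; apply: hv.
Qed.

Lemma oderivEw a P (D : {fset {cmonom I}}) : (msupp P `<=` D)%fset ->
  oderiv a P = \sum_(m <- D) << P@_m *+ m a *g divcm m (ucm a) >>.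
Proof.
move=> PD; rewrite /oderiv (big_fset_incl _ PD) // => m _ /mcoeff_outdom ->.
by rewrite mul0rn monalgU0.
Qed.

Lemma oderiv_lin a : linear (@oderiv K I a).
Proof.
move=> s x y; pose D := (msupp x `|` msupp y)%fset.
rewrite (@oderivEw a _ D); last first.
  apply: (fsubset_trans (msuppD_le _ _)); rewrite fsetUSS ?fsubset_refl //.
  exact: msuppZ_le.
rewrite (@oderivEw a x D) ?fsubsetUl // (@oderivEw a y D) ?fsubsetUr //.
rewrite scaler_sumr -big_split; apply: eq_bigr => m _ /=.
rewrite mcoeffD mcoeffZ mulrnDl monalgUD; congr (_ + _).
by rewrite scale_monom mulrnAr.
Qed.

Lemma oderivU a c m : oderiv a << c *g m >> = << c *+ m a *g divcm m (ucm a) >> :> osc.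
Proof.
by rewrite (@oderivEw _ _ [fset m]%fset) ?msuppU_le // big_seq_fset1 mcoeffUU.
Qed.

Lemma oderiv1 a : oderiv a 1 = 0 :> osc.
Proof. by rewrite -[1]/(<< 1 *g mon1 >>) oderivU cm1 monalgU0. Qed.

Lemma oderiv_var a b P :
  oderiv a (ovar b * P) = ovar b * oderiv a P + (a == b)%:R *: P.
Proof.
have hv : linear (fun P : osc => ovar b * P).
  by move=> s x y; rewrite mulrDr scalerAr.
have hs : linear (fun P : osc => (a == b)%:R *: P).
  by move=> s x y; rewrite scalerDr !scalerA mulrC.
move: P; apply: (osc_eq (linear_comp (oderiv_lin a) hv)
  (linear_add (linear_comp hv (oderiv_lin a)) hs)) => c m.
have E1 : oderiv a (ovar b * << c *g m >>) =
    << c *+ mulcm (ucm b) m a *g divcm (mulcm (ucm b) m) (ucm a) >>.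
  by apply: etrans (oderivU _ _ _); congr (oderiv a _); exact: ovarU.
have E2 : ovar b * oderiv a << c *g m >> =
    << c *+ m a *g mulcm (ucm b) (divcm m (ucm a)) >>.
  by apply: etrans (ovarU _ _ _); congr (_ * _); exact: oderivU.
apply: (etrans E1); apply: esym; apply: (etrans (congr1 (fun u => u + _) E2)).
apply: esym; rewrite mulcmE ucmE.
case: (eqVneq a b) => [->|ab].
  rewrite scale1r add1n mulrSr monalgUD; apply: (f_equal2 +%R).
    case: (posnP (m b)) => [->|mb]; first by rewrite !mulr0n !monalgU0.
    apply: (congr1 (mkmalgU^~ _)); apply: monom_eq => i.
    by rewrite divcmE !mulcmE divcmE ucmE; case: eqP => [<-|_]; lia.
  apply: (congr1 (mkmalgU^~ _)); apply: monom_eq => i.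
  by rewrite divcmE mulcmE addKn.
rewrite scale0r addr0 add0n; apply: (congr1 (mkmalgU^~ _)); apply: monom_eq => i.
rewrite divcmE !mulcmE divcmE !ucmE.
case: (eqVneq a i) => [ai|_]; case: (eqVneq b i) => [bi|_]; try lia.
by rewrite ai bi eqxx in ab.
Qed.

Lemma oderivC a b P : oderiv a (oderiv b P) = oderiv b (oderiv a P).
Proof.
move: P; apply: (osc_eq (linear_comp (oderiv_lin a) (oderiv_lin b))
  (linear_comp (oderiv_lin b) (oderiv_lin a))) => c m.
have E x y : oderiv x (oderiv y << c *g m >>) =
    << c *+ m y *+ divcm m (ucm y) x *g divcm (divcm m (ucm y)) (ucm x) >>.
  by apply: etrans (oderivU _ _ _); congr (oderiv x _); exact: oderivU.
apply: (etrans (E a b)); apply: esym; apply: (etrans (E b a)).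
apply: (f_equal2 (fun k x => mkmalgU k x)).
  by apply: monom_eq => i; rewrite !divcmE subnAC.
rewrite !divcmE !ucmE -!mulrnA; case: (eqVneq a b) => [->//|_].
by rewrite !subn0 mulnC.
Qed.

Lemma mcoeff_oderiv a P n : (oderiv a P)@_n = (n a).+1%:R * P@_(mulcm (ucm a) n).
Proof.
have hl : linear (fun P : osc => (oderiv a P)@_n : K^o).
  exact: (linear_comp (mcoeff_lin n) (oderiv_lin a)).
have hr : linear (fun P : osc => (n a).+1%:R * P@_(mulcm (ucm a) n) : K^o).
  by move=> s x y; rewrite mcoeffD mcoeffZ mulrDr [_ *: _]mulrCA.
move: P; apply: (osc_eq hl hr) => c m; rewrite oderivU !mcoeffU.
case: (eqVneq m (mulcm (ucm a) n)) => [->|mn].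
  rewrite mulcmE ucmE eqxx add1n (_ : divcm _ _ = n) ?eqxx ?mulr1n.
    by rewrite mulr_natl.
  by apply: monom_eq => i; rewrite divcmE mulcmE addKn.
rewrite mulr0n mulr0; case: (posnP (m a)) => [->|ma]; first by rewrite mulr0n mul0rn.
case: eqP => // E; move/eqP: mn; case.
by rewrite -E monom_divK.
Qed.

Lemma mcoeff1_var a P : (ovar a * P)@_mon1 = 0.
Proof.
have hl : linear (fun P : osc => (ovar a * P)@_mon1 : K^o).
  apply: (linear_comp (mcoeff_lin mon1)) => s x y.
  by rewrite mulrDr scalerAr.
have hr : linear (fun _ : osc => 0 : K^o) by move=> s x y; rewrite scaler0 addr0.
move: P; apply: (osc_eq hl hr) => c m; rewrite ovarU mcoeffU; case: eqP => // E.
by have := congr1 (fun u : {cmonom I} => u a) E; rewrite mulcmE cmUU cm1.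
Qed.

Lemma monom_neq1 m : m <> mon1 -> exists a n, m = mulcm (ucm a) n.
Proof.
apply: (monom_ind (Pm := fun m => m <> mon1 -> exists a n, m = mulcm (ucm a) n)) => //.
by move=> a n _ _; exists a, n.
Qed.
End Polynomials.

(** * The oscillator module *)
Lemma linear_scalel (K : fieldType) (V : lmodType K) (v : V) (b : K) :
  linear (fun c : K^o => (b * c) *: v).
Proof. by move=> s x u; rewrite mulrDr scalerDl scalerA [_ * (s *: x)]mulrCA. Qed.

Lemma sub_ker (K : fieldType) (U V : lmodType K) (f : U -> V) :
  linear f -> subspace [set x | f x = 0].
Proof.
move=> hf; split=> [|a u v /= hu hv]; first exact: (lmap0 hf).
by rewrite hf hu hv scaler0 addr0.
Qed.

Lemma add_scale0 (K : fieldType) (V : lmodType K) (u v : V) (c : K) :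
  c = 0 -> u + c *: v = u.
Proof. by move=> ->; rewrite scale0r addr0. Qed.

Lemma add_scaleN (K : fieldType) (V : lmodType K) (u v : V) (c c' : K) :
  c + c' = 0 -> u + c *: v + c' *: v = u.
Proof. by move=> h; rewrite -addrA -scalerDl h scale0r addr0. Qed.

(** * The dual bases of the odd part, sorted by degree *)

Section DualBases.
Variables (K : numFieldType) (C : cartanDatum K) (g : contragredient C).
Variables (d : 'rV[K]_(cd_n C)) (B : g -> g -> K).
Hypothesis hB : standard_form d B.
Variables (I : choiceType) (xx dd : I -> g).
Hypothesis hbases : dual_odd_bases B xx dd.
Local Notation hh := (@ga_h K C g).
Local Notation formB := (form_bilinear hB).

(** Some homogeneous [y] pairs nontrivially with [x]; invariance forces the eigenvalue of [gelt] on
    [x] to be minus the degree of [y], hence an integer. *)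
Lemma root_vector_dg (x : g) : root_vector x -> exists k, dg k x.
Proof.
move=> [x0 [r _ hr]].
have [b [k [y [hy Bxy]]]] : exists b k y, gk b k y /\ B x y != 0.
  apply: contrapT => h; move/eqP: x0; apply; apply: (form_nd hB).
  apply: (gk_ind (form_kerr hB x)) => b k y hy /=.
  by apply/eqP; apply: contrapT => Bxy; apply: h; exists b, k, y; split=> //; apply/negP.
exists (- k); rewrite /dg /= hr; congr (_ *: _).
apply: (mulIf Bxy).
have E1 : B (brk (hh (gelt C)) x) y = r (gelt C) * B x y.
  by rewrite hr (bilZl formB).
rewrite -E1 (brk_evenC x (homog_h g _)) (bilNl formB) (form_inv hB) hy.2.
by rewrite (bilZr formB) rmorphN mulNr.
Qed.

(** [B (dd a) (xx a) != 0] forces opposite degrees, and [dd a] in [nplus] fixes the sign. *)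
Lemma dual_basis_deg : exists deg : I -> nat, forall a,
  [/\ (0 < deg a)%N, gk true (deg a) (dd a) & gk true (- (deg a)%:Z) (xx a)].
Proof.
have [bx [bd [hr hp]]] : is_basis (@odd_nminus K C g) xx /\
    is_basis (@odd_nplus K C g) dd /\
    (forall a, root_vector (xx a) /\ root_vector (dd a)) /\
    (forall a b, B (dd a) (xx b) = if a == b then 2^-1 else 0) by case: hbases.
suff h a : exists k : nat, [/\ (0 < k)%N, gk true k (dd a) & gk true (- k%:Z) (xx a)].
  by have /choice[deg hdeg] := h; exists deg.
have [hx hd] := hr a; have [k hk] := root_vector_dg hd; have [l hl] := root_vector_dg hx.
have [pd npd] : homog true (dd a) /\ nplus (dd a) := bd.1 a.
have [px _] : homog true (xx a) /\ nminus (xx a) := bx.1 a.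
have k0 : 0 < k.
  case: (ltrP 0 k) => // k0; case: hd => /eqP; case.
  apply: (deg_part_disj hB npd); apply: (dg_deg_part hB (k := k)) => //.
  by rewrite /= /pos_deg -leNgt.
have kl : k + l = 0.
  apply/eqP; apply: contraT => kl.
  have := hp a a; rewrite eqxx (form_dg hB hk hl kl) => /esym/eqP.
  by rewrite invr_eq0 pnatr_eq0.
exists `|k|%N; split; first by lia.
  by split=> //; rewrite (_ : `|k|%N%:Z = k) //; lia.
by split=> //; rewrite (_ : - `|k|%N%:Z = l) //; lia.
Qed.

Variable deg : I -> nat.
Hypothesis hdeg : forall a,
  [/\ (0 < deg a)%N, gk true (deg a) (dd a) & gk true (- (deg a)%:Z) (xx a)].

Lemma dd_gk a : gk true (deg a) (dd a). Proof. by case: (hdeg a). Qed.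
Lemma xx_gk a : gk true (- (deg a)%:Z) (xx a). Proof. by case: (hdeg a). Qed.
Lemma deg_gt0 a : (0 < deg a)%N. Proof. by case: (hdeg a). Qed.
Lemma form_ddxx a b : B (dd a) (xx b) = if a == b then 2^-1 else 0.
Proof. by case: hbases. Qed.
Lemma form_xxdd a b : B (xx a) (dd b) = - (if b == a then 2^-1 else 0).
Proof. by rewrite (form_odd hB (xx_gk a).1 (dd_gk b).1) form_ddxx. Qed.

(** Basis vectors of degree [k] with partners [2 *: xx a] form a dual family, whose size is bounded;
    a duplicate-free list is extended until it is complete. *)
Lemma dual_basis_finite : exists ls : nat -> seq I,
  forall k, uniq (ls k) /\ forall a, (a \in ls k) = (deg a == k).
Proof.
suff h k : exists s : seq I, uniq s /\ forall a, (a \in s) = (deg a == k).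
  by have /choice[ls hls] := h; exists ls.
have [n [e he]] := gk_fin hB true k.
have bound s : uniq s -> (forall a, a \in s -> deg a = k) -> (size s <= n)%N.
  move=> us sk.
  have := @dual_family_size _ _ B formB (gk true k) (gk true (- k%:Z)) n e
    [seq (dd a, 2 *: xx a) | a <- s] he.
  rewrite size_map; apply; split; rewrite size_map => i.
    case: s us sk => // a0 s us sk is_; rewrite (nth_map a0) //=.
    have := sk (nth a0 (a0 :: s) i); rewrite mem_nth // => /(_ isT) <-.
    split; first exact: dd_gk.
    by apply: (subZ (gk_sub g _ _)); exact: xx_gk.
  move=> j; case: s us sk => // a0 s us sk is_ js; rewrite !(nth_map a0) //=.
  rewrite (bilZr formB) form_ddxx nth_uniq //; case: eqP => _; last by rewrite scaler0.
  by rewrite [_ *: _]mulfV // pnatr_eq0.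
have ext m : forall s, uniq s -> (forall a, a \in s -> deg a = k) ->
    (n < size s + m)%N -> exists s : seq I, uniq s /\ forall a, (a \in s) = (deg a == k).
  elim: m => [|m IH] s us sk sn.
    by move: (bound s us sk); rewrite leqNgt -[size s]addn0 sn.
  case: (pselect (exists a, deg a = k /\ a \notin s)) => [[a [ak as_]]|h].
    apply: (IH (a :: s)); rewrite /= ?as_ //; last by rewrite addSnnS.
    by move=> b; rewrite in_cons => /orP[/eqP->//|]; exact: sk.
  exists s; split=> // a; apply/idP/eqP => [|ak]; first exact: sk.
  by apply: contraT => as_; case: h; exists a.
by apply: (ext n.+1 [::]).
Qed.

Variable ls : nat -> seq I.
Hypothesis hls : forall k, uniq (ls k) /\ forall a, (a \in ls k) = (deg a == k).

Lemma mem_ls k a : (a \in ls k) = (deg a == k). Proof. by case: (hls k). Qed.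

Definition upto N := flatten [seq ls k | k <- iota 1 N].

Lemma mem_upto N a : (a \in upto N) = (deg a <= N)%N.
Proof.
apply/flatten_mapP/idP => [[k]|aN].
  by rewrite mem_iota mem_ls => kN /eqP ->; lia.
exists (deg a); last by rewrite mem_ls.
by rewrite mem_iota; have := deg_gt0 a; lia.
Qed.

Lemma uptoS N : upto N.+1 = upto N ++ ls N.+1.
Proof. by rewrite /upto -[X in iota _ X]addn1 iotaD map_cat flatten_cat /= cats0 add1n. Qed.

Lemma upto_uniq N : uniq (upto N).
Proof.
elim: N => // N IH; rewrite uptoS cat_uniq IH (hls N.+1).1 /= andbT.
by apply/hasPn => a; rewrite mem_ls mem_upto => /eqP->; rewrite ltnn.
Qed.

Lemma isumE (V : lmodType K) (F : I -> V) N :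
  (forall a, (N < deg a)%N -> F a = 0) ->
  \sum_(a \in [set: I]) F a = \sum_(a <- upto N) F a.
Proof.
move=> hF; rewrite [RHS]fsbig_seq ?upto_uniq //.
apply/esym/fsbig_widen => // a /= [_ /negP]; rewrite mem_upto -ltnNge => h.
exact: hF.
Qed.

Lemma big_upto (V : lmodType K) (F : I -> V) N :
  \sum_(a <- upto N) F a = \sum_(1 <= k < N.+1) \sum_(a <- ls k) F a.
Proof.
elim: N => [|N IH]; first by rewrite /upto /= big_nil big_geq.
by rewrite uptoS big_cat big_nat_recr //= IH.
Qed.

Lemma odd_ind (P : set g) : subspace P -> (forall a, P (xx a)) -> (forall a, P (dd a)) ->
  (forall k y, gk false k y -> P y) -> forall y, P y.
Proof.
move=> sP hx hd h0; apply: (gk_ind sP) => -[] k y; last exact: h0.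
have [[_ bx] [_ bd] _ _] := hbases.
move=> hy; case: (ltrgt0P k) => k0.
- have /bd [c [-> _]] : odd_nplus y by split; [exact: hy.1|exact: (dg_deg_part hB k0 hy.2)].
  by apply: (sub_sum sP) => a _; apply: (subZ sP).
- have /bx [c [-> _]] : odd_nminus y.
    by split; [exact: hy.1|apply: (dg_deg_part hB _ hy.2); rewrite /neg_deg].
  by apply: (sub_sum sP) => a _; apply: (subZ sP).
- by rewrite (_ : y = 0) ?sub0 //; [exact: sub0|apply: (gk_odd0 hB); rewrite -k0].
Qed.

(** The factor 2 compensates the normalisation [B (dd a) (xx a) = 2^-1]. *)
Lemma ls_dual_system k : (0 < k)%N ->
  dual_system B (gk true k) (gk true (- k%:Z)) [seq (dd a, 2 *: xx a) | a <- ls k].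
Proof.
move=> k0; have h1 a : a \in ls k -> gk true k (dd a) /\ gk true (- k%:Z) (2 *: xx a).
  rewrite mem_ls => /eqP <-; split; first exact: dd_gk.
  by apply: (subZ (gk_sub g _ _)); exact: xx_gk.
split.
- by move=> _ /mapP[a /h1[? ?] ->].
- move=> w hw; rewrite big_map /=; apply/eqP; rewrite -subr_eq0; apply/eqP.
  apply: (form_nd_gk hB (b := true) (k := k)).
    apply: (subB (gk_sub g _ _)) => //; apply: (sub_sum (gk_sub g _ _)) => a /h1[? _].
    exact: (subZ (gk_sub g _ _)).
  move=> y hy; set w' := _ - _.
  have hw' : gk true k w'.
    apply: (subB (gk_sub g _ _)) => //; apply: (sub_sum (gk_sub g _ _)) => a /h1[? _].
    exact: (subZ (gk_sub g _ _)).
  suff hxx b : B w' (xx b) = 0.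
    have [[_ bx] _ _ _] := hbases.
    have /bx [c [-> _]] : odd_nminus y.
      by split; [exact: hy.1|apply: (dg_deg_part hB _ hy.2); rewrite /neg_deg; lia].
    apply: (sub_sum (form_kerr hB w')) => b _; exact: (subZ (form_kerr hB w')).
  case: (boolP (b \in ls k)) => bk; last first.
    apply: (form_gk hB hw' (xx_gk b)); rewrite /=; move: bk; rewrite mem_ls.
    by move=> /eqP h; apply/eqP; lia.
  rewrite /w' (bilBl formB) (bil_suml formB) (bigD1_seq b) ?(hls k).1 //=.
  rewrite big1 => [|a /negbTE ab]; last by rewrite (bilZl formB) form_ddxx ab scaler0.
  rewrite (bilZl formB) form_ddxx eqxx (bilZr formB) addr0.
  have half2 (x : K) : 2 * x * 2^-1 = x by rewrite mulrAC mulfV ?mul1r // pnatr_eq0.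
  by apply/eqP; rewrite subr_eq0; apply/eqP/esym; exact: half2.
- move=> w hw; rewrite big_map /=; apply/eqP; rewrite -subr_eq0; apply/eqP.
  have hs : gk true (- k%:Z) (\sum_(a <- ls k) B (dd a) w *: (2 *: xx a)).
    apply: (sub_sum (gk_sub g _ _)) => a /h1[_ ?]; exact: (subZ (gk_sub g _ _)).
  apply: (form_nd_gkr hB (b := true) (k := k)); first exact: (subB (gk_sub g _ _)).
  move=> y hy; set w' := _ - _.
  have hw' : gk true (- k%:Z) w' by apply: (subB (gk_sub g _ _)).
  suff hdd b : B (dd b) w' = 0.
    have [_ [_ bd] _ _] := hbases.
    have /bd [c [-> _]] : odd_nplus y.
      by split; [exact: hy.1|apply: (dg_deg_part hB _ hy.2); rewrite /pos_deg].
    apply: (sub_sum (form_kerl hB w')) => b _; exact: (subZ (form_kerl hB w')).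
  case: (boolP (b \in ls k)) => bk; last first.
    apply: (form_gk hB (dd_gk b) hw'); rewrite /=; move: bk; rewrite mem_ls.
    by move=> /eqP h; apply/eqP; lia.
  rewrite /w' (bilBr formB) (bil_sumr formB) (bigD1_seq b) ?(hls k).1 //=.
  rewrite big1 => [|a /negbTE ab].
    rewrite !(bilZr formB) form_ddxx eqxx addr0.
    by rewrite -[2 *: _]/(_ * _) mulfV ?pnatr_eq0 // [_ *: 1]mulr1 subrr.
  by rewrite !(bilZr formB) form_ddxx eq_sym ab !scaler0.
Qed.
End DualBases.

(** * The Clifford action by multiplications and derivations *)

Section Oscillator.
Variables (K : numFieldType) (C : cartanDatum K) (g : contragredient C).
Variables (d : 'rV[K]_(cd_n C)) (B : g -> g -> K).
Hypothesis hB : standard_form d B.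
Variables (I : choiceType) (xx dd : I -> g).
Hypothesis hbases : dual_odd_bases B xx dd.
Variable deg : I -> nat.
Hypothesis hdeg : forall a,
  [/\ (0 < deg a)%N, gk true (deg a) (dd a) & gk true (- (deg a)%:Z) (xx a)].
Variable ls : nat -> seq I.
Hypothesis hls : forall k, uniq (ls k) /\ forall a, (a \in ls k) = (deg a == k).
Local Notation formB := (form_bilinear hB).
Local Notation osc := (oscillator K I).
Local Notation ovar := (@ovar K I).
Local Notation pneg := (deg_proj neg_deg).
Local Notation ppos := (deg_proj pos_deg).
Local Notation cliff := (cliff xx dd).
Implicit Types (P : osc) (y z u w : g).

Lemma odd_nminus_sub : subspace (@odd_nminus K C g).
Proof. exact: (sub_and (homog_sub _ _) (deg_part_sub g _)). Qed.
Lemma odd_nplus_sub : subspace (@odd_nplus K C g).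
Proof. exact: (sub_and (homog_sub _ _) (deg_part_sub g _)). Qed.

Lemma odd_pneg y : homog true y -> odd_nminus (pneg y).
Proof. by move=> hy; split; [exact: deg_proj_homog hB _ _ _ hy|by have [] := deg_projP neg_deg y]. Qed.
Lemma odd_ppos y : homog true y -> odd_nplus (ppos y).
Proof. by move=> hy; split; [exact: deg_proj_homog hB _ _ _ hy|by have [] := deg_projP pos_deg y]. Qed.

Lemma basis_xx : is_basis (@odd_nminus K C g) xx. Proof. by case: hbases. Qed.
Lemma basis_dd : is_basis (@odd_nplus K C g) dd. Proof. by case: hbases. Qed.

Lemma mulr_linr (Q : osc) : linear (fun P : osc => Q * P).
Proof. by move=> s x y; rewrite mulrDr scalerAr. Qed.

(** Composing [cliff] with the odd projection gives a map that is bilinear on all of [g]. *)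
Definition gamS y P := cliff (spr g true y) P.

Lemma gamSE y P : homog true y -> gamS y P = cliff y P.
Proof. by move=> hy; rewrite /gamS hy. Qed.

Lemma gamS_bil : bilinear_map gamS.
Proof.
split=> [y|P].
  apply: linear_add; first exact: mulr_linr.
  apply: linear_bigsum => a; exact: (linear_scale _ (oderiv_lin a)).
move=> a y z.
have hy := spr_homog true y; have hz := spr_homog true z.
rewrite /gamS linearP /cliff !(deg_proj_lin hB).
have E1 := extendP odd_nminus_sub basis_xx ovar a (odd_pneg hy) (odd_pneg hz).
have E2 := extendP odd_nplus_sub basis_dd (fun b => oderiv b P) a (odd_ppos hy) (odd_ppos hz).
by rewrite [lincomb ovar _]E1 [lincomb (fun b => oderiv b P) _]E2 mulrDl -scalerAl scalerDr addrACA.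
Qed.

Lemma pneg_gk b k y : gk b k y -> pneg y = if k < 0 then y else 0.
Proof. by move=> [_ hy]; rewrite (deg_proj_dg hB _ hy). Qed.
Lemma ppos_gk b k y : gk b k y -> ppos y = if 0 < k then y else 0.
Proof. by move=> [_ hy]; rewrite (deg_proj_dg hB _ hy). Qed.

Lemma pneg_xx a : pneg (xx a) = xx a.
Proof. by rewrite (pneg_gk (xx_gk hdeg a)) oppr_lt0 ltz_nat (deg_gt0 hdeg). Qed.
Lemma ppos_xx a : ppos (xx a) = 0.
Proof. by rewrite (ppos_gk (xx_gk hdeg a)) oppr_gt0. Qed.
Lemma ppos_dd a : ppos (dd a) = dd a.
Proof. by rewrite (ppos_gk (dd_gk hdeg a)) ltz_nat (deg_gt0 hdeg). Qed.
Lemma pneg_dd a : pneg (dd a) = 0.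
Proof. by rewrite (pneg_gk (dd_gk hdeg a)). Qed.

Lemma gamS_xx a P : gamS (xx a) P = ovar a * P.
Proof.
rewrite gamSE; last exact: (xx_gk hdeg a).1.
rewrite /cliff pneg_xx ppos_xx.
have E1 := extend_basis basis_xx ovar a.
have E2 := extend0 odd_nplus_sub basis_dd (fun b => oderiv b P).
by rewrite [lincomb ovar _]E1 [lincomb (fun b => oderiv b P) _]E2 addr0.
Qed.

Lemma gamS_dd a P : gamS (dd a) P = oderiv a P.
Proof.
rewrite gamSE; last exact: (dd_gk hdeg a).1.
rewrite /cliff pneg_dd ppos_dd.
have E1 := extend_basis basis_dd (fun b => oderiv b P) a.
have E2 := extend0 odd_nminus_sub basis_xx ovar.
by rewrite [lincomb ovar _]E2 [lincomb (fun b => oderiv b P) _]E1 mul0r add0r.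
Qed.

Lemma gamS_even k y P : gk false k y -> gamS y P = 0.
Proof.
move=> hy; rewrite /gamS (homog_sprE _ hy.1) /=.
by rewrite -[X in cliff X](linear0 (spr g true)) -/(gamS 0 P) (bil0l gamS_bil).
Qed.

(** Bilinearity reduces this to basis vectors and thus to the Heisenberg relations; the 2 of the
    Clifford relation cancels the [2^-1] of the dual bases. *)
Lemma gamS_comm y z P :
  gamS y (gamS z P) = gamS z (gamS y P) + (2 * B (spr g true y) (spr g true z)) *: P.
Proof.
have hs := linear_scalel P 2.
have sub y' : subspace [set z' | gamS y' (gamS z' P) =
    gamS z' (gamS y' P) + (2 * B (spr g true y') (spr g true z')) *: P].
  apply: sub_eq; first exact: (linear_comp (bil_linr gamS_bil y') (bil_linl gamS_bil P)).
  apply: linear_add; first exact: (bil_linl gamS_bil).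
  apply: (linear_comp hs); exact: (linear_comp (bil_linr formB _) (linearP (spr g true))).
have sub' z' : subspace [set y' | gamS y' (gamS z' P) =
    gamS z' (gamS y' P) + (2 * B (spr g true y') (spr g true z')) *: P].
  apply: sub_eq; first exact: (bil_linl gamS_bil).
  apply: linear_add; first exact: (linear_comp (bil_linr gamS_bil z') (bil_linl gamS_bil P)).
  apply: (linear_comp hs); exact: (linear_comp (bil_linl formB _) (linearP (spr g true))).
have sx a : spr g true (xx a) = xx a by exact: (xx_gk hdeg a).1.
have sd a : spr g true (dd a) = dd a by exact: (dd_gk hdeg a).1.
have even k y' z' : gk false k y' -> gamS y' (gamS z' P) =
    gamS z' (gamS y' P) + (2 * B (spr g true y') (spr g true z')) *: P.
  move=> hy; rewrite !(gamS_even _ hy) (bil0r gamS_bil) (homog_sprE _ hy.1) /=.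
  by rewrite (bil0l formB) mulr0 scale0r addr0.
have even' k y' z' : gk false k z' -> gamS y' (gamS z' P) =
    gamS z' (gamS y' P) + (2 * B (spr g true y') (spr g true z')) *: P.
  move=> hy; rewrite !(gamS_even _ hy) (bil0r gamS_bil) (homog_sprE _ hy.1) /=.
  by rewrite (bil0r formB) mulr0 scale0r addr0.
have two : (2 : K) * 2^-1 = 1 by rewrite mulfV // pnatr_eq0.
move: y; apply: (odd_ind hB hbases (sub' z)) => [a|a|k y]; last exact: even.
- move: z; apply: (odd_ind hB hbases (sub (xx a))) => [b|b|k z]; last exact: even'.
  + rewrite /mkset !gamS_xx !sx; apply: esym; apply: etrans (mulrCA (ovar b) (ovar a) P).
    apply: add_scale0; rewrite (form_gk hB (xx_gk hdeg a) (xx_gk hdeg b)) ?mulr0 //.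
    by have := deg_gt0 hdeg a; have := deg_gt0 hdeg b; move=> ? ?; apply/eqP; lia.
  + rewrite /mkset !gamS_xx !gamS_dd sx sd; apply: esym.
    apply: (etrans (f_equal2 +%R (oderiv_var b a P) erefl)).
    apply: add_scaleN; rewrite (form_xxdd hB hbases hdeg).
    by case: eqP => _; rewrite ?mulrN ?two ?oppr0 ?mulr0 ?subrr ?addr0.
- move: z; apply: (odd_ind hB hbases (sub (dd a))) => [b|b|k z]; last exact: even'.
  + rewrite /mkset !gamS_xx !gamS_dd sx sd (form_ddxx hbases).
    apply: (etrans (oderiv_var a b P)); apply: (f_equal2 +%R erefl).
    apply: (congr1 (fun c => c *: P)).
    by case: eqP => _; rewrite ?two ?mulr0.
  + rewrite /mkset !gamS_dd !sd; apply: esym; apply: etrans (oderivC b a P).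
    apply: add_scale0; rewrite (form_gk hB (dd_gk hdeg a) (dd_gk hdeg b)) ?mulr0 //.
    by have := deg_gt0 hdeg a; have := deg_gt0 hdeg b; move=> ? ?; apply/eqP; lia.
Qed.

Lemma oderiv_nil P : exists N : nat, forall a, (N < deg a)%N -> oderiv a P = 0.
Proof.
move: P; apply: (osc_ind_var (S := [set P | exists N : nat, forall a,
  (N < deg a)%N -> oderiv a P = 0])).
- split; first by exists 0%N => a _; rewrite (lmap0 (oderiv_lin a)).
  move=> s x y [N hN] [M hM]; exists (maxn N M) => a; rewrite gtn_max => /andP[h1 h2].
  by rewrite oderiv_lin hN // hM // scaler0 addr0.
- by exists 0%N => a _; rewrite oderiv1.
- move=> b P [N hN]; exists (maxn N (deg b)) => a; rewrite gtn_max => /andP[h1 h2].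
  rewrite oderiv_var hN // mulr0 add0r; case: eqP => [ab|_]; last by rewrite scale0r.
  by rewrite ab ltnn in h2.
Qed.

Lemma gamS_pos k y P : gk true k y -> 0 < k ->
  gamS y P = \sum_(a <- ls `|k|) (2 * B y (xx a)) *: oderiv a P.
Proof.
move=> hy k0; have kE : `|k|%N%:Z = k by lia.
have := @ls_dual_system _ _ _ _ _ hB _ _ _ hbases _ hdeg _ hls `|k|%N.
rewrite kE => /(_ ltac:(lia)) [_ h _].
rewrite {1}(h y hy) big_map (bil_suml gamS_bil); apply: eq_bigr => a _ /=.
by rewrite (bilZl gamS_bil) gamS_dd (bilZr formB).
Qed.

Lemma gamS_neg k y P : gk true k y -> k < 0 ->
  gamS y P = \sum_(a <- ls `|k|) (2 * B (dd a) y) *: (ovar a * P).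
Proof.
move=> hy k0; have kE : `|k|%N%:Z = - k by lia.
have := @ls_dual_system _ _ _ _ _ hB _ _ _ hbases _ hdeg _ hls `|k|%N.
rewrite kE opprK => /(_ ltac:(lia)) [_ _ h].
rewrite {1}(h y hy) big_map (bil_suml gamS_bil); apply: eq_bigr => a _ /=.
by rewrite scalerA (bilZl gamS_bil) gamS_xx mulrC.
Qed.

Lemma gamS_nil : restricted gamS.
Proof.
move=> P; have [N hN] := oderiv_nil P; exists N => k kN.
apply: (dg_ind (sub_ker (bil_linl gamS_bil P))) => -[] y hy; last exact: gamS_even hy.
rewrite /mkset (gamS_pos _ hy); last by lia.
rewrite big1_seq // => a /andP[_]; rewrite (mem_ls hls) => /eqP ak.
by rewrite hN; [exact: scaler0|lia].
Qed.
End Oscillator.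

(** * The unshifted action of the even part on the oscillator module *)

Section SpinAction.
Variables (K : numFieldType) (C : cartanDatum K) (g : contragredient C).
Variables (d : 'rV[K]_(cd_n C)) (B : g -> g -> K).
Hypothesis hB : standard_form d B.
Variables (I : choiceType) (xx dd : I -> g).
Hypothesis hbases : dual_odd_bases B xx dd.
Variable deg : I -> nat.
Hypothesis hdeg : forall a,
  [/\ (0 < deg a)%N, gk true (deg a) (dd a) & gk true (- (deg a)%:Z) (xx a)].
Variable ls : nat -> seq I.
Hypothesis hls : forall k, uniq (ls k) /\ forall a, (a \in ls k) = (deg a == k).
Local Notation brkB := (@brkB K g).
Local Notation formB := (form_bilinear hB).
Local Notation upto := (upto ls).
Local Notation pneg := (deg_proj neg_deg).
Local Notation ppos := (deg_proj pos_deg).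
Local Notation ev := (spr g false).
Local Notation od := (spr g true).
Implicit Types (y z u w : g).

(* The oscillator module enters only through the following properties, so that
   its polynomial realization is never unfolded. *)
Variables (S : lmodType K) (gam : g -> S -> S) (one : S) (c0 : S -> K^o).
Hypotheses (hgam : bilinear_map gam) (hc0 : linear c0).
Hypothesis gam_comm : forall y z P,
  gam y (gam z P) = gam z (gam y P) + (2 * B (od y) (od z)) *: P.
Hypothesis gam_nil : restricted gam.
Hypothesis gam_one : forall k y, gk true k y -> 0 <= k -> gam y one = 0.
Hypothesis c0_gam : forall k y P, gk true k y -> k < 0 -> c0 (gam y P) = 0.
Hypothesis S_ind : forall W : set S, subspace W -> W one ->
  (forall a P, W P -> W (gam (xx a) P)) -> forall P, W P.


Lemma od_split u : homog true u -> pneg u + ppos u = u.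
Proof.
move=> hu; rewrite -hu; move: u {hu}; apply: gk_ind.
  apply: sub_eq; last exact: linearP.
  by apply: linear_add; exact: (linear_comp (deg_proj_lin hB _) (linearP _)).
move=> b k u hu; rewrite /mkset (homog_sprE _ hu.1); case: b hu => hu /=; last first.
  by rewrite !(lmap0 (deg_proj_lin hB _)) addr0.
rewrite !(deg_proj_dg hB _ hu.2) /neg_deg /pos_deg.
case: (ltrgt0P k) => k0; rewrite ?addr0 ?add0r //.
by apply/esym/(gk_odd0 hB); rewrite -k0.
Qed.

(** Only basis vectors up to the degrees occurring in [y] contribute, so the partial sums stabilise;
    [2^-1] is the normalisation of the bases. *)
Lemma od_basis_expand y : exists N0 : nat, forall N, (N0 <= N)%N ->
  \sum_(a <- upto N) (B (dd a) (od y) *: xx a - B (xx a) (od y) *: dd a)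
  = 2^-1 *: od y.
Proof.
have nd a := (dd_gk hdeg a).1; have nx a := (xx_gk hdeg a).1.
pose Z N y := \sum_(a <- upto N) (B (dd a) (od y) *: xx a - B (xx a) (od y) *: dd a).
have hl (x : g) : linear (fun y => B x (od y) : K^o).
  exact: (linear_comp (bil_linr formB x) (linearP od)).
move: y; apply: (odd_ind hB hbases).
- split; first by exists 0%N => N _; rewrite linear0 scaler0 big1 // => a _;
    rewrite !(bil0r formB) !scale0r subrr.
  move=> s u v [N1 h1] [N2 h2]; exists (maxn N1 N2) => N; rewrite geq_max => /andP[a1 a2].
  rewrite linearP scalerDr scalerA mulrC -scalerA -(h1 _ a1) -(h2 _ a2).
  rewrite scaler_sumr -big_split; apply: eq_bigr => a _ /=.
  rewrite !(bilDr formB) !(bilZr formB) !scalerDl opprD addrACA.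
  by rewrite scalerBr !scalerA.
- move=> b; exists (deg b) => N bN; rewrite (nx b : od (xx b) = xx b).
  rewrite (bigD1_seq b) ?(upto_uniq hdeg hls) ?(mem_upto hdeg hls) //=.
  rewrite (form_ddxx hbases) eqxx big1 => [|a /negbTE ab].
    rewrite (form_gk hB (xx_gk hdeg b) (xx_gk hdeg b)) ?scale0r ?subr0 ?addr0 //.
    by have := deg_gt0 hdeg b; move=> ?; apply/eqP; lia.
  rewrite (form_ddxx hbases) ab scale0r.
  rewrite (form_gk hB (xx_gk hdeg a) (xx_gk hdeg b)) ?scale0r ?subr0 //.
  by have := deg_gt0 hdeg b; move=> ?; apply/eqP; lia.
- move=> b; exists (deg b) => N bN; rewrite (nd b : od (dd b) = dd b).
  rewrite (bigD1_seq b) ?(upto_uniq hdeg hls) ?(mem_upto hdeg hls) //=.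
  rewrite (form_xxdd hB hbases hdeg) eqxx big1 => [|a /negbTE ab].
    rewrite (form_gk hB (dd_gk hdeg b) (dd_gk hdeg b)); last first.
      by have := deg_gt0 hdeg b; move=> ?; apply/eqP; lia.
    by rewrite scale0r sub0r addr0 scaleNr opprK.
  rewrite (form_xxdd hB hbases hdeg) [b == a]eq_sym ab oppr0 scale0r.
  rewrite (form_gk hB (dd_gk hdeg a) (dd_gk hdeg b)) ?scale0r ?subr0 //.
  by have := deg_gt0 hdeg b; move=> ?; apply/eqP; lia.
- move=> k y hy; exists 0%N => N _; rewrite (homog_sprE _ hy.1) /= scaler0.
  by rewrite big1 // => a _; rewrite !(bil0r formB) !scale0r subrr.
Qed.

(** Already in normal order, as [dd a] stands on the right. In [ordered_term] the positive part of
    [u] has to move to the right of [xx a], while the negative part may stay. *)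
Definition left_term w a P := gam (brk (ev w) (xx a)) (gam (dd a) P).
Definition ordered_term u a P :=
  gam (pneg u) (gam (xx a) P) + gam (xx a) (gam (ppos u) P).
Definition right_term w a P := ordered_term (brk (ev w) (dd a)) a P.
Definition spin w P : S :=
  2^-1 *: (\sum_(a \in [set: I]) left_term w a P)
  - 2^-1 *: (\sum_(a \in [set: I]) right_term w a P).

Lemma left_term_bil a : bilinear_map (fun w P => left_term w a P).
Proof.
split=> [w|P]; first exact: (linear_comp (bil_linr hgam _) (bil_linr hgam _)).
apply: (linear_comp (bil_linl hgam _)).
exact: (linear_comp (bil_linl brkB _) (linearP ev)).
Qed.

Lemma ordered_term_bil a : bilinear_map (fun u P => ordered_term u a P).
Proof.
split=> [u|P].
  by apply: linear_add; exact: (linear_comp (bil_linr hgam _) (bil_linr hgam _)).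
apply: linear_add.
  exact: (linear_comp (bil_linl hgam _) (deg_proj_lin hB _)).
apply: (linear_comp (bil_linr hgam _)).
exact: (linear_comp (bil_linl hgam _) (deg_proj_lin hB _)).
Qed.

Lemma right_term_bil a : bilinear_map (fun w P => right_term w a P).
Proof.
split=> [w|P]; first exact: (bil_linr (ordered_term_bil a)).
apply: (linear_comp (bil_linl (ordered_term_bil a) P)).
exact: (linear_comp (bil_linl brkB _) (linearP ev)).
Qed.

Lemma left_term_fin w P : exists N : nat, forall a, (N < deg a)%N -> left_term w a P = 0.
Proof.
have [N hN] := gam_nil P; exists N => a aN.
by rewrite /left_term (hN (deg a)) ?(bil0r hgam) //; exact: (dd_gk hdeg a).2.
Qed.

Lemma right_term_fin w P : exists N : nat, forall a, (N < deg a)%N -> right_term w a P = 0.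
Proof.
move: w; apply: gk_ind.
  split; first by exists 0%N => a _; rewrite (bil0l (right_term_bil a)).
  move=> s u v [N1 h1] [N2 h2]; exists (maxn N1 N2) => a; rewrite gtn_max => /andP[a1 a2].
  by rewrite (bil_linl (right_term_bil a)) h1 // h2 // scaler0 addr0.
move=> [] k w hw.
  exists 0%N => a _; rewrite /right_term (homog_sprE _ hw.1) /= (bil0l brkB).
  exact: (bil0l (ordered_term_bil a)).
have [N hN] := gam_nil P; exists (N + `|k|)%N => a aN.
rewrite /right_term (hw.1 : ev w = w) /ordered_term.
have hwd := gk_brk hw (dd_gk hdeg a).
rewrite !(deg_proj_dg hB _ hwd.2) /neg_deg /pos_deg.
rewrite (_ : (k + deg a < 0) = false); last by apply/negbTE; lia.
rewrite (_ : (0 < k + deg a) = true); last by lia.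
by rewrite (bil0l hgam) add0r (hN (k + deg a)) ?(bil0r hgam) //; [lia|exact: hwd.2].
Qed.

Lemma spinE w P : exists N0 : nat, forall N, (N0 <= N)%N ->
  spin w P = 2^-1 *: \sum_(a <- upto N) (left_term w a P - right_term w a P).
Proof.
have [N1 h1] := left_term_fin w P; have [N2 h2] := right_term_fin w P.
exists (maxn N1 N2) => N; rewrite geq_max => /andP[a1 a2].
rewrite /spin (isumE hdeg hls (N := N)) => [|a aN]; last by apply: h1; lia.
rewrite (isumE hdeg hls (N := N)) => [|a aN]; last by apply: h2; lia.
by rewrite -scalerBr sumrB.
Qed.

Lemma spin_bil : bilinear_map spin.
Proof.
split=> [w|P] s u v.
- have [N1 h1] := spinE w u; have [N2 h2] := spinE w v.
  have [N3 h3] := spinE w (s *: u + v); pose N := maxn N1 (maxn N2 N3).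
  rewrite (h1 N) ?(h2 N) ?(h3 N) /N ?leq_max ?leqnn ?orbT //.
  rewrite [RHS]addrC scalerA mulrC -scalerA -scalerDr [in RHS]addrC; congr (_ *: _).
  rewrite scaler_sumr -big_split; apply: eq_bigr => a _ /=.
  rewrite (bil_linr (left_term_bil a)) (bil_linr (right_term_bil a)).
  by rewrite scalerBr opprD addrACA.
- have [N1 h1] := spinE u P; have [N2 h2] := spinE v P.
  have [N3 h3] := spinE (s *: u + v) P; pose N := maxn N1 (maxn N2 N3).
  rewrite (h1 N) ?(h2 N) ?(h3 N) /N ?leq_max ?leqnn ?orbT //.
  rewrite [RHS]addrC scalerA mulrC -scalerA -scalerDr [in RHS]addrC; congr (_ *: _).
  rewrite scaler_sumr -big_split; apply: eq_bigr => a _ /=.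
  rewrite (bil_linl (left_term_bil a)) (bil_linl (right_term_bil a)).
  by rewrite scalerBr opprD addrACA.
Qed.

Lemma left_term_gam w a y P :
  left_term w a (gam y P) = gam y (left_term w a P) +
    (2 * B (dd a) (od y)) *: gam (brk (ev w) (xx a)) P
    + (2 * B (brk (ev w) (xx a)) (od y)) *: gam (dd a) P.
Proof.
have hu : homog true (brk (ev w) (xx a)).
  exact: (brk_parity (spr_homog false w) (xx_gk hdeg a).1).
rewrite /left_term (gam_comm (dd a)) ((dd_gk hdeg a).1 : od (dd a) = dd a).
by rewrite (bilDr hgam) (bilZr hgam) gam_comm (hu : od _ = _) addrAC.
Qed.

Lemma ordered_term_gam u a y P : homog true u ->
  ordered_term u a (gam y P) = gam y (ordered_term u a P) +
    (2 * B (xx a) (od y)) *: gam u P + (2 * B u (od y)) *: gam (xx a) P.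
Proof.
move=> hu; have h1 := deg_proj_homog hB neg_deg hu; have h2 := deg_proj_homog hB pos_deg hu.
rewrite /ordered_term (gam_comm (xx a)) ((xx_gk hdeg a).1 : od (xx a) = xx a).
rewrite (gam_comm (ppos u)) (h2 : od _ = _) !(bilDr hgam) !(bilZr hgam).
rewrite (gam_comm (pneg u)) (h1 : od _ = _) (gam_comm (xx a) y).
rewrite ((xx_gk hdeg a).1 : od (xx a) = xx a).
have -> : gam u P = gam (pneg u) P + gam (ppos u) P.
  by rewrite -(bilDl hgam) (od_split hu).
have -> : B u (od y) = B (pneg u) (od y) + B (ppos u) (od y).
  by rewrite -{1}(od_split hu) (bilDl formB).
rewrite mulrDr scalerDl scalerDr.
by rewrite (AC (3*3) (((1*4)*(3*5))*(2*6))).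
Qed.

(** The commutator contains the basis expansion of [y], bracketed with [w], and that of [[w, y]]; by
    [od_basis_expand] each gives one half of the result. *)
Lemma spin_gam w y P :
  spin w (gam y P) = gam y (spin w P) + gam (brk (ev w) (od y)) P.
Proof.
set v := brk (ev w) (od y).
have hv : homog true v by exact: (brk_parity (spr_homog false w) (spr_homog true y)).
have [N1 h1] := spinE w P; have [N2 h2] := spinE w (gam y P).
have [N3 h3] := od_basis_expand y; have [N4 h4] := od_basis_expand v.
pose N := maxn (maxn N1 N2) (maxn N3 N4).
have {h3} h3 := h3 N ltac:(by rewrite !leq_max leqnn !orbT).
have {h4} h4 := h4 N ltac:(by rewrite !leq_max leqnn !orbT).
rewrite (h1 N) ?(h2 N) /N ?leq_max ?leqnn ?orbT // -/N.
rewrite (bilZr hgam) (bil_sumr hgam) (hv : od v = v) in h4 *.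
apply/eqP; rewrite addrC -subr_eq -scalerBr -sumrB; apply/eqP.
have two : (2 : K)^-1 * 2 = 1 by rewrite mulVf // pnatr_eq0.
have fE a : left_term w a (gam y P) - right_term w a (gam y P) -
    gam y (left_term w a P - right_term w a P) =
    2 *: (gam (brk (ev w) (B (dd a) (od y) *: xx a - B (xx a) (od y) *: dd a)) P +
          gam (B (dd a) v *: xx a - B (xx a) v *: dd a) P).
  have hu := brk_parity (spr_homog false w) (xx_gk hdeg a).1.
  have hu2 := brk_parity (spr_homog false w) (dd_gk hdeg a).1.
  rewrite left_term_gam /right_term (ordered_term_gam _ _ _ hu2).
  rewrite (brk_evenC (xx a) (spr_homog _ _)) (brk_evenC (dd a) (spr_homog _ _)).
  rewrite !(bilNl formB) !(form_inv hB) -/v.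
  rewrite -!(brk_evenC _ (spr_homog false w)).
  rewrite (bilBr brkB) !(bilZr brkB) !(bilBl hgam) !(bilZl hgam).
  rewrite (bilBr hgam) !mulrN !scaleNr !scalerDr !scalerN !scalerA.
  move: (gam y (left_term _ _ _)) (gam y (ordered_term _ _ _)) => L R.
  move: (_ *: gam (brk _ (xx a)) P) (_ *: gam (brk _ (dd a)) P) => G1 G2.
  move: (_ *: gam (dd a) P) (_ *: gam (xx a) P) => G3 G4.
  rewrite !opprD !opprK (AC (3*3*2) (((2*5)*(6*3))*((1*7)*(4*8)))) /=.
  by rewrite subrr addNr !addr0.
rewrite (eq_bigr _ (fun a _ => fE a)) -scaler_sumr scalerA two scale1r big_split /=.
rewrite -!(bil_suml hgam) -(bil_sumr brkB) h3 h4 (bilZr brkB) -/v -(bilDl hgam).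
by rewrite -scalerDl -mulr2n -[_ *+ 2]mulr_natr two scale1r.
Qed.

Lemma left_term_one w a : left_term w a one = 0.
Proof.
by rewrite /left_term (gam_one (dd_gk hdeg a)) ?(bil0r hgam).
Qed.

(** For [0 <= k] normal ordering puts an annihilator of the vacuum on the right of every term. *)
Lemma spin_one k w : gk false k w -> 0 <= k -> spin w one = 0.
Proof.
move=> hw k0; have [N h] := spinE w one; rewrite (h N) // big1 ?scaler0 // => a _.
rewrite left_term_one sub0r /right_term (hw.1 : ev w = w) /ordered_term.
have hwd := gk_brk hw (dd_gk hdeg a); have a0 := deg_gt0 hdeg a.
rewrite !(deg_proj_dg hB _ hwd.2) /neg_deg /pos_deg.
rewrite (_ : (k + deg a < 0) = false); last by apply/negbTE; lia.
rewrite (_ : (0 < k + deg a) = true); last by lia.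
by rewrite (bil0l hgam) add0r (gam_one hwd) ?(bil0r hgam) ?oppr0 //; lia.
Qed.

(** Moving [xx a] to the left costs a multiple of [B u (xx a)], which is 0 because both vectors have
    negative degree. *)
Lemma c0_spin w : c0 (spin w one) = 0.
Proof.
have [N h] := spinE w one; rewrite (h N) // (lmapZ hc0) (lmap_sum hc0) big1 ?scaler0 // => a _.
have a0 := deg_gt0 hdeg a.
have c0x P : c0 (gam (xx a) P) = 0.
  by apply: (c0_gam _ (xx_gk hdeg a)); lia.
rewrite left_term_one sub0r (lmapN hc0) /right_term /ordered_term (lmapD hc0) c0x addr0.
rewrite gam_comm (lmapD hc0) c0x add0r (lmapZ hc0) [c0 one as X in _ *: X]lock.
set u := pneg _.
have hu : homog true u.
  apply: (deg_proj_homog hB); exact: (brk_parity (spr_homog false w) (dd_gk hdeg a).1).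
rewrite (hu : od u = u) ((xx_gk hdeg a).1 : od (xx a) = xx a).
suff -> : B u (xx a) = 0 by rewrite mulr0 scale0r oppr0.
have : deg_part neg_deg u by have [] := deg_projP neg_deg (brk (ev w) (dd a)).
move=> /(deg_part_orth hB); apply; first exact: (xx_gk hdeg a).2.
by rewrite /neg_deg; lia.
Qed.

Lemma spin_ev w P : spin (ev w) P = spin w P.
Proof. by rewrite /spin /left_term /right_term !spr_orth. Qed.

(** Induction on polynomials: a factor [xx a] costs the term [gam [w, xx a]], which [gam_nil] kills
    for [w] of large degree. *)
Lemma spin_nil : restricted spin.
Proof.
move=> P.
suff [N hN] : exists N : nat, forall k : int, N%:Z < k ->
    forall w, gk false k w -> spin w P = 0.
  exists N => k kN w hw; rewrite -spin_ev; apply: hN kN _ _.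
  by split; [exact: spr_homog|exact: dg_spr].
move: P; apply: S_ind.
- split; first by exists 0%N => k _ w _; rewrite (bil0r spin_bil).
  move=> s u v [N1 h1] [N2 h2]; exists (maxn N1 N2) => k kN w hw.
  rewrite (bil_linr spin_bil) (h1 k) // ?(h2 k) ?scaler0 ?addr0 //; lia.
- by exists 0%N => k k0 w hw; apply: (spin_one hw); apply: ltW.
- move=> a P [N1 h1]; have [N2 h2] := gam_nil P.
  exists (N1 + N2 + deg a)%N => k kN w hw.
  rewrite spin_gam (h1 k) ?(bil0r hgam) ?add0r //; last by lia.
  rewrite (hw.1 : ev w = w) ((xx_gk hdeg a).1 : od (xx a) = xx a).
  have [_ hx] := gk_brk hw (xx_gk hdeg a).
  by apply: (h2 _ _ _ hx); lia.
Qed.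
End SpinAction.

(** * Tensor products *)
Section SubspaceType.
Variables (K : fieldType) (V : lmodType K) (P : set V).
Hypothesis sP : subspace P.

(** Turns a subspace into a module in its own right, to serve as target in the universal property of
    the tensor product; the ignored argument ties the predicate to its closure proof. *)
Definition subspace_pred (_ : subspace P) : {pred V} := fun x => `[< P x >].

Fact subspace_pred_closed : submod_closed (subspace_pred sP).
Proof.
split=> [|a u v]; first by apply/asboolP; apply: sub0.
by move=> /asboolP hu /asboolP hv; apply/asboolP; apply: sP.2.
Qed.

HB.instance Definition _ := GRing.isSubmodClosed.Build K V (subspace_pred sP)
  subspace_pred_closed.

Record subspace_type := SubspaceType {
  subspace_val :> V; subspace_valP : subspace_val \in subspace_pred sP }.
HB.instance Definition _ := [isSub for subspace_val].
HB.instance Definition _ := [Choice of subspace_type by <:].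
HB.instance Definition _ := [SubChoice_isSubLmodule of subspace_type by <:].
End SubspaceType.

Section TensorProducts.
Variables (K : fieldType) (V S : lmodType K) (T : tensorProduct V S).

Lemma tensB : bilinear_map (tens T). Proof. exact: tens_bilinear. Qed.

Lemma tens_eq (W : lmodType K) (F G : T -> W) : linear F -> linear G ->
  (forall v s, F (tens T v s) = G (tens T v s)) -> forall t, F t = G t.
Proof.
move=> hF hG h t.
have b : bilinear_map (fun v s => F (tens T v s)).
  split=> u; first exact: (linear_comp hF (bil_linr tensB u)).
  exact: (linear_comp hF (bil_linl tensB u)).
have [_ /(_ (lmap hF) (lmap hG))] := tens_universal T b; exact.
Qed.

(* Universality gives a retraction of T onto the subspace P. *)
Lemma tens_ind (P : set T) : subspace P -> (forall v s, P (tens T v s)) -> forall t, P t.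
Proof.
move=> sP hP t; pose U : lmodType K := subspace_type sP.
have hin v s : tens T v s \in subspace_pred sP by apply/asboolP.
pose f v s : U := SubspaceType (hin v s).
have bf : bilinear_map f.
  split=> u a x y; apply: val_inj; rewrite linearP /=.
    exact: (bil_linr tensB).
  exact: (bil_linl tensB).
have [[F hF] _] := tens_universal T bf.
have hv : linear (fun t => subspace_val (F t) : T).
  by move=> a x y; rewrite linearP; exact: (linearP (val : U -> T)).
have -> : t = subspace_val (F t).
  by apply: (tens_eq (F := id) _ hv) => // v s; rewrite hF.
exact/asboolP/(subspace_valP (F t)).
Qed.

Lemma tens_extend (W : lmodType K) (f : V -> S -> W) : bilinear_map f ->
  exists F : T -> W, linear F /\ forall v s, F (tens T v s) = f v s.
Proof. by move=> /(tens_universal T)[[F hF] _]; exists F; split=> //; exact: linearP. Qed.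

Section Tmap.
Variables (f : V -> V) (h : S -> S).
Hypotheses (hf : linear f) (hh : linear h).

(** Universality gives both the existence of the extension and the independence of the [xget] in
    [tmap] from the choice. *)
Lemma tmapP : linear (tmap (T := T) f h) /\
  forall v s, tmap f h (tens T v s) = tens T (f v) (h s).
Proof.
have b : bilinear_map (fun v s => tens T (f v) (h s)).
  split=> u; first exact: (linear_comp (bil_linr tensB _) hh).
  exact: (linear_comp (bil_linl tensB _) hf).
have [[F hF] uF] := tens_universal T b.
have E t : tmap f h t = F t.
  have : exists u, [set u | exists F : {linear T -> T},
      (forall v s, F (tens T v s) = tens T (f v) (h s)) /\ u = F t] u.
    by exists (F t), F.
  move=> /(@xgetPex _ 0)[G [hG]]; rewrite -/(tmap f h t) => ->.
  by apply: uF => v s; rewrite hG hF.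
by split=> [a x y|v s]; rewrite !E ?linearP ?hF.
Qed.
Lemma tmap_lin : linear (tmap (T := T) f h). Proof. by case: tmapP. Qed.
Lemma tmap_tens v s : tmap f h (tens T v s) = tens T (f v) (h s).
Proof. by case: tmapP. Qed.
End Tmap.

Lemma linear_id (W : lmodType K) : linear (@id W). Proof. by []. Qed.

Lemma tmap_left_bil (G : lmodType K) (A : G -> V -> V) : bilinear_map A ->
  bilinear_map (fun x (t : T) => tmap (A x) id t).
Proof.
move=> hA; have hl x := tmap_lin (bil_linr hA x) (@linear_id S).
split=> [x|t a x y]; first exact: hl.
apply: (tens_eq (hl _) (linear_add (linear_scale a (hl x)) (hl y))) => v s.
rewrite !(tmap_tens (bil_linr hA _) (@linear_id S)) (bil_linl hA).
exact: (bil_linl tensB).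
Qed.

Lemma tmap_right_bil (G : lmodType K) (A : G -> S -> S) : bilinear_map A ->
  bilinear_map (fun x (t : T) => tmap id (A x) t).
Proof.
move=> hA; have hl x := tmap_lin (@linear_id V) (bil_linr hA x).
split=> [x|t a x y]; first exact: hl.
apply: (tens_eq (hl _) (linear_add (linear_scale a (hl x)) (hl y))) => v s.
rewrite !(tmap_tens (@linear_id V) (bil_linr hA _)) (bil_linl hA).
exact: (bil_linr tensB).
Qed.

Lemma tmap_left_right (f : V -> V) (h : S -> S) (t : T) : linear f -> linear h ->
  tmap id h (tmap f id t) = tmap f id (tmap id h t).
Proof.
move=> hf hh.
have hl := tmap_lin hf (@linear_id S); have hr := tmap_lin (@linear_id V) hh.
move: t; apply: (tens_eq (linear_comp hr hl) (linear_comp hl hr)) => v s.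
by rewrite !(tmap_tens hf (@linear_id S), tmap_tens (@linear_id V) hh).
Qed.

End TensorProducts.

Section TensorRestricted.
Variables (K : numFieldType) (C : cartanDatum K) (g : contragredient C).
Variables (V S : lmodType K) (T : tensorProduct V S).

Definition restricted_on (U : lmodType K) (A : g -> U -> U) (t : U) : Prop :=
  exists N : nat, forall k : int, N%:Z < k -> forall x, dg k x -> A x t = 0.

Lemma restricted_on_sub (U : lmodType K) (A : g -> U -> U) :
  bilinear_map A -> subspace (restricted_on A).
Proof.
move=> hA; split; first by exists 0%N => k _ x _; rewrite (bil0r hA).
move=> s u v [N1 h1] [N2 h2]; exists (maxn N1 N2) => k kN x hx.
by rewrite (bil_linr hA) (h1 k) // ?(h2 k) ?scaler0 ?addr0 //; lia.
Qed.

Lemma tmap_left_restricted (A : g -> V -> V) : bilinear_map A ->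
  (forall v, restricted_on A v) ->
  forall t : T, restricted_on (fun x (t : T) => tmap (A x) id t) t.
Proof.
move=> hA hr; apply: tens_ind; first exact: (restricted_on_sub (tmap_left_bil T hA)).
move=> v s; have [N h] := hr v; exists N => k kN x hx.
rewrite (tmap_tens T (bil_linr hA x) (@linear_id _ S)) (h k kN x hx).
exact: (bil0l (tensB T)).
Qed.

Lemma tmap_right_restricted (A : g -> S -> S) : bilinear_map A ->
  (forall v, restricted_on A v) ->
  forall t : T, restricted_on (fun x (t : T) => tmap id (A x) t) t.
Proof.
move=> hA hr; apply: tens_ind; first exact: (restricted_on_sub (tmap_right_bil T hA)).
move=> v s; have [N h] := hr s; exists N => k kN x hx.
rewrite (tmap_tens T (@linear_id _ V) (bil_linr hA x)) (h k kN x hx).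
exact: (bil0r (tensB T)).
Qed.
End TensorRestricted.

(** * The vanishing criterion for operators commuting with the Clifford algebra *)

Section TensorFock.
Variables (K : numFieldType) (I : choiceType) (V : lmodType K).
Local Notation osc := (oscillator K I).
Local Notation ovar := (@ovar K I).
Local Notation mon1 := (@mone {cmonom I}).
Variable T : tensorProduct V osc.

Lemma monomial_coefficients : exists coef : {cmonom I} -> T -> V,
  (forall m, linear (coef m)) /\
  (forall m v P, coef m (tens T v P) = P@_m *: v).
Proof.
suff h m : exists F : T -> V, linear F /\ forall v P, F (tens T v P) = P@_m *: v.
  have /choice[coef hc] := h; exists coef.
  by split=> m; [exact: (hc m).1|exact: (hc m).2].
apply: (tens_extend T (f := fun v (P : osc) => P@_m *: v)).
split=> [v a P Q|P a u v]; first by rewrite mcoeffD mcoeffZ scalerDl scalerA.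
by rewrite scalerDr !scalerA mulrC.
Qed.

Variable coef : {cmonom I} -> T -> V.
Hypothesis hcoef : forall m, linear (coef m).
Hypothesis coefE : forall m v P, coef m (tens T v P) = P@_m *: v.

(** Each [t] is a finite sum of coefficients tensored with monomials; allowing any larger index set
    [D'] makes this property stable under sums. *)
Lemma coef_inj t : (forall m, coef m t = 0) -> t = 0.
Proof.
have [D h] : exists D : {fset {cmonom I}}, forall D' : {fset {cmonom I}},
    (D `<=` D')%fset -> t = \sum_(m <- D') tens T (coef m t) (<< m >> : osc).
  move: t; apply: tens_ind.
    split.
      exists fset0 => D' _; rewrite big1 // => m _.
      by rewrite (lmap0 (hcoef m)) (bil0l (tensB T)).
    move=> a u v [D1 h1] [D2 h2]; exists (D1 `|` D2)%fset => D'.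
    rewrite fsubUset => /andP[/h1 e1 /h2 e2].
    rewrite {1}e1 {1}e2 scaler_sumr -big_split; apply: eq_bigr => m _ /=.
    by rewrite hcoef (bil_linl (tensB T)).
  move=> v P; exists (msupp P) => D' PD.
  rewrite [in LHS](monalgEw PD) (bil_sumr (tensB T)); apply: eq_bigr => m _.
  rewrite coefE (bilZl (tensB T)) -(bilZr (tensB T)); congr (tens T v _).
  by apply: esym; apply: (etrans (scale_monom _ _ _)); rewrite mulr1.
move=> h0; rewrite (h D (fsubset_refl _)) big1 // => m _.
by rewrite h0 (bil0l (tensB T)).
Qed.

Lemma coef_oderiv a n t :
  coef n (tmap id (@oderiv K I a) t) = (n a).+1%:R *: coef (mulcm (ucm a) n) t.
Proof.
have hr := tmap_lin (T := T) (@linear_id _ V) (oderiv_lin a).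
move: t; apply: (tens_eq (linear_comp (hcoef n) hr) (linear_scale _ (hcoef _))) => v P.
rewrite (tmap_tens T (@linear_id _ V) (oderiv_lin a)) !coefE mcoeff_oderiv.
by rewrite scalerA.
Qed.

(** Up to a nonzero integer, each nonconstant coefficient of [t] is a coefficient of some derivative
    of [t]. *)
Lemma fock_vacuum t : (forall a, tmap id (@oderiv K I a) t = 0) -> coef mon1 t = 0 ->
  t = 0.
Proof.
move=> hd h1; apply: coef_inj => m; case: (pselect (m = mon1)) => [->//|].
move=> /monom_neq1[a [n ->]].
have := coef_oderiv a n t; rewrite hd (lmap0 (hcoef n)) => /esym/eqP.
by rewrite scaler_eq0 pnatr_eq0 /= => /eqP.
Qed.

(** [1] is killed by all derivations, hence so is the image of [v (x) 1], and [fock_vacuum] applies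
    to it. The variables produce all other tensors from these. *)
Lemma fock_eq0 (Delta : T -> T) : linear Delta ->
  (forall a t, Delta (tmap id (@oderiv K I a) t) = tmap id (@oderiv K I a) (Delta t)) ->
  (forall a t, Delta (tmap id (fun P => ovar a * P) t) =
    tmap id (fun P => ovar a * P) (Delta t)) ->
  (forall v, coef mon1 (Delta (tens T v 1)) = 0) -> forall t, Delta t = 0.
Proof.
move=> hD dD vD h1.
have hx a : linear (fun P : osc => ovar a * P).
  by move=> s x y; rewrite mulrDr scalerAr.
apply: (tens_ind (sub_ker hD)) => v.
have hS : subspace [set P : osc | Delta (tens T v P) = 0].
  exact: (sub_ker (linear_comp hD (bil_linr (tensB T) v))).
apply: (osc_ind_var hS) => [|a P hP].
  apply: fock_vacuum => // a; rewrite -dD (tmap_tens T (@linear_id _ V) (oderiv_lin a)).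
  by rewrite oderiv1 (bil0r (tensB T)) (lmap0 hD).
have := vD a (tens T v P); rewrite (tmap_tens T (@linear_id _ V) (hx a)) /mkset => ->.
by rewrite hP (lmap0 (tmap_lin (T := T) (@linear_id _ V) (hx a))).
Qed.
End TensorFock.

(** * Dirac operators on highest weight supermodules *)
Section SuperModules.
Variables (K : numFieldType) (C : cartanDatum K) (g : contragredient C).
Variable M : superModule g.

Lemma sact_rep b c (x y : g) (v : M) : homog b x -> homog c y ->
  sact x (sact y v) = sact (brk x y) v + (-1) ^+ (b && c) *: sact y (sact x v).
Proof. by move=> hx hy; rewrite (sact_brk _ hx hy) subrK. Qed.

End SuperModules.

(** This sign becomes the minus sign between the two terms of the Dirac operator. *)
Lemma dual_system_skew (K : fieldType) (V : lmodType K) (B : V -> V -> K) W W' s :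
  bilinear_map (W := K^o) B -> subspace W -> (forall x y, W x -> W' y -> B x y = - B y x) ->
  dual_system B W W' s -> dual_system B W' W [seq (p.2, - p.1) | p <- s].
Proof.
move=> hB sW skew [s1 s2 s3]; split.
- by move=> _ /mapP[p /s1[? ?] ->]; split=> //; apply: subN.
- move=> w hw; rewrite big_map {1}(s3 _ hw); apply: eq_big_seq => p /s1[h1 _] /=.
  by rewrite (bilNr hB) (skew _ _ h1 hw).
- move=> w hw; rewrite big_map {1}(s2 _ hw); apply: eq_big_seq => p /s1[_ h2] /=.
  by rewrite (skew _ _ hw h2) scalerN scaleNr.
Qed.

(** * A highest weight supermodule tensored with the oscillator module *)

Section Main.
Variables (K : numFieldType) (C : cartanDatum K) (g : contragredient C).
Variables (d : 'rV[K]_(cd_n C)) (B : g -> g -> K).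
Hypothesis hB : standard_form d B.
Hypothesis hd : symmetrizer d.
Variable rho : hdual C.
Hypothesis hrho : weyl_vector rho.
Variables (M : superModule g) (Lambda : hdual C).
Hypothesis hM : highest_weight_supermodule M Lambda.
Local Notation hh := (@ga_h K C g).
Local Notation formB := (form_bilinear hB).

Lemma highest_weight_ind (W : set M) : subspace W ->
  (forall x v, W v -> W (sact x v)) ->
  (forall v, (forall t, sact (hh t) v = (Lambda t : K) *: v) ->
     (forall k (x : g), 0 < k -> dg k x -> sact x v = 0) -> W v) ->
  forall v, W v.
Proof.
move=> sW hW hv v; case: hM => _ _ _ [v0 [[_ _] wt ann gen]].
apply: (gen W) => //; first by split=> // x u _; apply: hW.
apply: hv => [t|k x k0 hx]; first exact: wt.
by apply: ann => //; apply: (dg_deg_part hB (k := k)).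
Qed.

(** The highest weight vector is killed by all positive degrees, and acting by an element of degree
    [j] raises the bound by at most [|j|]. *)
Lemma sact_restricted : restricted (@sact K g M).
Proof.
have hsub := restricted_on_sub (@sact_bilinear K g M).
apply: (highest_weight_ind (W := restricted_on (@sact K g M))) => //.
- move=> x v hv; move: x; apply: gk_ind.
    exact: (sub_pre (bil_linl (@sact_bilinear K g M) v) hsub).
  move=> b j x hx; have [N h] := hv; exists (N + `|j|)%N => k kN.
  apply: dg_ind; first exact: (sub_ker (bil_linl (@sact_bilinear K g M) _)).
  move=> c y hy; rewrite /mkset (sact_rep _ hy.1 hx.1).
  rewrite (h _ _ _ (gk_brk hy hx).2); last by lia.
  by rewrite (h k _ _ hy.2) ?(bil0r (@sact_bilinear K g M)) ?scaler0 ?addr0 //; lia.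
- by move=> v _ hn; exists 0%N => k k0 x; apply: hn.
Qed.

Variables (I : choiceType) (xx dd : I -> g).
Hypothesis hbases : dual_odd_bases B xx dd.
Local Notation osc := (oscillator K I).
Variable T : tensorProduct M osc.
Variable deg : I -> nat.
Hypothesis hdeg : forall a,
  [/\ (0 < deg a)%N, gk true (deg a) (dd a) & gk true (- (deg a)%:Z) (xx a)].
Variable ls : nat -> seq I.
Hypothesis hls : forall k, uniq (ls k) /\ forall a, (a \in ls k) = (deg a == k).
Variable cs : bool -> int -> seq (g * g).
Hypothesis hcs : forall b k, dual_system B (gk b k) (gk b (- k)) (cs b k).
Variable coef : {cmonom I} -> T -> M.
Hypothesis hcoef : forall m, linear (coef m).
Hypothesis coefE : forall m v (P : osc), coef m (tens T v P) = P@_m *: v.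

Local Notation mon1 := (@mone {cmonom I}).
Local Notation gam0 := (gamS xx dd).
Local Notation spin0 := (spin xx dd gam0).

Definition t_act (x : g) (t : T) : T := tmap (@sact K g M x) id t.
Definition t_gam (y : g) (t : T) : T := tmap id (gam0 y) t.
Definition t_spin (w : g) (t : T) : T := tmap id (spin0 w) t.
Definition t_par (t : T) : T := tmap (@parity_sign K M) id t.
Definition t_vac (v : M) : T := tens T v 1.

Let sactB := @sact_bilinear K g M.
Let gamB := gamS_bil hB hbases.

Lemma gamS_one k y : gk true k y -> 0 <= k -> gam0 y 1 = 0.
Proof.
move=> hy k0; move: k0; rewrite le_eqVlt => /orP[/eqP k0|k0].
  have -> : y = 0 by apply: (gk_odd0 hB); rewrite k0.
  exact: (bil0l gamB).
rewrite (gamS_pos hB hbases hdeg hls 1 hy k0) big1 // => a _.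
by rewrite oderiv1; exact: scaler0.
Qed.

Lemma gamS_coef1 k y (P : osc) : gk true k y -> k < 0 -> (gam0 y P)@_mon1 = 0.
Proof.
move=> hy k0; rewrite (gamS_neg hB hbases hdeg hls P hy k0).
have hl := @mcoeff_lin K {cmonom I} mon1.
apply: (etrans (lmap_sum hl _ _ _)); rewrite big1 // => a _.
by apply: (etrans (lmapZ hl _ _)); rewrite mcoeff1_var scaler0.
Qed.

Lemma gamS_osc_ind (W : set osc) : subspace W -> W 1 ->
  (forall a P, W P -> W (gam0 (xx a) P)) -> forall P, W P.
Proof.
move=> sW h1 hW; apply: osc_ind_var => // a P hP.
by have := hW a P hP; rewrite (gamS_xx hB hbases hdeg).
Qed.

Let gamC := gamS_comm hB hbases hdeg.
Let gamN := gamS_nil hB hbases hdeg hls.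
Let c0L := @mcoeff_lin K {cmonom I} mon1.
Let spinB := spin_bil hB hdeg hls gamB gamN.
Let spinN := spin_nil hB hbases hdeg hls gamB gamC gamN gamS_one gamS_osc_ind.

Lemma t_act_bil : bilinear_map t_act. Proof. exact: (tmap_left_bil T sactB). Qed.
Lemma t_gam_bil : bilinear_map t_gam. Proof. exact: (tmap_right_bil T gamB). Qed.
Lemma t_spin_bil : bilinear_map t_spin. Proof. exact: (tmap_right_bil T spinB). Qed.
Lemma t_par_lin : linear t_par.
Proof. exact: (tmap_lin (@parity_sign_lin K M) (@linear_id K osc)). Qed.

Lemma t_actE x v (P : osc) : t_act x (tens T v P) = tens T (sact x v) P.
Proof. exact: (tmap_tens T (bil_linr sactB x) (@linear_id K osc)). Qed.
Lemma t_gamE y v (P : osc) : t_gam y (tens T v P) = tens T v (gam0 y P).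
Proof. exact: (tmap_tens T (@linear_id K M) (bil_linr gamB y)). Qed.
Lemma t_spinE w v (P : osc) : t_spin w (tens T v P) = tens T v (spin0 w P).
Proof. exact: (tmap_tens T (@linear_id K M) (bil_linr spinB w)). Qed.
Lemma t_parE v (P : osc) : t_par (tens T v P) = tens T (parity_sign v) P.
Proof. exact: (tmap_tens T (@parity_sign_lin K M) (@linear_id K osc)). Qed.

Let actL x := bil_linr t_act_bil x.
Let gamL x := bil_linr t_gam_bil x.
Let spinL x := bil_linr t_spin_bil x.
Let tb := tensB T.

Lemma t_act_rep b c x y t : homog b x -> homog c y ->
  t_act x (t_act y t) = t_act (brk x y) t + (-1) ^+ (b && c) *: t_act y (t_act x t).
Proof.
move=> hx hy; move: t; apply: (tens_eq (linear_comp (actL x) (actL y))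
  (linear_add (actL _) (linear_scale _ (linear_comp (actL y) (actL x))))) => v P.
by rewrite !t_actE (sact_rep _ hx hy) (bilDl tb) (bilZl tb).
Qed.

Lemma t_gam_act y x t : t_gam y (t_act x t) = t_act x (t_gam y t).
Proof. exact: (tmap_left_right _ (bil_linr sactB x) (bil_linr gamB y)). Qed.

Lemma t_spin_act w x t : t_spin w (t_act x t) = t_act x (t_spin w t).
Proof. exact: (tmap_left_right _ (bil_linr sactB x) (bil_linr spinB w)). Qed.

Lemma t_gam_par y t : t_gam y (t_par t) = t_par (t_gam y t).
Proof. exact: (tmap_left_right _ (@parity_sign_lin K M) (bil_linr gamB y)). Qed.

Lemma linear_scaler (U : lmodType K) (c : K) : linear (fun u : U => c *: u).
Proof. by move=> a u v; rewrite scalerDr !scalerA mulrC. Qed.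

Lemma t_gam_gam y z t : homog true y -> homog true z ->
  t_gam y (t_gam z t) = t_gam z (t_gam y t) + (2 * B y z) *: t.
Proof.
move=> hy hz; move: t; apply: (tens_eq (linear_comp (gamL y) (gamL z))
  (linear_add (linear_comp (gamL z) (gamL y)) (@linear_scaler T _))) => v P.
rewrite !t_gamE gamC (hy : spr g true y = y) (hz : spr g true z = z).
by rewrite (bilDr tb) (bilZr tb).
Qed.

Lemma t_spin_gam w y t : homog false w -> homog true y ->
  t_spin w (t_gam y t) = t_gam y (t_spin w t) + t_gam (brk w y) t.
Proof.
move=> hw hy; move: t; apply: (tens_eq (linear_comp (spinL w) (gamL y))
  (linear_add (linear_comp (gamL y) (spinL w)) (gamL _))) => v P.
rewrite !(t_gamE, t_spinE) (spin_gam hB hbases hdeg hls gamB gamC gamN).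
by rewrite (hw : spr g false w = w) (hy : spr g true y = y) (bilDr tb).
Qed.

Lemma t_act_nil : restricted t_act.
Proof. exact: tmap_left_restricted sactB sact_restricted. Qed.
Lemma t_gam_nil : restricted t_gam.
Proof. exact: tmap_right_restricted gamB gamN. Qed.
Lemma t_spin_nil : restricted t_spin.
Proof. exact: tmap_right_restricted spinB spinN. Qed.

Lemma t_gam_vac k u v : gk true k u -> 0 <= k -> t_gam u (t_vac v) = 0.
Proof. by move=> hu k0; rewrite t_gamE (gamS_one hu k0) (bil0r tb). Qed.

Lemma t_spin_vac k w v : gk false k w -> 0 <= k -> t_spin w (t_vac v) = 0.
Proof.
move=> hw k0; rewrite t_spinE.
by rewrite (spin_one hB hdeg hls gamB gamN gamS_one hw k0) (bil0r tb).
Qed.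

Lemma t_coef_gam k u t : gk true k u -> k < 0 -> coef mon1 (t_gam u t) = 0.
Proof.
move=> hu k0; move: t; apply: (tens_ind (sub_ker (linear_comp (hcoef mon1) (gamL u)))) => v P.
by rewrite /mkset t_gamE coefE (gamS_coef1 _ hu k0) scale0r.
Qed.

Lemma t_coef_vac v : coef mon1 (t_vac v) = v.
Proof. by rewrite coefE mcoeff1 eqxx scale1r. Qed.

Lemma t_coef_spin w v : homog false w -> coef mon1 (t_spin w (t_vac v)) = 0.
Proof.
move=> hw; rewrite t_spinE coefE.
have := c0_spin hB hdeg hls gamB c0L gamC gamN gamS_one.
by move=> /(_ gamS_coef1 w) ->; rewrite scale0r.
Qed.


Lemma t_coef_act x t : coef mon1 (t_act x t) = sact x (coef mon1 t).
Proof.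
move: t; apply: (tens_eq (linear_comp (hcoef mon1) (actL x))
  (linear_comp (bil_linr sactB x) (hcoef mon1))) => v P.
by rewrite t_actE !coefE (bilZr sactB).
Qed.

Lemma t_fock (Delta : T -> T) : linear Delta ->
  (forall k z t, gk true k z -> Delta (t_gam z t) = t_gam z (Delta t)) ->
  (forall v, coef mon1 (Delta (t_vac v)) = 0) -> forall t, Delta t = 0.
Proof.
move=> hD hg h1; apply: (fock_eq0 hcoef coefE hD) => //.
- move=> a t; have E u : tmap id (@oderiv K I a) u = t_gam (dd a) u.
    rewrite /t_gam; congr (tmap id _ u); apply/funext => P.
    by rewrite (gamS_dd hB hbases hdeg).
  by rewrite !E (hg _ _ _ (dd_gk hdeg a)).
- move=> a t; have E u : tmap id (fun P => ovar K a * P) u = t_gam (xx a) u.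
    rewrite /t_gam; congr (tmap id _ u); apply/funext => P.
    by rewrite (gamS_xx hB hbases hdeg).
  by rewrite !E (hg _ _ _ (xx_gk hdeg a)).
Qed.

Lemma t_casimir t : casimir B cs rho t_act t =
  (B (sharp B Lambda) (sharp B Lambda) + 2 * B (sharp B rho) (sharp B Lambda)) *: t.
Proof.
set c := (X in X *: _).
have cL := casimir_lin hcs rho t_act_bil t_act_nil.
move: t; apply: (tens_eq cL (@linear_scaler T c)) => v P; move: v.
have hP := bil_linl tb P.
apply: (highest_weight_ind (W := [set v | casimir B cs rho t_act (tens T v P) = c *: tens T v P])).
- exact: (sub_eq (linear_comp cL hP) (linear_comp (@linear_scaler T c) hP)).
- move=> x v hv; rewrite /mkset -t_actE.
  rewrite (casimir_comm hB hd hcs hrho t_act_bil t_act_rep t_act_nil) hv.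
  by rewrite (bilZr t_act_bil).
- move=> v hl hn; apply: (casimir_highest hB hcs rho t_act_bil).
    by move=> s; rewrite t_actE hl (bilZl tb).
  by move=> k x k0 hx; rewrite t_actE (hn _ _ k0 hx) (bil0l tb).
Qed.

(** * The Dirac operator in terms of canonical tensors, and its square *)

Local Notation D0 := (dirac0 cs t_act t_gam).
Let D0_lin := dirac0_lin hcs t_act_bil t_gam_bil t_gam_act t_act_nil t_gam_nil.

Lemma odd_tensor_actE y z t : homog true z ->
  odd_tensor_act xx dd y z t = t_act y (t_gam z (t_par t)).
Proof.
move=> hz; have E : cliff xx dd z = gam0 z by apply/funext => P; rewrite -gamSE.
have hf := linear_comp (bil_linr sactB y) (@parity_sign_lin K M).
have hg := bil_linr gamB z.
rewrite /odd_tensor_act E.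
move: t; apply: (tens_eq (tmap_lin (T := T) hf hg)
  (linear_comp (actL y) (linear_comp (gamL z) t_par_lin))) => v P.
by rewrite (tmap_tens T hf hg) t_parE t_gamE t_actE.
Qed.

(** In degree [k > 0] the bases give the system [(dd a, 2 xx a)], and in degree [- k], by skewness,
    [(2 xx a, - dd a)]; uniqueness of the tensor puts them in place of [cs]. Their factor 2 is the
    prefactor of [dirac]. *)
Lemma dirac_dirac0 t : dirac xx dd t = D0 (t_par t).
Proof.
set u := t_par t.
have [N1 h1] := t_gam_nil u; have [N2 h2] := t_act_nil u.
pose N := maxn N1 N2.
have hN1 (k : int) x : N%:Z < k -> dg k x -> t_gam x u = 0.
  by move=> kN; apply: h1; lia.
have hN2 (k : int) x : N%:Z < k -> dg k x -> t_act x u = 0.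
  by move=> kN; apply: h2; lia.
have hTa a : odd_tensor_act xx dd (xx a) (dd a) t - odd_tensor_act xx dd (dd a) (xx a) t =
    t_act (xx a) (t_gam (dd a) u) - t_act (dd a) (t_gam (xx a) u).
  by rewrite (odd_tensor_actE _ _ (dd_gk hdeg a).1) (odd_tensor_actE _ _ (xx_gk hdeg a).1).
rewrite /dirac (isumE hdeg hls (N := N)); last first.
  move=> a aN; rewrite hTa (hN1 _ _ _ (dd_gk hdeg a).2) // (bil0r t_act_bil).
  by rewrite -t_gam_act (hN2 _ _ _ (dd_gk hdeg a).2) // (bil0r t_gam_bil) subr0.
rewrite (eq_bigr _ (fun a _ => hTa a)) big_upto.
rewrite /dirac0 (@zsumE _ _ _ N); last first.
  move=> k kN; rewrite big1_seq // => p /= /[dup] /(cs1 hcs)[_ p1] /(cs2 hcs)[_ p2].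
  case: (ltrP 0 k) => k0; first by rewrite (hN1 _ _ _ p1) ?(bil0r t_act_bil) //; lia.
  by rewrite -t_gam_act (hN2 _ _ _ p2) ?(bil0r t_gam_bil) //; lia.
have hPhi : bilinear_map (fun x y => t_act x (t_gam y u)).
  split=> w; first exact: (linear_comp (actL w) (bil_linl t_gam_bil u)).
  exact: (bil_linl t_act_bil).
rewrite /zrange big_cons (cs_odd0 hB hcs hPhi) add0r big_cat !big_map /= -big_split /=.
rewrite scaler_sumr /index_iota subSS subn0.
apply: eq_big_seq => k; rewrite mem_iota => /andP[k0 _] /=.
have lsd := ls_dual_system hB hbases hdeg hls k0.
rewrite (dual_system_unique hPhi (hcs true k) lsd) big_map /=.
have skew x y : gk true k x -> gk true (- k%:Z) y -> B x y = - B y x.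
  by move=> [hx _] [hy _]; exact: (form_odd hB).
have lsd' := dual_system_skew formB (gk_sub g true k) skew lsd.
have hc := hcs true (- k%:Z); rewrite opprK in hc.
rewrite (dual_system_unique hPhi hc lsd') !big_map /=.
rewrite -big_split scaler_sumr; apply: eq_bigr => a _ /=.
by rewrite (bilZl t_act_bil) (bilNl t_act_bil) (bilZl t_gam_bil) (bilZr t_act_bil) -scalerBr.
Qed.

Lemma t_parK t : t_par (t_par t) = t.
Proof.
move: t; apply: (tens_eq (linear_comp t_par_lin t_par_lin) (@linear_id K T)) => v P.
rewrite !t_parE; congr (tens T _ P); move: v; apply: homog_ind.
  exact: (sub_eq (linear_comp (@parity_sign_lin K M) (@parity_sign_lin K M)) (@linear_id K M)).
move=> b v hv; rewrite /mkset (parity_signE hv) (lmapZ (@parity_sign_lin K M)).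
by rewrite (parity_signE hv) scalerA -expr2 sqrr_sign scale1r.
Qed.

Lemma t_par_act x t : homog true x -> t_par (t_act x t) = - t_act x (t_par t).
Proof.
move=> hx; rewrite -scaleN1r; move: t.
apply: (tens_eq (linear_comp t_par_lin (actL x))
  (linear_scale _ (linear_comp (actL x) t_par_lin))) => v P.
rewrite !(t_parE, t_actE) -(bilZl tb); congr (tens T _ P); move: v; apply: homog_ind.
  exact: (sub_eq (linear_comp (@parity_sign_lin K M) (bil_linr sactB x))
    (linear_scale _ (linear_comp (bil_linr sactB x) (@parity_sign_lin K M)))).
move=> b v hv; rewrite /mkset (parity_signE hv) (parity_signE (sact_parity hx hv)).
by rewrite (bilZr sactB) scalerA; case: (b); rewrite /= ?mulrNN ?mulr1 ?expr0 ?expr1 ?mulN1r ?opprK.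
Qed.

Lemma t_par_dirac0 t : t_par (D0 t) = - D0 (t_par t).
Proof.
have hfin := dirac0_fin hcs t_act_bil t_gam_bil t_gam_act t_act_nil t_gam_nil.
rewrite /dirac0 (zsum_lin t_par_lin (hfin t)) -scaleN1r.
rewrite (zsum_lin (@linear_scaler T (-1)) (hfin _)).
apply: zsum_ext => k; rewrite (lmap_sum t_par_lin) scaler_sumr.
apply: eq_big_seq => p /(cs2 hcs)[hp _] /=.
by rewrite (t_par_act _ hp) -t_gam_par scaleN1r.
Qed.

(** Odd elements reverse the parity of [M], so [D0] anticommutes with the involution [t_par], whence
    the minus sign. *)
Lemma dirac_sqE t : dirac xx dd (dirac xx dd t) = - D0 (D0 t).
Proof. by rewrite !dirac_dirac0 t_par_dirac0 t_parK (lmapN D0_lin). Qed.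

Lemma hext_eq (l : hdual C) (x : g) t : deg_part (fun k => k != 0) (x - hh t) -> hext l x = l t.
Proof.
move=> hx; rewrite /hext; congr (l _).
have hs := @xgetPex _ 0 [set t | deg_part (fun k => k != 0) (x - hh t)] (ex_intro _ t hx).
set s := xget _ _ in hs *.
apply/eqP; rewrite -subr_eq0; apply/eqP; apply: (@ga_h_inj _ _ g).
have hl := ga_h_lin g.
rewrite (lmapB hl); apply: (deg_part_disj hB (Q := fun k => k != 0)).
  have -> : hh s - hh t = (x - hh t) - (x - hh s) by rewrite opprB [RHS]addrC addrA subrK.
  exact: (subB (deg_part_sub g _)).
rewrite -(lmapB hl); apply: (dg_deg_part hB (k := 0)) => //.
exact: (gk_h g _).2.
Qed.

Lemma hext_h (l : hdual C) t : hext l (hh t) = l t.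
Proof. by apply: hext_eq; rewrite subrr; apply: (sub0 (deg_part_sub g _)). Qed.

Lemma hext_dg (l : hdual C) k (x : g) : k != 0 -> dg k x -> hext l x = 0.
Proof.
move=> k0 hx; rewrite -(linear0 l); apply: hext_eq.
rewrite (lmap0 (ga_h_lin g)) subr0.
exact: (dg_deg_part hB (Q := fun k => k != 0) k0 hx).
Qed.

Lemma normal_orderE y z (P : osc) : homog true y -> homog true z ->
  normal_order xx dd y z P =
  gam0 (deg_proj neg_deg y) (gam0 (deg_proj neg_deg z) P)
  + gam0 (deg_proj neg_deg y) (gam0 (deg_proj pos_deg z) P)
  + gam0 (deg_proj neg_deg z) (gam0 (deg_proj pos_deg y) P)
  + gam0 (deg_proj pos_deg y) (gam0 (deg_proj pos_deg z) P).
Proof.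
move=> hy hz; have hc Q x : homog true x -> cliff xx dd (deg_proj Q x) = gam0 (deg_proj Q x).
  by move=> hx; apply/funext => R; rewrite -gamSE //; apply: (deg_proj_homog hB).
by rewrite /normal_order !hc.
Qed.

Lemma osc_actE rho1 w (P : osc) : homog false w ->
  osc_act xx dd rho1 w P = spin0 w P - hext rho1 w *: P.
Proof.
move=> hw; have hL a : normal_order xx dd (brk w (xx a)) (dd a) P = left_term xx dd gam0 w a P.
  have ho : homog true (brk w (xx a)) := brk_parity hw (xx_gk hdeg a).1.
  rewrite (normal_orderE _ ho (dd_gk hdeg a).1) (pneg_dd hB hdeg) (ppos_dd hB hdeg).
  rewrite /left_term (hw : spr g false w = w) -[in RHS](od_split hB ho).
  by rewrite (bilDl gamB) !(bil0l gamB) (bil0r gamB) add0r addr0.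
have hR a : normal_order xx dd (brk w (dd a)) (xx a) P = right_term xx dd gam0 w a P.
  have ho : homog true (brk w (dd a)) := brk_parity hw (dd_gk hdeg a).1.
  rewrite (normal_orderE _ ho (xx_gk hdeg a).1) (pneg_xx hB hdeg) (ppos_xx hB hdeg).
  rewrite /right_term /ordered_term (hw : spr g false w = w).
  by rewrite (bil0l gamB) !(bil0r gamB) !addr0.
pose sums (F G : I -> osc) : osc := 2^-1 *: (\sum_(a \in [set: I]) F a)
  - 2^-1 *: (\sum_(a \in [set: I]) G a) - hext rho1 w *: P.
exact: (f_equal2 sums (funext hL) (funext hR)).
Qed.

Local Notation diag w t := (t_act w t + t_spin w t).
Let diagB : bilinear_map (fun w t => diag w t).
Proof.
split=> u; apply: linear_add; [exact: actL|exact: spinL|exact: (bil_linl t_act_bil)|].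
exact: (bil_linl t_spin_bil).
Qed.

Lemma diag_actE rho1 w t : homog false w ->
  diag_act xx dd rho1 w t = diag w t - hext rho1 w *: t.
Proof.
move=> hw; rewrite /diag_act -addrA; congr (_ + _).
have E : osc_act xx dd rho1 w = fun P => spin0 w P - hext rho1 w *: P.
  by apply/funext => P; apply: osc_actE.
have hl : linear (osc_act xx dd rho1 w).
  rewrite E; exact: (linear_sub (bil_linr spinB w) (@linear_scaler osc _)).
move: t; apply: (tens_eq (tmap_lin (T := T) (@linear_id K M) hl)
  (linear_sub (spinL w) (@linear_scaler T _))) => v P.
rewrite (tmap_tens T (@linear_id K M) hl) t_spinE.
apply: (etrans (congr1 (tens T v) (osc_actE rho1 P hw))).
apply: (etrans (bilBr tb _ _ _)); congr (_ - _); exact: (bilZr tb).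
Qed.

Lemma dirac0_even w t : homog false w -> D0 (diag w t) = diag w (D0 t).
Proof.
move=> hw; rewrite -hw; move: w {hw} t.
apply: (gk_ind (P := [set w | forall t, D0 (diag (spr g false w) t) = diag (spr g false w) (D0 t)])).
  have h t := sub_eq (linear_comp D0_lin (linear_comp (bil_linl diagB t) (linearP (spr g false))))
    (linear_comp (bil_linl diagB (D0 t)) (linearP (spr g false))).
  by split=> [t|a u v hu hv t]; [exact: (h t).1|apply: (h t).2].
move=> b k w hw t; rewrite (homog_sprE _ hw.1); case: b hw => hw /=.
  by rewrite !(bil0l diagB) (lmap0 D0_lin).
exact: (dirac0_diag hB hcs t_act_bil t_gam_bil t_spin_bil t_act_rep t_gam_act t_spin_act
  t_spin_gam t_act_nil t_gam_nil t hw).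
Qed.

(** Completes the square in [(l, l + 2 rho)]; the constant [(rho, rho)] cancels in the difference of
    two such values. *)
Lemma form_shift (l : hdual C) : dual_form B (l + rho) (l + rho) =
  B (sharp B l) (sharp B l) + 2 * B (sharp B rho) (sharp B l) + B (sharp B rho) (sharp B rho).
Proof.
have sD : sharp B (l + rho) = sharp B l + sharp B rho.
  by rewrite -[l in LHS]scale1r (sharp_lin hB hcs) scale1r.
rewrite /dual_form -/(sharp B (l + rho)) sD (bilDl formB) !(bilDr formB).
rewrite (form_even hB (gk_sharp B l).1 (gk_sharp B rho).1).
by rewrite mulr_natl mulr2n !addrA.
Qed.

Lemma dirac_sq_scalar rho0 (V : set T) mu :
  highest_weight (diag_act xx dd (rho0 - rho)) (homog false) V mu ->
  forall t, V t -> dirac xx dd (dirac xx dd t) =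
    (dual_form B (Lambda + rho) (Lambda + rho)
     - dual_form B (mu + rho0) (mu + rho0)) *: t.
Proof.
move=> [_ _ _ [v [_ wt ann gen]]].
pose kappa := dual_form B (Lambda + rho) (Lambda + rho) - dual_form B (mu + rho0) (mu + rho0).
(* The action on [V] contains the shift [- (rho0 - rho)]; removing it adds this functional to the
   weight. *)
pose l : hdual C := mu + (rho0 - rho).
have lE : l + rho = mu + rho0 by rewrite /l -addrA subrK.
have hsq : D0 (D0 v) = - kappa *: v.
  rewrite (dirac0_sq_highest hB hd hcs hrho sactB t_act_bil t_gam_bil t_spin_bil
    (hcoef mon1) t_act_rep t_gam_act t_spin_act t_gam_gam t_spin_gam t_act_nil t_gam_nil
    t_spin_nil t_gam_vac t_spin_vac t_coef_gam t_coef_vac t_coef_spin t_coef_act t_fock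
    (l := l) (t_casimir v)).
  - congr (_ *: _); rewrite /kappa -lE !form_shift opprB.
    by rewrite [in RHS]opprD [in RHS]addrACA subrr addr0.
  - move=> s; have := wt s; rewrite (diag_actE _ _ (homog_h g s)) hext_h.
    by move=> /eqP; rewrite subr_eq -scalerDl => /eqP ->; rewrite /l add_lfunE.
  (* [hext] vanishes in nonzero degrees, so raising vectors kill [v] for the unshifted action
     too. *)
  - move=> k w k0 hw; have := ann w hw.1 (dg_deg_part hB k0 hw.2).
    by rewrite (diag_actE _ _ hw.1) (hext_dg _ _ hw.2) ?scale0r ?subr0 // gt_eqF.
apply: (gen [set t | dirac xx dd (dirac xx dd t) = kappa *: t]); last first.
  by rewrite /mkset dirac_sqE hsq scaleNr opprK.
have sW : subspace [set t | D0 (D0 t) = - kappa *: t].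
  exact: (sub_eq (linear_comp D0_lin D0_lin) (@linear_scaler T _)).
have WE t : (dirac xx dd (dirac xx dd t) = kappa *: t) <-> D0 (D0 t) = - kappa *: t.
  rewrite dirac_sqE scaleNr; split=> [<-|->]; first by rewrite opprK.
  by rewrite opprK.
split; first by split=> [|a u w /WE hu /WE hw]; apply/WE; [exact: sW.1|exact: sW.2].
(* The shift is by a scalar, so [D0] commutes with the shifted action as well. *)
move=> w u hw /WE hu; apply/WE; rewrite (diag_actE _ _ hw).
rewrite !(lmapB D0_lin) !(lmapZ D0_lin) !(dirac0_even _ hw) hu.
rewrite (bilZr t_act_bil) (bilZr t_spin_bil) -scalerDr [RHS]scalerBr.
by congr (_ - _); rewrite !scalerA mulrC.
Qed.
End Main.

Theorem proposition85 (R : realType)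
  (C : cartanDatum R[i]) (g : contragredient C) (hg : kac_moody g)
  (d : 'rV[R[i]]_(cd_n C)) (hd : symmetrizer d)
  (B : g -> g -> R[i]) (hB : standard_form d B)
  (hreal : forall i j,
     dual_form B (cd_alpha i) (cd_alpha j) \is Num.real)
  (rho rho0 : hdual C)
  (hrho : weyl_vector rho) (hrho0 : kac_peterson_primitive g rho0)
  (I : choiceType) (xx dd : I -> g) (hbases : dual_odd_bases B xx dd)
  (M : superModule g) (Lambda : hdual C)
  (hM : highest_weight_supermodule M Lambda)
  (T : tensorProduct M (oscillator R[i] I))
  (V : set T) (mu : hdual C)
  (hV : highest_weight (diag_act xx dd (rho0 - rho)) (homog false) V mu) :
  (forall v : T, V v ->
     dirac xx dd (dirac xx dd v) =
       (dual_form B (Lambda + rho) (Lambda + rho)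
        - dual_form B (mu + rho0) (mu + rho0)) *: v) /\
  ((forall v : T, V v -> dirac xx dd (dirac xx dd v) = 0) <->
   dual_form B (Lambda + rho) (Lambda + rho)
     = dual_form B (mu + rho0) (mu + rho0)).
Proof.
have [cs hcs] := form_dual_systems hB.
have [deg hdeg] := dual_basis_deg hB hbases.
have [ls hls] := dual_basis_finite hB hbases hdeg.
have [coef [hcoef coefE]] := monomial_coefficients T.
have key := dirac_sq_scalar hB hd hrho hM hbases hdeg hls hcs hcoef coefE hV.
split=> //; have [_ _ _ [v [[Vv v0] _ _ _]]] := hV.
split=> [h0|E t Vt]; last by rewrite (key _ Vt) E subrr scale0r.
have := h0 v Vv; rewrite (key _ Vv) => /eqP.
by rewrite scaler_eq0 (negbTE v0) orbF subr_eq0 => /eqP.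
Qed.
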